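(* Consider the $N$-firm irreversible investment (oligopoly) game described in the context, where firm $i$ chooses an investment strategy $\xi^i$ to maximize the net profit $$P^i(\xi^i,\xi^{-i}):=\mathbb{E}\Big[\int_0^Te^{-\rho t}\alpha^iX_t^i\Big(X_t^0-\gamma\sum_{j=1}^N\alpha^jX_t^j\Big)dt-c^i\int_{[0,T]}e^{-\rho t}d\xi_t^i\Big].$$ Then there exists an $\mathbb{F}^0$-adapted Nash equilibrium, i.e. a vector $\xi=(\xi^1,\dots,\xi^N)$ of $\mathbb{F}^0$-adapted investment strategies such that, for every $i=1,\dots,N$, $P^i(\xi^i,\xi^{-i})\geq P^i(\bar\xi^i,\xi^{-i})$ for every investment strategy $\bar\xi^i$ of firm $i$.
   Context: Fix $N\in\mathbb{N}$, $N\geq2$, and $T\in(0,\infty)$. On a complete probability space $(\Omega,\mathcal{F},\mathbb{P})$ with a one-dimensional Brownian motion $W^0$, the demand process $X^0$ solves $$dX_t^0=\mu^0(t,X_t^0)dt+\sigma^0(t,X_t^0)dW_t^0,\quad X_0^0=x_0^0\in\mathbb{R},$$ where $\mu^0,\sigma^0:[0,T]\times\mathbb{R}\to\mathbb{R}$ are Lipschitz continuous and $0<\underline\sigma\leq\sigma^0(t,x)\leq\bar\sigma$ for all $t\in[0,T]$, $x\in\mathbb{R}$, for some constants $\underline\sigma,\bar\sigma\in\mathbb{R}$. $\mathbb{F}^0=(\mathcal{F}^0_t)_t$ is the right-continuous extension of the filtration generated by $W^0$, augmented by the $\mathbb{P}$-null sets. An investment strategy is an $\mathbb{F}^0$-adapted,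 nonnegative, nondecreasing, càdlàg process $\xi^i$ on $[0,T]$ with $\mathbb{E}[\xi_T^i]<\infty$. The capital stock of firm $i$ evolves as $$dX_t^i=-\delta^iX_t^idt+d\xi_t^i,\quad X_{0-}^i=x_0^i\geq0,$$ with constant $\delta^i>0$. The constants $\alpha^i>0$, $c^i>0$ ($i=1,\dots,N$), $\gamma>0$ and $\rho>0$ are given. Here $\xi^{-i}=(\xi^j)_{j\neq i}$, and $\int_{[0,T]}f_t\,d\xi_t:=f_0\xi_0+\int_0^Tf_t\,d\xi_t$, the last integral being over $(0,T]$. *)

(* Defs.v *)
From HB Require Import structures.
From mathcomp Require Import all_boot all_order all_algebra.
From mathcomp Require Import all_classical all_reals all_analysis.
Import Order.TTheory GRing.Theory Num.Theory.
Import numFieldNormedType.Exports.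

Set Implicit Arguments.
Unset Strict Implicit.
Unset Printing Implicit Defensive.

Local Open Scope classical_set_scope.
Local Open Scope ring_scope.

(* Processes are functions X : R -> Omega -> R, with X t w the value at time t
   in state w; only times in [0, T] are ever used. *)

Section paths.
Context {R : realType}.
Implicit Types (T t : R) (f : R -> R).

Definition cadlag T f :=
  (forall t : R, t \in `[0, T[ -> f s @[s --> t^'+] --> f t) /\
  (forall t : R, t \in `]0, T] -> cvg (f s @[s --> t^'-])).

Definition clamp T t : R := Num.max 0 (Num.min t T).

End paths.

Section filtrations.
Context {R : realType} {d : measure_display} {Omega : measurableType d}.
Variables (P : probability Omega R) (T : R).
Implicit Types (W X : R -> Omega -> R) (F : R -> set_system Omega).

Definition natural_filtration W (s : R) : set_system Omega :=
  <<s \bigcup_(r in `[0, Num.min s T])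
        preimage_set_system [set: Omega] (W r) measurable >>.

(* At t = T the intersection runs over s > T, for which natural_filtration W s
   is natural_filtration W T. *)
Definition augmented_filtration W (t : R) : set_system Omega :=
  \bigcap_(s in `]t, +oo[) <<s natural_filtration W s `|` P.-negligible >>.

Definition sub_measurable (G : set_system Omega) (Y : Omega -> R) :=
  preimage_set_system [set: Omega] Y measurable `<=` G.

Definition adapted F X := forall t : R, t \in `[0, T] -> sub_measurable (F t) (X t).

Record brownian_motion W : Prop := BrownianMotion {
  brownian_measurable :
    forall t : R, t \in `[0, T] -> measurable_fun [set: Omega] (W t) ;
  brownian_0 : forall w, W 0 w = 0 ;
  brownian_continuous : forall w, {within `[0, T], continuous (W ^~ w)} ;
  brownian_normal : forall s t : R, 0 <= s -> s < t -> t <= T ->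
    forall B : set R, measurable B ->
      P ((W t \- W s) @^-1` B) = normal_prob 0 (Num.sqrt (t - s)) B ;
  brownian_independent : forall s t : R, 0 <= s -> s < t -> t <= T ->
    forall (A : set Omega) (B : set R), natural_filtration W s A -> measurable B ->
      P (A `&` (W t \- W s) @^-1` B)
        = (P A * P ((W t \- W s)%R @^-1` B))%E }.

End filtrations.

Section stochastic_integral.
Context {R : realType} {d : measure_display} {Omega : measurableType d}.
Variables (P : probability Omega R) (T : R) (F : R -> set_system Omega).
Variable W : R -> Omega -> R.
Local Notation mu := (@lebesgue_measure R).

(* The process \sum_k Y_k 1_(]a_k, b_k]), Y_k bounded and F_(a_k)-measurable. *)
Record simple_process := SimpleProcess {
  simple_size : nat ;
  simple_left : 'I_simple_size -> R ;
  simple_right : 'I_simple_size -> R ;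
  simple_coef : 'I_simple_size -> Omega -> R ;
  simple_times : forall k,
    0 <= simple_left k /\ simple_left k <= simple_right k <= T ;
  simple_adapted : forall k, sub_measurable (F (simple_left k)) (simple_coef k) ;
  simple_bounded : forall k, exists c : R, forall w, `|simple_coef k w| <= c }.

Definition simple_fun (H : simple_process) (t : R) (w : Omega) : R :=
  \sum_(k < simple_size H)
    simple_coef k w * \1_`]simple_left k, simple_right k] t.

Definition simple_integral (H : simple_process) (t : R) (w : Omega) : R :=
  \sum_(k < simple_size H) simple_coef k w *
    (W (Num.min (simple_right k) t) w - W (Num.min (simple_left k) t) w).

(* I is (a version of) the Ito integral of H against W over [0, t]: the limit
   in L^2(P) of the integrals of simple processes that approximate H in
   L^2(ds x P). *)
Definition ito_integral (t : R) (H : R -> Omega -> R) (I : Omega -> R) :=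
  measurable_fun [set: Omega] I /\
  exists Hn : nat -> simple_process,
    (\int[P]_w \int[mu]_(s in `[0%R, t])
        ((simple_fun (Hn n) s w - H s w) ^+ 2)%:E)%E @[n --> \oo] --> 0%E /\
    (\int[P]_w ((simple_integral (Hn n) t w - I w) ^+ 2)%:E)%E
        @[n --> \oo] --> 0%E.

Record sde_solution (b sigma : R -> R -> R) (x0 : R) (X : R -> Omega -> R)
    : Prop := SdeSolution {
  sde_adapted : adapted T F X ;
  sde_continuous : forall w, {within `[0, T], continuous (X ^~ w)} ;
  sde_equation : exists M : R -> Omega -> R,
    (forall t : R, t \in `[0, T] ->
       ito_integral t (fun s w => sigma s (X s w)) (M t)) /\
    {ae P, forall w, forall t : R, t \in `[0, T] ->
       X t w = x0 + (\int[mu]_(s in `[0%R, t]) b s (X s w))%R + M t w} }.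

End stochastic_integral.

Section strategies.
Context {R : realType} {d : measure_display} {Omega : measurableType d}.
Variables (P : probability Omega R) (T : R) (F : R -> set_system Omega).

Record investment_strategy := InvestmentStrategy {
  strategy_process :> R -> Omega -> R ;
  strategy_adapted : adapted T F strategy_process ;
  strategy_ge0 : forall w (t : R), t \in `[0, T] -> 0 <= strategy_process t w ;
  strategy_nondecreasing : forall w (s t : R), 0 <= s -> s <= t -> t <= T ->
    strategy_process s w <= strategy_process t w ;
  strategy_cadlag : forall w, cadlag T (strategy_process ^~ w) ;
  strategy_integrable : (\int[P]_w (strategy_process T w)%:E < +oo)%E }.

(* The path of a strategy, extended from [0, T] to R by constants, so that it
   is a distribution function on R. *)
Definition strategy_path (xi : investment_strategy) (w : Omega) (t : R) : R :=
  xi (clamp T t) w.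

Lemma strategy_path_nd xi w : nondecreasing (strategy_path xi w).
Proof.
move=> s t st; rewrite /strategy_path /clamp.
have [T0|T0] := leP 0 T; last first.
  have E u : Num.max 0 (Num.min u T) = 0.
    by apply/max_l; rewrite ge_min (ltW T0) orbT.
  by rewrite !E.
apply: strategy_nondecreasing.
- by rewrite le_max lexx.
- by rewrite ge_max le_max lexx /= le_max; apply/orP; right; rewrite le_min !ge_min st lexx orbT.
- by rewrite ge_max T0 /= ge_min lexx orbT.
Qed.

Lemma strategy_path_rc xi w : right_continuous (strategy_path xi w).
Proof.
move=> t.
have cst c u : t < u -> (forall s, t <= s < u -> clamp T s = c) ->
    strategy_path xi w s @[s --> t^'+] --> strategy_path xi w t.
  move=> tu H; apply: (@cvg_trans _ ((fun=> strategy_path xi w t) @ t^'+)); last exact: cvg_cst.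
  apply: near_eq_cvg; near=> s; rewrite /strategy_path (H t) ?lexx//.
  by rewrite (H s)//; apply/andP; split; near: s; [exact: nbhs_right_ge|exact: nbhs_right_lt].
have [Tt|tT] := leP T t.
  apply: (cst (Num.max 0 T) (t + 1)); first by rewrite ltrDl.
  move=> s /andP[ts _]; rewrite /clamp min_r//; exact: le_trans ts.
have [t0|t0] := ltP t 0.
  apply: (cst 0 0) => // s /andP[_ s0]; rewrite /clamp max_l// ge_min.
  by rewrite (ltW s0).
have E s : t <= s < T -> clamp T s = s.
  by move=> /andP[ts sT]; rewrite /clamp (min_l (ltW sT)) max_r// (le_trans t0).
rewrite {2}/strategy_path E ?lexx//.
have [rc _] := strategy_cadlag xi w.
apply: cvg_trans (rc t _); last by rewrite in_itv /= t0 tT.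
apply: near_eq_cvg; near=> s; rewrite /strategy_path E//.
by apply/andP; split; near: s; [exact: nbhs_right_ge|exact: nbhs_right_lt].
Unshelve. all: by end_near. Qed.

HB.instance Definition _ xi w := isCumulative.Build R _ R (strategy_path xi w)
  (@strategy_path_nd xi w) (@strategy_path_rc xi w).

(* \int_[0,T] f d xi, including the initial jump xi_0. *)
Definition strategy_integral (f : R -> R) (xi : investment_strategy)
    (w : Omega) : R :=
  f 0 * xi 0 w +
  (\int[lebesgue_stieltjes_measure (strategy_path xi w)]_(t in `]0%R, T]) f t)%R.

End strategies.

Section capital.
Context {R : realType}.
Local Notation mu := (@lebesgue_measure R).

(* dX_t = - delta X_t dt + d xi_t, X_(0-) = x0, for one path xi. *)
Definition capital_equation (T delta x0 : R) (xi X : R -> R) :=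
  cadlag T X /\
  forall t : R, t \in `[0, T] ->
    X t = x0 - delta * (\int[mu]_(s in `[0%R, t]) X s)%R + xi t.

(* The unique cadlag solution on [0, T] of this linear equation with bounded
   right-hand side; every cadlag path xi has one. Its values outside [0, T] are
   arbitrary and never used. *)
Definition capital_path (T delta x0 : R) (xi : R -> R) : R -> R :=
  xget (fun=> 0) (capital_equation T delta x0 xi).

End capital.

Section game.
Context {R : realType} {d : measure_display} {Omega : measurableType d}.
Variables (P : probability Omega R) (T : R) (F : R -> set_system Omega).
Local Notation mu := (@lebesgue_measure R).
Variables (N : nat) (X0 : R -> Omega -> R).
Variables (alpha c delta x0 : 'I_N -> R) (gamma rho : R).
Local Notation strategy := (investment_strategy P T F).

Definition capital (xi : 'I_N -> strategy) (i : 'I_N) (t : R) (w : Omega) : R :=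
  capital_path T (delta i) (x0 i) (xi i ^~ w) t.

Definition net_profit (i : 'I_N) (xi : 'I_N -> strategy) (w : Omega) : R :=
  (\int[mu]_(t in `[0%R, T]) (expR (- rho * t) * alpha i * capital xi i t w *
     (X0 t w - gamma * \sum_j alpha j * capital xi j t w)))%R
  - c i * strategy_integral (fun t => expR (- rho * t)) (xi i) w.

(* Extended real valued: the positive part of net_profit is integrable (as soon
   as E \int_0^T |X0_t|^2 dt is finite), its negative part need not be. *)
Definition expected_profit (i : 'I_N) (xi : 'I_N -> strategy) : \bar R :=
  (\int[P]_w (net_profit i xi w)%:E)%E.

Definition nash_equilibrium (xi : 'I_N -> strategy) :=
  forall (i : 'I_N) (xibar : strategy),
    (expected_profit i [eta xi with i |-> xibar] <= expected_profit i xi)%E.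

End game.

(* Main.v *)
Require Import Defs.
From HB Require Import structures.
From mathcomp Require Import all_boot all_order all_algebra.
From mathcomp Require Import all_classical all_reals all_analysis.
From mathcomp Require Import measurable_realfun ring lra.
Import Order.TTheory GRing.Theory Num.Theory.
Import numFieldNormedType.Exports.

(** The game has an exact potential. With outputs y_j = alpha_j X^j and demand z, the
    stage payoff y_i (z - gamma (sum y)) of firm i plus

      z^2 / gamma - z (sum y) + gamma / 2 ((sum y)^2 + sum y_j^2)

    does not depend on y_i (payoff_add_potential). Integrating over time and adding
    all investment costs gives a nonnegative functional of the profile of
    strategies, and a deviation of firm i changes the profit of i by minus the change
    of that functional. A minimizer of its expectation is therefore an equilibrium
    (minimizer_nash), and it remains to find one.

    The functional is finite at zero investment because the demand is square
    integrable (sde_square_integrable). This rests on the Ito isometry, which bounds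
    the second moment of the stochastic integral, and on Gronwall's inequality along
    paths.

    The potential is strongly convex in the outputs. For a minimizing sequence that is
    good enough, 4^-(n+1) above the infimum in its n-th term, comparison with midpoints
    (expected_gap_le) shows that consecutive terms have summable expected L1 distance
    in time, first for capitals and then for investments, because the capital
    equation can be solved for the investment (path_dist). Hence almost surely the
    nondecreasing investment paths converge at almost every time (path_ae_cvg).
    Their limits at T are finite because the potential
    dominates the terminal cost. The right-continuous regularization of the lower
    limit is a cadlag nondecreasing process, adapted because the filtration is right
    continuous (limit_process_adapted), and Fatou's lemma, applied in time
    (potential_fatou) and then in the state (exp_liminf_potential_le), shows that it
    minimizes the expected potential.

    Stieltjes integrals disappear at the start: the capital of a firm and its discounted
    cost are expressed by time integrals of the investment path (capital_pathE and
    stieltjes_exp_parts, both by exchanging integrals over a triangle). *)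

Set Implicit Arguments.
Unset Strict Implicit.
Unset Printing Implicit Defensive.

Local Open Scope classical_set_scope.
Local Open Scope ring_scope.

(** * Bounded measurable paths *)

Section bounded_measurable.
Context {R : realType}.
Local Notation mu := (@lebesgue_measure R).
Implicit Types (T t : R) (f g : R -> R).

(** Paths of strategies and of capital are bounded and measurable, but in general
    not continuous; this class contains them and is stable under everything done
    to paths below, so that all integrals in time are finite. *)
Definition bdm T f := measurable_fun `[0, T]%classic f /\
  exists M : R, forall t, t \in `[0, T] -> `|f t| <= M.

Lemma bdm_integrable T f : bdm T f -> mu.-integrable `[0, T] (EFin \o f).
Proof.
move=> [mf [M fM]]; apply: measurable_bounded_integrable => //.
- by rewrite /= (lebesgue_measure_itv `[0,T])/=; case: ifPn => // _; rewrite -EFinB ltry.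
- exists M; split; first exact: num_real.
  by move=> x Mx t tT; apply: (le_trans (fM t tT)); exact: ltW.
Qed.

Lemma bdm_cst T c : bdm T (cst c).
Proof. by split; [exact: measurable_cst|exists `|c|]. Qed.

Lemma bdmD T f g : bdm T f -> bdm T g -> bdm T (fun t => f t + g t).
Proof.
move=> [mf [M fM]] [mg [M' gM]]; split; first exact: measurable_funD.
exists (M + M') => t tT; rewrite (le_trans (ler_normD _ _))// lerD//; [exact: fM|exact: gM].
Qed.

Lemma bdmM T f g : bdm T f -> bdm T g -> bdm T (fun t => f t * g t).
Proof.
move=> [mf [M fM]] [mg [M' gM]]; split; first exact: measurable_funM.
exists (M * M') => t tT; rewrite normrM ler_pM//; [exact: fM|exact: gM].
Qed.

Lemma bdmN T f : bdm T f -> bdm T (fun t => - f t).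
Proof.
move=> /(bdmM (bdm_cst T (-1))) [mf [M fM]].
have E : (fun t => - f t) = (fun t => cst (-1) t * f t) by apply/funext => t /=; rewrite mulN1r.
by rewrite E; split => //; exists M.
Qed.

Lemma bdmB T f g : bdm T f -> bdm T g -> bdm T (fun t => f t - g t).
Proof. by move=> bf /bdmN; exact: bdmD. Qed.

Lemma bdmX T f n : bdm T f -> bdm T (fun t => f t ^+ n).
Proof.
move=> bf; elim: n => [|n ih]; first by under eq_fun do rewrite expr0; exact: bdm_cst.
by under eq_fun do rewrite exprS; exact: bdmM.
Qed.

Lemma bdm_norm T f : bdm T f -> bdm T (fun t => `|f t|).
Proof.
move=> [mf [M fM]]; split; first exact: measurableT_comp.
by exists M => t tT; rewrite normr_id fM.
Qed.

Lemma bdm_sum T (I : Type) (s : seq I) (F : I -> R -> R) :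
  (forall i, bdm T (F i)) -> bdm T (fun t => \sum_(i <- s) F i t).
Proof.
move=> bF; elim: s => [|i s ih].
  by under eq_fun do rewrite big_nil; exact: bdm_cst.
by under eq_fun do rewrite big_cons; exact: bdmD.
Qed.

(** Clamping the time argument extends the path to a nondecreasing function on
    the whole line. *)
Lemma bdm_nd T f : (forall s t, 0 <= s -> s <= t -> t <= T -> f s <= f t) -> bdm T f.
Proof.
move=> nd; have [T0|T0] := leP 0 T; last first.
  have E t : (t \in `[0, T]) = false.
    by rewrite in_itv /=; apply/negP => /andP[t0 tT]; have := le_trans t0 tT; rewrite leNgt T0.
  split; last by exists 0 => t; rewrite E.
  have -> : `[0, T]%classic = set0 by rewrite set_itv_ge// bnd_simp -ltNge.
  exact: measurable_fun_set0.
have clampI t : 0 <= clamp T t <= T by rewrite /clamp le_max lexx /= ge_max T0 ge_min lexx orbT.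
have mclamp : {in `[0, T], forall t, clamp T t = t}.
  move=> t; rewrite in_itv /= => /andP[t0 tT].
  by rewrite /clamp (min_l tT) max_r.
split.
  have : measurable_fun `[0, T]%classic (f \o clamp T).
    apply: nondecreasing_measurable => // s t st /=.
    have /andP[s0 sT] := clampI s; have /andP[t0 tT] := clampI t.
    apply: nd => //; rewrite /clamp ge_max !le_max lexx /=.
    by rewrite le_min !ge_min st lexx !orbT.
  apply: eq_measurable_fun => t; rewrite inE => tT.
  by rewrite /= mclamp.
exists (`|f 0| + `|f T|) => t; rewrite in_itv /= => /andP[t0 tT].
rewrite ler_norml; apply/andP; split.
  have := nd 0 t (lexx _) t0 tT; have := ler_norm (- f 0); rewrite normrN.
  have := normr_ge0 (f T); lra.
have := nd t T t0 tT (lexx _); have := ler_norm (f T); have := normr_ge0 (f 0); lra.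
Qed.

Lemma bdm_continuous T f : {within `[0, T], continuous f} -> bdm T f.
Proof.
move=> cf; split; first exact: subspace_continuous_measurable_fun.
have [T0|T0] := leP 0 T; last first.
  exists 0 => t; rewrite in_itv /= => /andP[t0 tT].
  by have := le_trans t0 tT; rewrite leNgt T0.
have [a _ fa] := EVT_max T0 cf; have [b _ fb] := EVT_min T0 cf.
exists (`|f a| + `|f b|) => t tT; rewrite ler_norml.
have := fa t tT; have := fb t tT; have := ler_norm (f a); have := ler_norm (- f b).
rewrite normrN; have := normr_ge0 (f b); have := normr_ge0 (f a); lra.
Qed.

Lemma bdmW S T f : S <= T -> bdm T f -> bdm S f.
Proof.
move=> ST [mf [M fM]]; split.
  by apply: measurable_funS mf => // t /=; rewrite !in_itv /= => /andP[-> /le_trans]; exact.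
by exists M => t; rewrite in_itv /= => /andP[t0 tS]; rewrite fM// in_itv /= t0 (le_trans tS).
Qed.

Lemma continuous_expRM c : continuous (fun t : R => expR (c * t)).
Proof.
move=> t; apply: continuous_comp; last exact: continuous_expR.
by apply: cvgM; [exact: cvg_cst|exact: cvg_id].
Qed.

Lemma bdm_expRM T c : bdm T (fun t => expR (c * t)).
Proof. exact/bdm_continuous/continuous_subspaceT/continuous_expRM. Qed.

Lemma bdm_int_continuous T f : 0 <= T -> bdm T f ->
  {within `[0, T], continuous (fun t => \int[mu]_(s in `[0, t]) f s)}.
Proof. by move=> T0 /bdm_integrable; exact: parameterized_integral_continuous. Qed.

Lemma int_expRN l a b : a <= b ->
  (\int[mu]_(t in `[a, b]) (l * expR (- l * t))%:E)%E = (expR (- l * a) - expR (- l * b))%:E.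
Proof.
rewrite le_eqVlt => /predU1P[<-|ab].
  by rewrite set_itv1 integral_set1 subrr.
have dF t : is_derive t 1 (fun t : R => - expR (- l * t)) (l * expR (- l * t)).
  apply: is_derive_eq.
  by rewrite /GRing.scale /=; ring.
rewrite (@continuous_FTC2 _ _ (fun t => - expR (- l * t)))//.
- by rewrite -EFinB opprK addrC.
- apply: continuous_subspaceT => t; apply: cvgM; first exact: cvg_cst.
  exact: continuous_expRM.
- split.
  + by move=> t _; exact: ex_derive.
  + by apply: cvgN; exact/cvg_at_right_filter/continuous_expRM.
  + by apply: cvgN; exact/cvg_at_left_filter/continuous_expRM.
- by move=> t _; rewrite derive1E derive_val.
Qed.

End bounded_measurable.

Section triangle.
Context {R : realType}.
Local Notation mu := (@lebesgue_measure R).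
Local Open Scope ereal_scope.

(** Tonelli's theorem on the triangle r <= s. With nu the Lebesgue measure it
    yields Gronwall's inequality and solves the capital equation; with nu a
    Stieltjes measure it is the integration by parts for the cost. *)
Lemma tonelli_triangle (nu : {sigma_finite_measure set (measurableTypeR R) -> \bar R})
    (D : set R) (t : R) (phi a : R -> \bar R) :
  measurable D -> D `<=` `[0%R, t] ->
  measurable_fun setT phi -> measurable_fun setT a ->
  (forall s, 0 <= phi s) -> (forall r, 0 <= a r) ->
  \int[mu]_(s in `[0%R, t]) (phi s * \int[nu]_(r in D `&` `]-oo, s]) a r) =
  \int[nu]_(r in D) (a r * \int[mu]_(s in `[r, t]) phi s).
Proof.
move=> mD Dt mphi ma phi0 a0.
have mle : measurable [set p : measurableTypeR R * measurableTypeR R | (p.2 <= p.1)%R].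
  rewrite -[X in measurable X]setTI.
  by apply: measurable_fun_le.
pose E := [set p : measurableTypeR R * measurableTypeR R | (p.2 <= p.1)%R] `&` (`[0%R, t] `*` D).
have mE : measurable E by apply: measurableI => //; exact: measurableX.
pose f (p : measurableTypeR R * measurableTypeR R) := (\1_E p)%:E * (phi p.1 * a p.2).
have f0 p : 0 <= f p by apply: mule_ge0 => //; exact: mule_ge0.
have mf : measurable_fun setT f.
  apply: emeasurable_funM; first exact/measurable_EFinP/measurable_indic.
  apply: emeasurable_funM; first exact: (measurableT_comp mphi measurable_fst).
  exact: (measurableT_comp ma measurable_snd).
have := @fubini_tonelli _ _ _ _ _ mu nu f mf f0.
rewrite (_ : (\int[mu]_x _) = \int[mu]_(s in `[0%R, t]) (phi s * \int[nu]_(r in D `&` `]-oo, s]) a r)); last first.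
  rewrite [RHS]integral_mkcond; apply: eq_integral => s _.
  rewrite patchE; case: ifPn => [/set_mem st|/negP st]; last first.
    rewrite integral0_eq// => r _; rewrite /f indicE memNset ?mul0e//= => -[_ [/= sI _]].
    by apply: st; exact: mem_set.
  rewrite -ge0_integralZl//; last 2 first.
    - by apply: measurableI.
    - exact: measurable_funTS.
  rewrite [RHS]integral_mkcond; apply: eq_integral => r _.
  rewrite patchE /f indicE; case: ifPn => [/set_mem rD|/negP rD].
    by rewrite mem_set ?mul1e//; move: rD st; rewrite /E /= in_itv /= => -[].
  rewrite memNset ?mul0e// => -[/= rs [_ /= Dr]].
  by apply: rD; apply: mem_set; split => //=; rewrite in_itv.
move=> ->.
rewrite [RHS]integral_mkcond; apply: eq_integral => r _.
rewrite patchE; case: ifPn => [/set_mem Dr|/negP rD]; last first.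
  rewrite integral0_eq// => s _; rewrite /f indicE memNset ?mul0e//= => -[_ [/= _ Dr]].
  by apply: rD; exact: mem_set.
rewrite -ge0_integralZl//; last exact: measurable_funTS.
rewrite [RHS]integral_mkcond; apply: eq_integral => s _.
have := Dt _ Dr; rewrite /= in_itv /= => /andP[r0 rt].
rewrite patchE /f indicE; case: ifPn => [/set_mem|/negP] sI.
  move: sI; rewrite /= in_itv /= => /andP[rs st]; rewrite mem_set ?mul1e ?[_ * a r]muleC//.
  by rewrite /E /= in_itv /= (le_trans r0 rs) st.
rewrite memNset ?mul0e// /E /= in_itv /= => -[rs [/andP[_ st] _]].
by apply: sI; apply: mem_set; rewrite /= in_itv /= rs st.
Qed.

End triangle.

(** * Gronwall's inequality *)

Section exp_triangle.
Context {R : realType}.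
Local Notation mu := (@lebesgue_measure R).
Implicit Types (T t : R) (f g u m : R -> R).

Lemma bdm_EFin_int T f : bdm T f ->
  (\int[mu]_(t in `[0%R, T]) (f t)%:E)%E = (\int[mu]_(t in `[0, T]) f t)%:E.
Proof. by move=> /bdm_integrable bf; rewrite fineK//; exact: integrable_fin_num. Qed.

Lemma bdm_intD T f g : bdm T f -> bdm T g ->
  \int[mu]_(t in `[0, T]) (f t + g t) =
  \int[mu]_(t in `[0, T]) f t + \int[mu]_(t in `[0, T]) g t.
Proof. by move=> bf bg; rewrite RintegralD//; exact: bdm_integrable. Qed.

Lemma bdm_intB T f g : bdm T f -> bdm T g ->
  \int[mu]_(t in `[0, T]) (f t - g t) =
  \int[mu]_(t in `[0, T]) f t - \int[mu]_(t in `[0, T]) g t.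
Proof. by move=> bf bg; rewrite RintegralB//; exact: bdm_integrable. Qed.

Lemma bdm_intZ T c f : bdm T f ->
  \int[mu]_(t in `[0, T]) (c * f t) = c * \int[mu]_(t in `[0, T]) f t.
Proof. by move=> bf; rewrite RintegralZl//; exact: bdm_integrable. Qed.

Lemma bdm_le_int T f g : bdm T f -> bdm T g ->
  (forall t, t \in `[0, T] -> f t <= g t) ->
  \int[mu]_(t in `[0, T]) f t <= \int[mu]_(t in `[0, T]) g t.
Proof. by move=> bf bg fg; apply: le_Rintegral => //; exact: bdm_integrable. Qed.

Lemma itv_eq_int T f g : {in `[0, T], f =1 g} ->
  \int[mu]_(t in `[0, T]) f t = \int[mu]_(t in `[0, T]) g t.
Proof. by move=> fg; apply: eq_Rintegral => t; rewrite inE; exact: fg. Qed.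

Lemma bdm_int T f : 0 <= T -> bdm T f -> bdm T (fun t => \int[mu]_(s in `[0, t]) f s).
Proof. by move=> T0 bf; apply: bdm_continuous; exact: bdm_int_continuous. Qed.

(** The fundamental theorem of calculus for e^(-l t) U(t), where U is the integral
    of u. As u need not be continuous, the order of integration is exchanged
    instead of differentiating. *)
Lemma exp_triangle T l u t : 0 < l -> 0 <= t <= T -> bdm T u ->
    (forall s, s \in `[0, T] -> 0 <= u s) ->
  expR (- l * t) * \int[mu]_(s in `[0, t]) u s =
  \int[mu]_(s in `[0, t]) (expR (- l * s) * (u s - l * \int[mu]_(r in `[0, s]) u r)).
Proof.
move=> l0 /andP[t0 tT] bu u0.
have but := bdmW tT bu.
have bU : bdm t (fun s => \int[mu]_(r in `[0, s]) u r) by exact: bdm_int.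
have be := bdm_expRM t (- l).
pose a : R -> \bar R := EFin \o (u \_ `[0, t]).
pose phi (s : R) : \bar R := (l * expR (- l * s))%:E.
have a0 r : (0 <= a r)%E.
  rewrite lee_fin patchE; case: ifPn => // /set_mem /=; rewrite in_itv /= => /andP[r0 rt].
  by apply: u0; rewrite in_itv /= r0 (le_trans rt).
have phi0 s : (0 <= phi s)%E by rewrite lee_fin mulr_ge0 ?expR_ge0// ltW.
have mphi : measurable_fun setT phi.
  apply/measurable_EFinP; apply: measurable_funM; first exact: measurable_cst.
  by apply: continuous_measurable_fun; exact: continuous_expRM.
have ma : measurable_fun setT a.
  apply/measurable_EFinP; apply/(measurable_restrictT u) => //; by case: but.
have H := tonelli_triangle mu (D := `[0, t]) _ (@subset_refl _ _) mphi ma phi0 a0.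
have {}H := H ltac:(by []).
move: H.
rewrite (_ : (\int[mu]_(s in _) _)%E =
  (\int[mu]_(s in `[0%R, t]) ((l * expR (- l * s) * \int[mu]_(r in `[0, s]) u r)%:E))%E); last first.
  apply: eq_integral => s /set_mem /=; rewrite in_itv /= => /andP[s0 st].
  rewrite EFinM; congr (_ * _)%E.
  rewrite -bdm_EFin_int; last exact: bdmW but.
  have -> : `[0, t]%classic `&` `]-oo, s]%classic = `[0, s]%classic :> set R.
    apply/seteqP; split => r /=; rewrite !in_itv /=; first by move=> [/andP[-> _] ->].
    by move=> /andP[-> rs]; rewrite rs (le_trans rs).
  apply: eq_integral => r /set_mem /=; rewrite in_itv /= => /andP[r0 rs].
  by rewrite /a /= patchE mem_set//= in_itv /= r0 (le_trans rs).
rewrite (_ : (\int[mu]_(r in _) (a r * _))%E =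
  (\int[mu]_(r in `[0%R, t]) ((expR (- l * r) * u r - expR (- l * t) * u r)%:E))%E); last first.
  apply: eq_integral => r rI; move: (rI) => /set_mem /=; rewrite in_itv /= => /andP[r0 rt].
  rewrite /a /= patchE rI.
  have -> : (\int[mu]_(s in `[r, t]) phi s = (expR (- l * r) - expR (- l * t))%:E)%E.
    by rewrite -int_expRN.
  by rewrite -EFinM; congr EFin; ring.
rewrite !bdm_EFin_int; last 2 first.
  by apply: bdmB; apply: bdmM => //; exact: bdm_cst.
  by apply: bdmM => //; apply: bdmM => //; exact: bdm_cst.
move=> [] H.
have be' : bdm t (fun s => l * expR (- l * s) * \int[mu]_(r in `[0, s]) u r).
  by apply: bdmM => //; apply: bdmM => //; exact: bdm_cst.
have -> : \int[mu]_(s in `[0, t]) (expR (- l * s) * (u s - l * \int[mu]_(r in `[0, s]) u r)) =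
  \int[mu]_(s in `[0, t]) (expR (- l * s) * u s - l * expR (- l * s) * \int[mu]_(r in `[0, s]) u r).
  by apply: itv_eq_int => s _; ring.
rewrite bdm_intB//; last exact: bdmM.
rewrite H bdm_intB; last 2 first.
  exact: bdmM.
  by apply: bdmM => //; exact: bdm_cst.
by rewrite bdm_intZ//; ring.
Qed.

(** By the hypothesis on u, the integrand on the right of exp_triangle is at most
    e^(-l s) m(s). *)
Lemma gronwall_int T l u m t : 0 < l -> 0 <= t <= T -> bdm T u -> bdm T m ->
    (forall s, s \in `[0, T] -> 0 <= u s) ->
    (forall s, s \in `[0, T] -> 0 <= m s) ->
    (forall s, s \in `[0, T] -> u s <= m s + l * \int[mu]_(r in `[0, s]) u r) ->
  \int[mu]_(s in `[0, t]) u s <= expR (l * t) * \int[mu]_(s in `[0, t]) m s.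
Proof.
move=> l0 /andP[t0 tT] bu bm u0 m0 um.
have but := bdmW tT bu; have bmt := bdmW tT bm.
rewrite -ler_pdivrMl ?expR_gt0// -expRN -mulNr (@exp_triangle T)// ?t0//.
have sub s : s \in `[0, t] -> s \in `[0, T].
  by rewrite !in_itv /= => /andP[-> /le_trans]; exact.
apply: bdm_le_int => //.
  apply: bdmM; first exact: bdm_expRM.
  by apply: bdmB => //; apply: bdmM; [exact: bdm_cst|exact: bdm_int].
move=> s st; have := um _ (sub _ st); have := m0 _ (sub _ st).
move: st; rewrite in_itv /= => /andP[s0 _] ms ums.
have e1 : expR (- l * s) <= 1.
  by rewrite -expR0 ler_expR mulNr oppr_le0 mulr_ge0// ltW.
apply: (@le_trans _ _ (expR (- l * s) * m s)).
  by rewrite ler_wpM2l ?expR_ge0// lerBlDr.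
by rewrite -[leRHS]mul1r ler_wpM2r.
Qed.

End exp_triangle.

(** * Joint measurability of processes *)

Section joint_measurability.
Context {R : realType} {d : measure_display} {Omega : measurableType d}.
Local Notation mu := (@lebesgue_measure R).
Implicit Types (T t : R) (Z : R -> Omega -> R).

(** Joint measurability in time and state makes time integrals random variables
    and allows the exchange of expectations and time integrals. *)
Definition jmeas T Z :=
  measurable_fun ((`[0, T]%classic : set (measurableTypeR R)) `*` [set: Omega])
    (fun p => Z p.1 p.2).

Let grid T n (t : R) : R := Num.min T ((Num.truncn (t * n.+1%:R)).+1%:R / n.+1%:R).

Let grid_gt T n t : 0 <= t < T -> t < grid T n t.
Proof.
move=> /andP[t0 tT]; rewrite lt_min tT /= ltr_pdivlMr//.
by have := truncnS_gt (t * n.+1%:R).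
Qed.

Let grid_le T n t : 0 <= t -> grid T n t <= t + n.+1%:R^-1.
Proof.
move=> t0; rewrite ge_min; apply/orP; right.
rewrite ler_pdivrMr// mulrDl mulVf// -natr1 lerD2r.
by rewrite truncn_le mulr_ge0.
Qed.

(** Rounding the time up to a grid of mesh 1/(n+1) leaves countably many times, so
    the rounded process is jointly measurable; by right continuity it converges
    pointwise. *)
Lemma jmeas_right_continuous T Z :
  (forall t, t \in `[0, T] -> measurable_fun setT (Z t)) ->
  (forall w t, t \in `[0, T[ -> Z s w @[s --> t^'+] --> Z t w) -> jmeas T Z.
Proof.
move=> mZ rZ.
have mD : measurable ((`[0, T]%classic : set (measurableTypeR R)) `*` [set: Omega]).
  exact: measurableX.
apply: (@measurable_fun_cvg _ _ _ _ (fun n p => Z (grid T n p.1) p.2)).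
- move=> n.
  pose E k : set (measurableTypeR R * Omega) :=
    (`[0, T] `&` `[k%:R / n.+1%:R, k.+1%:R / n.+1%:R[) `*` setT.
  have DE : (`[0, T]%classic : set (measurableTypeR R)) `*` [set: Omega] = \bigcup_k E k.
    apply/seteqP; split => [[t w] /= [tI _]|[t w] [k _] [[]]//].
    exists (Num.truncn (t * n.+1%:R)) => //; split => //=; split => //=.
    have t0 : 0 <= t by move: tI; rewrite in_itv /= => /andP[].
    rewrite in_itv /= ler_pdivrMr// ltr_pdivlMr//.
    by rewrite truncn_le ?mulr_ge0//= truncnS_gt.
  have mE k : measurable (E k) by apply: measurableX => //; exact: measurableI.
  rewrite DE; apply/measurable_fun_bigcup => // k.
  have [->|/set0P[[t0 w0] [[/= tI _] _]]] := eqVneq (E k) set0.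
    exact: measurable_fun_set0.
  move: tI; rewrite in_itv /= => /andP[t00 t0T].
  have cT : Num.min T (k.+1%:R / n.+1%:R) \in `[0, T].
    by rewrite in_itv /= le_min (le_trans t00 t0T) /= ge_min lexx /= divr_ge0.
  apply: (@eq_measurable_fun _ _ _ _ _ (Z (Num.min T (k.+1%:R / n.+1%:R)) \o snd)).
    move=> [t w] /set_mem [[/= tI tk] _]; rewrite /grid.
    suff -> : Num.truncn (t * n.+1%:R) = k by [].
    apply: truncn_def; move: tk.
    by rewrite in_itv /= ler_pdivrMr// ltr_pdivlMr.
  by apply/measurable_funTS/measurableT_comp => //; exact: mZ.
- move=> [t w] [/= tI _]; move: (tI); rewrite in_itv /= => /andP[t0]; rewrite le_eqVlt => /predU1P[tT|tT].
    apply: (@cvg_trans _ ((fun=> Z t w) @ \oo)); last exact: cvg_cst.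
    apply: near_eq_cvg; apply: nearW => n.
    rewrite tT /grid min_l// ler_pdivlMr// ltW//.
    by have := truncnS_gt (T * n.+1%:R).
  apply: (cvg_at_rightP (Z ^~ w) t (Z t w)).1; first by apply: rZ; rewrite in_itv /= t0.
  split; first by move=> n; apply: grid_gt; rewrite t0.
  apply: (@squeeze_cvgr _ _ _ _ (cst t) (fun n => t + n.+1%:R^-1)).
  - apply: nearW => n; rewrite grid_le// andbT ltW// grid_gt// t0//.
  - exact: cvg_cst.
  - rewrite -[X in _ --> X]addr0; apply: cvgD; first exact: cvg_cst.
    exact: cvg_harmonic.
Qed.

End joint_measurability.

(** * The capital equation *)

Section capital_formula.
Context {R : realType}.
Local Notation mu := (@lebesgue_measure R).
Implicit Types (T t : R) (f X : R -> R).

(** The variation of constants formula for dX = - delta X dt + df, after an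
    integration by parts that removes the integral with respect to f. *)
Definition capital_of (delta x : R) f t :=
  x + f t - delta * expR (- delta * t) *
    \int[mu]_(s in `[0, t]) (expR (delta * s) * (x + f s)).

Lemma bdm_capital_of T delta x f : 0 <= T -> bdm T f -> bdm T (capital_of delta x f).
Proof.
move=> T0 bf; apply: bdmB; first by apply: bdmD => //; exact: bdm_cst.
apply: bdmM; first by apply: bdmM; [exact: bdm_cst|exact: bdm_expRM].
apply: bdm_int => //; apply: bdmM; first exact: bdm_expRM.
by apply: bdmD => //; exact: bdm_cst.
Qed.

(** This is exp_triangle for u(s) = e^(delta s) (x + f(s)); inserted into the
    definition of capital_of it gives the integral equation. *)
Lemma int_capital_of T delta x f t : 0 < delta -> 0 <= x -> 0 <= t <= T -> bdm T f ->
  (forall s, s \in `[0, T] -> 0 <= f s) ->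
  \int[mu]_(s in `[0, t]) capital_of delta x f s =
  expR (- delta * t) * \int[mu]_(s in `[0, t]) (expR (delta * s) * (x + f s)).
Proof.
move=> d0 x0 tT bf f0; rewrite (@exp_triangle _ T)//; last 2 first.
- by apply: bdmM; [exact: bdm_expRM|apply: bdmD => //; exact: bdm_cst].
- by move=> s sT; rewrite mulr_ge0 ?expR_ge0// addr_ge0// f0.
apply: itv_eq_int => s _; rewrite /capital_of mulrBr mulrA -expRD.
by rewrite mulNr addNr expR0 mul1r; ring.
Qed.

(** One-sided limits bound the path near each point, and [0, T] is compact. *)
Lemma bounded_cadlag T X : cadlag T X -> exists M : R, forall t, t \in `[0, T] -> `|X t| <= M.
Proof.
move=> [rX lX].
have /compact_near_coveringP nc := @segment_compact R 0 T.
pose P (M x : R) := x \in `[0, T] -> `|X x| <= M.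
have loc x : `[0, T]%classic x -> exists M0, \forall y \near x, P M0 y.
  rewrite /= in_itv /= => /andP[x0 xT].
  have [M1 H1] : exists M1, \forall y \near x, x < y -> P M1 y.
    have [xT'|Tx] := ltP x T; last first.
      by exists 0; near=> y => xy; rewrite /P in_itv /= => /andP[_ /(lt_le_trans xy)]; rewrite ltNge Tx.
    exists (`|X x| + 1).
    have /cvgrPdist_le/(_ 1 ltr01) H0 := rX x ltac:(by rewrite in_itv /= x0).
    have {}H0 : \forall y \near x, x < y -> `|X x - X y| <= 1 := H0.
    apply: (@filterS _ (nbhs x) _ _ _ _ H0) => y Hy /Hy H _.
    by have := ler_distD (X x) (X y) 0; rewrite !subr0 distrC => /le_trans; apply; rewrite addrC lerD2l.
  have [M2 H2] : exists M2, \forall y \near x, y < x -> P M2 y.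
    have [x0'|x0'] := ltP 0 x; last first.
      by exists 0; near=> y => yx; rewrite /P in_itv /= => /andP[/le_lt_trans/(_ yx)]; rewrite ltNge x0'.
    have /cvg_ex[l] := lX x ltac:(by rewrite in_itv /= x0').
    move=> /cvgrPdist_le/(_ 1 ltr01) H0.
    have {}H0 : \forall y \near x, y < x -> `|l - X y| <= 1 := H0.
    exists (`|l| + 1).
    apply: (@filterS _ (nbhs x) _ _ _ _ H0) => y Hy /Hy H _.
    by have := ler_distD l (X y) 0; rewrite !subr0 distrC => /le_trans; apply; rewrite addrC lerD2l.
  exists (Num.max `|X x| (Num.max M1 M2)).
  apply: filterS2 H1 H2 => y H1 H2 yT; rewrite !le_max.
  have [xy|yx|->] := ltgtP x y; last by rewrite lexx.
    by rewrite H1// orbT.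
  by rewrite H2// !orbT.
have H : \forall M \near (pinfty_nbhs R), `[0, T]%classic `<=` P M.
  apply: nc => x /loc[M0 H].
  exists ([set y | P M0 y], [set M | M0 <= M]) => /=; first by split => //; exact/nbhs_pinfty_ge/num_real.
  by move=> [y M] /= [yM MM] yT; exact: le_trans (yM yT) MM.
have [M HM] := @filter_ex _ (pinfty_nbhs R) _ _ H.
by exists M => t tT; apply: HM.
Unshelve. all: by end_near. Qed.

Lemma bdm_cadlag T X : cadlag T X -> bdm T X.
Proof.
move=> cX; split; last exact: bounded_cadlag.
have := @jmeas_right_continuous R _ (measurableTypeR R) T (fun t _ => X t).
move=> H; have {}H : jmeas T (fun t (_ : measurableTypeR R) => X t).
  apply: H; first by move=> t _; exact: measurable_cst.
  by move=> _ t tT; case: cX => + _; exact.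
have -> : X = (fun p : measurableTypeR R * measurableTypeR R => X p.1) \o (fun t => (t, 0)) by [].
apply: (measurable_comp _ _ H); first exact: measurableX.
  by move=> _ /= [t tT <-].
by apply/measurable_funTS/measurable_fun_pair => //; exact: measurable_cst.
Qed.

(** The distance u of two solutions satisfies u(t) <= delta int_0^t u, so that
    Gronwall's inequality applies with m = 0. *)
Lemma capital_equation_unique T delta x f X t : 0 < delta -> 0 <= x -> bdm T f ->
  (forall s, s \in `[0, T] -> 0 <= f s) ->
  capital_equation T delta x f X -> t \in `[0, T] -> X t = capital_of delta x f t.
Proof.
move=> d0 x0 bf f0 [cX eX] tT.
have T0 : 0 <= T by move: tT; rewrite in_itv /= => /andP[/le_trans]; exact.
have bX := bdm_cadlag cX; have bc := bdm_capital_of delta x T0 bf.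
have eC s : s \in `[0, T] ->
    capital_of delta x f s = x - delta * (\int[mu]_(r in `[0, s]) capital_of delta x f r) + f s.
  by move=> sT; rewrite (@int_capital_of T)// /capital_of; ring.
pose u s := `|X s - capital_of delta x f s|.
have bD := bdmB bX bc; have bu := bdm_norm bD.
have le_u s : s \in `[0, T] -> u s <= delta * \int[mu]_(r in `[0, s]) u r.
  move=> sT; rewrite /u eX// eC//.
  have /andP[s0 sT'] : 0 <= s <= T by move: sT; rewrite in_itv.
  have -> : forall A B : R, x - delta * A + f s - (x - delta * B + f s) = - (delta * (A - B)).
    by move=> A B; ring.
  rewrite -bdm_intB; [|exact: bdmW sT' bX|exact: bdmW sT' bc].
  rewrite normrN normrM gtr0_norm// ler_pM2l//.
  by apply: le_normr_Rintegral => //; apply: bdm_integrable; exact: bdmW bD.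
have I0 : \int[mu]_(s in `[0, t]) u s <= 0.
  have := @gronwall_int _ T delta u (cst 0) t d0.
  rewrite [X in _ <= _ * X](_ : _ = 0) ?mulr0; last by rewrite /cst Rintegral_cst//= mul0r.
  apply => //; [exact: bdm_cst|by move=> s _; exact: normr_ge0|].
  by move=> s sT; rewrite /cst add0r le_u.
have := le_u _ tT => /le_trans/(_ (mulr_ge0_le0 (ltW d0) I0)).
by rewrite normr_le0 subr_eq0 => /eqP.
Qed.

Lemma cadlag_capital_of T delta x f : cadlag T f -> cadlag T (capital_of delta x f).
Proof.
move=> cf; have bf := bdm_cadlag cf; have [rf lf] := cf.
have bg : bdm T (fun s => expR (delta * s) * (x + f s)).
  by apply: bdmM; [exact: bdm_expRM|apply: bdmD => //; exact: bdm_cst].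
have cont a b : a < b -> a \in `[0, T] -> b \in `[0, T] ->
   (\int[mu]_(s in `[0, t]) (expR (delta * s) * (x + f s)) @[t --> a^'+] -->
      \int[mu]_(s in `[0, a]) (expR (delta * s) * (x + f s))) /\
   (\int[mu]_(s in `[0, t]) (expR (delta * s) * (x + f s)) @[t --> b^'-] -->
      \int[mu]_(s in `[0, b]) (expR (delta * s) * (x + f s))).
  rewrite !in_itv /= => ab /andP[a0 aT] /andP[b0 bT].
  have sub : `[a, b] `<=` `[0, T].
    by move=> s /=; rewrite !in_itv /= => /andP[/(le_trans a0)-> /le_trans]; exact.
  have := bdm_int_continuous (le_trans b0 bT) bg.
  by move=> /(continuous_subspaceW sub)/(continuous_within_itvP _ ab)[_ ? ?].
split=> t tT.
  apply: cvgB; first by apply: cvgD; [exact: cvg_cst|exact: rf].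
  apply: cvgM; first by apply: cvgM; [exact: cvg_cst|exact/cvg_at_right_filter/continuous_expRM].
  move: tT; rewrite in_itv /= => /andP[t0 tT].
  by apply: (cont t T _ _ _).1 => //; rewrite in_itv /= ?t0 ?lexx ?ltW ?(le_lt_trans t0).
have /cvg_ex[l fl] := lf t tT.
apply/cvg_ex; exists (x + l - delta * expR (- delta * t) * \int[mu]_(s in `[0, t]) (expR (delta * s) * (x + f s))).
apply: cvgB; first by apply: cvgD; [exact: cvg_cst|exact: fl].
apply: cvgM; first by apply: cvgM; [exact: cvg_cst|exact/cvg_at_left_filter/continuous_expRM].
move: tT; rewrite in_itv /= => /andP[t0 tT].
by apply: (cont 0 t _ _ _).2 => //; rewrite in_itv /= ?tT ?lexx ?(ltW t0)// (le_trans _ tT)// ltW.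
Qed.

(** capital_of solves the equation, and by uniqueness the solution chosen in
    capital_path agrees with it on [0, T]. *)
Lemma capital_pathE T delta x f t : 0 < delta -> 0 <= x -> cadlag T f ->
  (forall s, s \in `[0, T] -> 0 <= f s) -> t \in `[0, T] ->
  capital_path T delta x f t = capital_of delta x f t.
Proof.
move=> d0 x0 cf f0 tT; apply: (@capital_equation_unique T) => //; first exact: bdm_cadlag.
rewrite /capital_path; case: xgetP => [X _ //|/(_ (capital_of delta x f)) []].
split; first exact: cadlag_capital_of.
move=> s sT; rewrite (@int_capital_of T)//; last exact: bdm_cadlag.
by rewrite /capital_of; ring.
Qed.

End capital_formula.

(** * Integration by parts for the investment cost *)

Section stieltjes.
Context {R : realType}.
Local Notation mu := (@lebesgue_measure R).

Lemma lebesgue_stieltjes_itvoc (F : cumulative R R) (a b : R) : a <= b ->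
  lebesgue_stieltjes_measure F `]a, b] = (F b - F a)%:E.
Proof.
move=> ab; rewrite /lebesgue_stieltjes_measure/= /measure_extension/=.
rewrite measurable_mu_extE//; last exact: is_ocitv.
exact: wlength_itv_bnd.
Qed.

(** Write e^(-rho r) - e^(-rho T) as the integral of rho e^(-rho s) over [r, T] and
    exchange the integrals. In this form the cost of an investment path involves
    the path itself, so that convergence of paths can be used. *)
Lemma stieltjes_exp_parts (F : cumulative R R) (T rho : R) : 0 <= T -> 0 < rho ->
  \int[lebesgue_stieltjes_measure F]_(t in `]0, T]) expR (- rho * t) =
  expR (- rho * T) * F T - F 0 + rho * \int[mu]_(t in `[0, T]) (expR (- rho * t) * F t).
Proof.
move=> T0 r0; set nu := lebesgue_stieltjes_measure F.
have bF : bdm T F by apply: bdm_nd => s t _ st _; exact: cumulative_is_nondecreasing.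
have be := bdm_expRM T (- rho).
pose phi (s : R) : \bar R := (rho * expR (- rho * s))%:E.
have phi0 s : (0 <= phi s)%E by rewrite lee_fin mulr_ge0 ?expR_ge0// ltW.
have mphi : measurable_fun setT phi.
  apply/measurable_EFinP; apply: measurable_funM; first exact: measurable_cst.
  by apply: continuous_measurable_fun; exact: continuous_expRM.
have sub : `]0, T] `<=` `[0, T] by exact: subset_itv_oc_cc.
have H := @tonelli_triangle R nu `]0, T]%classic T phi (cst 1%E) ltac:(by []) sub mphi
  ltac:(exact: measurable_cst) phi0 ltac:(by []).
move: H.
rewrite (_ : (\int[mu]_(s in _) _)%E =
  (\int[mu]_(s in `[0%R, T]) ((rho * expR (- rho * s) * (F s - F 0)))%:E)%E); last first.
  apply: eq_integral => s /set_mem /=; rewrite in_itv /= => /andP[s0 sT].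
  rewrite EFinM; congr (_ * _)%E.
  have -> : `]0, T]%classic `&` `]-oo, s]%classic = `]0, s]%classic :> set R.
    apply/seteqP; split => r /=; rewrite !in_itv /=; first by move=> [/andP[-> _] ->].
    by move=> /andP[-> rs]; rewrite rs (le_trans rs).
  by rewrite integral_cst// mul1e; apply: lebesgue_stieltjes_itvoc.
rewrite bdm_EFin_int; last first.
  by apply: bdmM; [apply: bdmM => //|apply: bdmB => //]; exact: bdm_cst.
have nuE : nu `]0%R, T]%classic = (F T - F 0)%:E by exact: lebesgue_stieltjes_itvoc.
have fin : (nu `]0%R, T]%classic < +oo)%E by rewrite nuE ltry.
have ie : nu.-integrable `]0, T]%classic (EFin \o (fun t => expR (- rho * t))).
  apply: measurable_bounded_integrable => //.
    by case: be => + _; apply: measurable_funS.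
  have [_ [M HM]] := be; exists M; split; first exact: num_real.
  by move=> x Mx t /sub tT; apply: (le_trans (HM t tT)); exact: ltW.
have ic : nu.-integrable `]0, T]%classic (EFin \o (fun=> expR (- rho * T))).
  apply: measurable_bounded_integrable => //.
  exists `|expR (- rho * T)|; split; first exact: num_real.
  by move=> x Mx t _ /=; exact: ltW.
rewrite (_ : (\int[nu]_(r in _) _)%E =
  (\int[nu]_(r in `]0%R, T]) ((expR (- rho * r) - expR (- rho * T))%:E))%E); last first.
  apply: eq_integral => r /set_mem /=; rewrite in_itv /= => /andP[_ rT].
  by rewrite mul1e int_expRN.
have E2 : \int[nu]_(r in `]0, T]) (expR (- rho * r) - expR (- rho * T)) =
    \int[nu]_(r in `]0, T]) expR (- rho * r) - expR (- rho * T) * (F T - F 0).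
  rewrite RintegralB//; congr (_ - _); rewrite Rintegral_cst//; congr (_ * _).
  by move: nuE => /(congr1 fine).
move=> /(congr1 fine)/= H; rewrite -[RHS]/(Rintegral nu _ _) E2 in H.
have {H} -> : \int[nu]_(t in `]0, T]) expR (- rho * t) =
  expR (- rho * T) * (F T - F 0) +
  \int[mu]_(t in `[0, T]) (rho * expR (- rho * t) * (F t - F 0)) by rewrite H; ring.
have -> : \int[mu]_(t in `[0, T]) (rho * expR (- rho * t) * (F t - F 0)) =
   \int[mu]_(t in `[0, T]) (rho * (expR (- rho * t) * F t) - F 0 * (rho * expR (- rho * t))).
  by apply: itv_eq_int => t _; ring.
have b1 : bdm T (fun t => expR (- rho * t) * F t) by exact: bdmM.
have b2 : bdm T (fun t => rho * expR (- rho * t)) by apply: bdmM => //; exact: bdm_cst.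
rewrite bdm_intB; [|by apply: bdmM => //; exact: bdm_cst|by apply: bdmM => //; exact: bdm_cst].
rewrite !bdm_intZ//.
have : (\int[mu]_(t in `[0%R, T]) (rho * expR (- rho * t))%:E)%E = (1 - expR (- rho * T))%:E.
  by rewrite int_expRN// mulr0 expR0.
rewrite bdm_EFin_int// bdm_intZ// => -[->].
by ring.
Qed.

End stieltjes.

(** * Measurability of time integrals *)

Section joint_integrals.
Context {R : realType} {d : measure_display} {Omega : measurableType d}.
Local Notation mu := (@lebesgue_measure R).
Implicit Types (T t : R) (Z : R -> Omega -> R).

Lemma jmeasD T Z1 Z2 : jmeas T Z1 -> jmeas T Z2 -> jmeas T (fun t w => Z1 t w + Z2 t w).
Proof. exact: measurable_funD. Qed.

Lemma jmeasB T Z1 Z2 : jmeas T Z1 -> jmeas T Z2 -> jmeas T (fun t w => Z1 t w - Z2 t w).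
Proof. exact: measurable_funB. Qed.

Lemma jmeasM T Z1 Z2 : jmeas T Z1 -> jmeas T Z2 -> jmeas T (fun t w => Z1 t w * Z2 t w).
Proof. exact: measurable_funM. Qed.

Lemma jmeasX T Z n : jmeas T Z -> jmeas T (fun t w => Z t w ^+ n).
Proof. exact: measurable_funX. Qed.

Lemma jmeas_norm T Z : jmeas T Z -> jmeas T (fun t w => `|Z t w|).
Proof. by move=> mZ; apply: measurableT_comp. Qed.

Lemma jmeas_cst T c : jmeas T (fun _ (_ : Omega) => c).
Proof. exact: measurable_cst. Qed.

Lemma jmeas_sum T (I : Type) (s : seq I) (F : I -> R -> Omega -> R) :
  (forall i, jmeas T (F i)) -> jmeas T (fun t w => \sum_(i <- s) F i t w).
Proof. by move=> mF; apply: measurable_sum. Qed.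

Lemma jmeas_fst T (f : R -> R) : bdm T f -> jmeas T (fun t (_ : Omega) => f t).
Proof.
move=> [mf _]; rewrite /jmeas.
apply: (measurable_comp (F := `[0, T]%classic) _ _ mf) => //.
  by move=> _ /= [[t w] [/= tT _] <-].
by apply: measurable_funTS; exact: measurable_fst.
Qed.

Lemma jmeasW S T Z : S <= T -> jmeas T Z -> jmeas S Z.
Proof.
move=> ST; apply: measurable_funS; first exact: measurableX.
by move=> [t w] [/= tS _]; split => //=; move: tS; rewrite !in_itv /= => /andP[-> /le_trans]; exact.
Qed.

Lemma jmeas_patch T Z : jmeas T Z ->
  measurable_fun setT (fun p : measurableTypeR R * Omega => (Z ^~ p.2 \_ `[0, T]) p.1).
Proof.
have mD : measurable ((`[0, T]%classic : set (measurableTypeR R)) `*` [set: Omega]).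
  exact: measurableX.
move=> /(measurable_restrictT (fun p => Z p.1 p.2) mD).
rewrite (_ : (fun p : measurableTypeR R * Omega => (Z ^~ p.2 \_ `[0, T]) p.1) =
  (fun p => Z p.1 p.2) \_ (`[0, T]%classic `*` setT))//.
apply/funext => -[t w]; rewrite !patchE/=; congr (if _ then _ else _).
by apply/idP/idP => /set_mem tT; apply/mem_set => //; case: tT.
Qed.

Lemma jmeas_eint T Z : jmeas T Z -> (forall t w, t \in `[0, T] -> 0 <= Z t w) ->
  measurable_fun setT (fun w => \int[mu]_(t in `[0%R, T]) (Z t w)%:E)%E.
Proof.
move=> /jmeas_patch mZ Z0.
pose f p := ((Z ^~ p.2 \_ `[0, T]) p.1)%:E.
have := @measurable_fun_fubini_tonelli_G _ _ (measurableTypeR R) Omega R mu f.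
rewrite /fubini_G (_ : (fun y => (\int[mu]_x f (x, y))%E) =
  (fun w => \int[mu]_(t in `[0%R, T]) (Z t w)%:E)%E).
  apply; first exact/measurable_EFinP.
  move=> [t w]; rewrite lee_fin /= patchE; case: ifPn => // /set_mem; exact: Z0.
apply/funext => w; rewrite [RHS]integral_mkcond; apply: eq_integral => t _.
by rewrite /f /= !patchE; case: ifPn.
Qed.

Lemma jmeas_int T Z : jmeas T Z ->
  measurable_fun setT (fun w => \int[mu]_(t in `[0, T]) Z t w).
Proof.
move=> mZ; apply: measurableT_comp => //.
under eq_fun do rewrite integralE.
apply: emeasurable_funB.
- have := @jmeas_eint T (fun t w => Num.max (Z t w) 0) _ _.
  rewrite (_ : (fun w => \int[mu]_(t in `[0%R, T]) (Num.max (Z t w) 0)%:E)%E = 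
   (fun w => \int[mu]_(t in `[0%R, T]) ((fun t => (Z t w)%:E)^\+ t))%E).
    apply; first by apply: measurable_maxr => //; exact: measurable_cst.
    by move=> t w _; rewrite le_max lexx orbT.
  by apply/funext => w; apply: eq_integral => t _; rewrite funeposE EFin_max.
- have := @jmeas_eint T (fun t w => Num.max (- Z t w) 0) _ _.
  rewrite (_ : (fun w => \int[mu]_(t in `[0%R, T]) (Num.max (- Z t w) 0)%:E)%E = 
   (fun w => \int[mu]_(t in `[0%R, T]) ((fun t => (Z t w)%:E)^\- t))%E).
    apply.
      apply: measurable_maxr; last exact: measurable_cst.
      exact: measurable_funN.
    by move=> t w _; rewrite le_max lexx orbT.
  by apply/funext => w; apply: eq_integral => t _; rewrite funenegE EFin_max.
Qed.

Lemma jmeas_eexp (P : probability Omega R) T Z : jmeas T Z ->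
  (forall t w, t \in `[0, T] -> 0 <= Z t w) ->
  measurable_fun `[0, T]%classic (fun t => \int[P]_w (Z t w)%:E)%E.
Proof.
move=> /jmeas_patch mZ Z0.
pose f p := ((Z ^~ p.2 \_ `[0, T]) p.1)%:E.
have mF : measurable_fun setT (fubini_F P f).
  apply: (@measurable_fun_fubini_tonelli_F _ _ (measurableTypeR R)).
    exact/measurable_EFinP.
  by move=> [t w]; rewrite lee_fin /= patchE; case: ifPn => // /set_mem; exact: Z0.
have mF' : measurable_fun `[0, T]%classic (fubini_F P f) by exact: measurable_funTS mF.
apply: (eq_measurable_fun _ _ mF') => t tT.
by apply: eq_integral => w _; rewrite /f /= patchE tT.
Qed.

Lemma jmeas_tonelli (P : probability Omega R) T Z : jmeas T Z ->
  (forall t w, t \in `[0, T] -> 0 <= Z t w) ->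
  (\int[P]_w \int[mu]_(t in `[0%R, T]) (Z t w)%:E =
   \int[mu]_(t in `[0%R, T]) \int[P]_w (Z t w)%:E)%E.
Proof.
move=> /jmeas_patch mZ Z0.
pose f p := ((Z ^~ p.2 \_ `[0, T]) p.1)%:E.
have := @fubini_tonelli _ _ (measurableTypeR R) Omega R mu P f.
rewrite (_ : (\int[mu]_x _ = \int[mu]_(t in `[0%R, T]) \int[P]_w (Z t w)%:E)%E).
  rewrite (_ : (\int[P]_y _ = \int[P]_w \int[mu]_(t in `[0%R, T]) (Z t w)%:E)%E).
    move=> ->//; first exact/measurable_EFinP.
    by move=> [t w]; rewrite lee_fin /= patchE; case: ifPn => // /set_mem; exact: Z0.
  apply: eq_integral => w _; rewrite [RHS]integral_mkcond; apply: eq_integral => t _.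
  by rewrite /f /= !patchE; case: ifPn.
rewrite [RHS]integral_mkcond; apply: eq_integral => t _.
rewrite patchE; case: ifPn => [tT|tT].
  by apply: eq_integral => w _; rewrite /f /= patchE tT.
rewrite integral0_eq// => w _.
by rewrite /f /= patchE (negbTE tT).
Qed.

Lemma jmeas_capital_of T delta x Z :
  (forall t, t \in `[0, T] -> measurable_fun setT (Z t)) ->
  (forall w, cadlag T (Z ^~ w)) -> jmeas T (fun t w => capital_of delta x (Z ^~ w) t).
Proof.
move=> mZ cZ; apply: jmeas_right_continuous; last first.
  by move=> w t tT; case: (cadlag_capital_of delta x (cZ w)) => + _; exact.
have jZ : jmeas T Z by apply: jmeas_right_continuous => // w t tT; case: (cZ w) => + _; exact.
move=> t tT; apply: measurable_funB.
  by apply: measurable_funD; [exact: measurable_cst|exact: mZ].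
apply: measurable_funM; first exact: measurable_cst.
apply: jmeas_int.
have tT' : t <= T by move: tT; rewrite in_itv /= => /andP[].
apply: jmeasM; first by apply: (jmeas_fst (f := fun s => expR (delta * s))); exact: bdm_expRM.
by apply: jmeasD; [exact: jmeas_cst|exact: jmeasW jZ].
Qed.

End joint_integrals.

(** * Moments of the normal law *)

Section real_integrable.
Context d (T : measurableType d) (R : realType) (m : {measure set T -> \bar R}).
Implicit Types (D : set T) (f g : T -> R).

Lemma integrable_scale D f (k : R) : measurable D ->
  m.-integrable D (EFin \o f) -> m.-integrable D (EFin \o (fun x => k * f x)).
Proof. by move=> mD /(integrableZl mD k); apply: eq_integrable. Qed.

End real_integrable.

Section density.
Context {R : realType}.
Local Notation mu := (@lebesgue_measure R).

(** The density agrees almost everywhere with the Radon-Nikodym derivative of the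
    normal law, which obeys the change of variables formula. *)
Lemma ge0_integral_normal_prob (s : R) (f : R -> \bar R) :
  measurable_fun setT f -> (forall x, 0 <= f x)%E ->
  (\int[normal_prob 0 s]_x f x = \int[mu]_x (f x * (normal_pdf 0 s x)%:E))%E.
Proof.
move=> mf f0.
have dom := normal_prob_dominates 0 s.
rewrite -(Radon_Nikodym_SigmaFinite.change_of_variables dom)//.
have ie := Radon_Nikodym_SigmaFinite.f_integrable dom.
have mpdf : measurable_fun setT (EFin \o (@normal_pdf R 0 s)).
  by apply/measurable_EFinP; exact: measurable_normal_pdf.
apply: ae_eq_integral => //.
- by apply: emeasurable_funM => //; exact: measurable_int ie.
- exact: emeasurable_funM.
- apply: ae_eqe_mul2l; apply: integral_ae_eq => //.
  by move=> E _ mE; rewrite -Radon_Nikodym_SigmaFinite.f_integral.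
Qed.

Lemma is_derive_normal_pdf (s x : R) : s != 0 ->
  is_derive x 1 (normal_pdf 0 s) (- (x / s ^+ 2) * normal_pdf 0 s x).
Proof.
move=> s0; rewrite normal_pdfE// /normal_fun.
apply: is_derive_eq.
rewrite /GRing.scale /=.
have s20 : s ^+ 2 != 0 by rewrite expf_neq0.
by rewrite -mulr_natl; field.
Qed.

(** As p' = - (x / s^2) p, integrating by parts over [-n, n] gives
    int x^2 p = s^2 int p - 2 s^2 n p(n), and the boundary term is of order 1/n
    because e^y >= 1 + y. *)
Lemma second_moment_normal (s : R) : s != 0 ->
  (\int[normal_prob 0 s]_x (x ^+ 2)%:E = (s ^+ 2)%:E)%E.
Proof.
move=> s0; rewrite ge0_integral_normal_prob//; last 2 first.
- by apply/measurable_EFinP; exact: measurable_funX.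
- by move=> x; rewrite lee_fin sqr_ge0.
pose F n : set (measurableTypeR R) := `[- n.+1%:R, n.+1%:R]%classic.
have ndF : nondecreasing_seq F.
  move=> m n mn; apply/subsetPset => x; rewrite /F /= !in_itv /= => /andP[mx xm].
  rewrite (le_trans _ mx) ?lerN2 ?ler_nat//=.
  by rewrite (le_trans xm)// ler_nat.
have UF : \bigcup_n F n = setT.
  rewrite -subTset => x _; exists (Num.truncn `|x|) => //.
  rewrite /F /= in_itv /= -ler_norml ltW//.
  exact: truncnS_gt.
have mF n : measurable (F n : set (measurableTypeR R)) by exact: measurable_itv.
have mpdf : measurable_fun setT (@normal_pdf R 0 s) by exact: measurable_normal_pdf.
have mx2p : measurable_fun setT (fun x : R => x ^+ 2 * normal_pdf 0 s x).
  by apply: measurable_funM => //; exact: measurable_funX.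
have cp : continuous (@normal_pdf R 0 s) by exact: continuous_normal_pdf.
have p0 := @normal_pdf_ge0 R 0 s.
have cv2 := @ge0_nondecreasing_set_cvg_integral _ (measurableTypeR R) _ F (fun x => (x ^+ 2 * normal_pdf 0 s x)%:E) mu ndF mF.
have cv0 := @ge0_nondecreasing_set_cvg_integral _ (measurableTypeR R) _ F (fun x => (normal_pdf 0 s x)%:E) mu ndF mF.
rewrite UF integral_normal_pdf in cv0.
have {}cv0 : (\int[mu]_(x in F i) (normal_pdf 0 s x)%:E)%E @[i --> \oo] --> 1%E.
  apply: cv0.
  - by move=> i; apply/measurable_funTS/measurable_EFinP.
  - by move=> i x _; rewrite lee_fin.
rewrite UF in cv2.
have {}cv2 : (\int[mu]_(x in F i) (x ^+ 2 * normal_pdf 0 s x)%:E)%E @[i --> \oo] -->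
   (\int[mu]_x (x ^+ 2 * normal_pdf 0 s x)%:E)%E.
  apply: cv2.
  - by move=> i; apply/measurable_funTS/measurable_EFinP.
  - by move=> i x _; rewrite lee_fin mulr_ge0// sqr_ge0.
under eq_integral do rewrite -EFinM.
apply: (cvg_unique _ cv2); first exact: ereal_hausdorff.
have parts n : (\int[mu]_(x in F n) (x ^+ 2 * normal_pdf 0 s x)%:E =
  (s ^+ 2)%:E * \int[mu]_(x in F n) (normal_pdf 0 s x)%:E
   - (2 * s ^+ 2 * (n.+1%:R * normal_pdf 0 s n.+1%:R))%:E)%E.
  have ip : mu.-integrable (F n) (EFin \o normal_pdf 0 s).
    exact: (integrableS _ _ (@subsetT _ _) (integrable_normal_pdf 0 s)).
  have cx2p : continuous (fun x : R => x ^+ 2 * normal_pdf 0 s x - s ^+ 2 * normal_pdf 0 s x).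
    move=> x; apply: cvgB; apply: cvgM => //; try exact: cp.
      exact: sqr_continuous.
    exact: cvg_cst.
  have lt : - n.+1%:R < n.+1%:R :> R by rewrite -subr_gt0 opprK addr_gt0.
  have dF (x : R) : is_derive x 1 (fun x : R => - s ^+ 2 * (x * normal_pdf 0 s x))
      (x ^+ 2 * normal_pdf 0 s x - s ^+ 2 * normal_pdf 0 s x).
    have := is_derive_normal_pdf x s0 => dp.
    apply: is_derive_eq; rewrite /GRing.scale /= !mulr1.
    have s20 : s ^+ 2 != 0 by rewrite expf_neq0.
    by field.
  have cG : continuous (fun x : R => - s ^+ 2 * (x * normal_pdf 0 s x)).
    move=> x; apply: cvgM; first exact: cvg_cst.
    by apply: cvgM; [exact: cvg_id|exact: cp].
  have := @continuous_FTC2 R (fun x => x ^+ 2 * normal_pdf 0 s x - s ^+ 2 * normal_pdf 0 s x)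
    (fun x => - s ^+ 2 * (x * normal_pdf 0 s x)) _ _ lt (continuous_subspaceT cx2p).
  have -> : normal_pdf 0 s (- n.+1%:R) = normal_pdf 0 s n.+1%:R :> R.
    by rewrite !normal_pdfE// /normal_fun !subr0 sqrrN.
  have ex2 : mu.-integrable (F n) (EFin \o (fun x => x ^+ 2 * normal_pdf 0 s x)).
    apply: (@le_integrable _ _ _ mu (F n) (mF n) _ (EFin \o (fun x => n.+1%:R ^+ 2 * normal_pdf 0 s x))) => //.
    - by apply/measurable_EFinP; exact: measurable_funTS.
    - move=> x; rewrite /F /= in_itv /= => /andP[nx xn]; have nn (y : R) : 0 <= y ^+ 2 * normal_pdf 0 s x by apply: mulr_ge0 => //; exact: sqr_ge0.
      rewrite lee_fin (ger0_norm (nn x)) (ger0_norm (nn _)).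
      rewrite ler_wpM2r// -(real_normK (num_real x)) lerXn2r ?nnegrE//.
      by rewrite ler_norml nx.
    - exact: (@integrable_scale _ _ _ mu (F n) (normal_pdf 0 s)).
  have isp : mu.-integrable (F n) (EFin \o (fun x => s ^+ 2 * normal_pdf 0 s x)).
    exact: (@integrable_scale _ _ _ mu (F n) (normal_pdf 0 s)).
  have -> : (\int[mu]_(x in F n) (x ^+ 2 * normal_pdf 0 s x)%:E =
    (\int[mu]_(x in F n) (x ^+ 2 * normal_pdf 0 s x))%:E)%E by rewrite fineK//; exact: integrable_fin_num ex2.
  have -> : (\int[mu]_(x in F n) (normal_pdf 0 s x)%:E =
    (\int[mu]_(x in F n) (normal_pdf 0 s x))%:E)%E by rewrite fineK//; exact: integrable_fin_num ip.
  move=> H.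
  have := congr1 fine (H _ _); rewrite -[LHS]/(Rintegral mu _ _) /= RintegralB// RintegralZl//.
  move=> {}H; rewrite -EFinM -EFinB; congr EFin.
  have {}H := H ltac:(by split => [x _||]; [exact: ex_derive|exact/cvg_at_right_filter/cG|exact/cvg_at_left_filter/cG])
    ltac:(by move=> x _; rewrite derive1E derive_val).
  by rewrite -[LHS](subrK (s ^+ 2 * \int[mu]_(x in F n) normal_pdf 0 s x)) H; ring.
suff : ((s ^+ 2)%:E * \int[mu]_(x in F n) (normal_pdf 0 s x)%:E
   - (2 * s ^+ 2 * (n.+1%:R * normal_pdf 0 s n.+1%:R))%:E)%E @[n --> \oo] --> ((s ^+ 2)%:E * 1 - 0)%E.
  by rewrite mule1 sube0; under eq_fun do rewrite -parts.
have s20 : 0 < s ^+ 2 by rewrite exprn_even_gt0.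
apply: cvgeB => //.
  by apply: cvgeZl.
apply: cvg_EFin; first exact: nearW.
suff : (2 * s ^+ 2 * (n.+1%:R * normal_pdf 0 s n.+1%:R)) @[n --> \oo] --> (2 * s ^+ 2 * 0) by rewrite mulr0.
apply: cvgM; first exact: cvg_cst.
apply: (@squeeze_cvgr _ _ _ _ (cst 0) (fun n => 2 * s ^+ 2 * normal_peak s * n.+1%:R^-1)).
- apply: nearW => n; apply/andP; split; first exact: (mulr_ge0 (ler0n _ _) (p0 _)).
  have n0 : 0 < n.+1%:R :> R by [].
  have -> : normal_pdf 0 s n.+1%:R = normal_peak s * expR (- (n.+1%:R ^+ 2 / (s ^+ 2 *+ 2))).
    by rewrite normal_pdfE//= /normal_fun subr0 mulNr.
  rewrite mulrCA [leRHS]mulrAC [leRHS]mulrC ler_wpM2l ?normal_peak_ge0//.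
  rewrite expRN ler_pdivrMr ?expR_gt0//.
  apply: (@le_trans _ _ (2 * s ^+ 2 / n.+1%:R * (1 + n.+1%:R ^+ 2 / (s ^+ 2 *+ 2)))).
    rewrite mulrDr mulr1 -[leLHS]add0r lerD//; first by rewrite divr_ge0// mulr_ge0// ltW.
    rewrite le_eqVlt; apply/orP; left; apply/eqP; rewrite -mulr_natl; field.
    by rewrite s0 /= addrC natr1 pnatr_eq0.
  by rewrite ler_wpM2l ?expR_ge1Dx// divr_ge0// mulr_ge0// ltW.
- exact: cvg_cst.
- rewrite -(mulr0 (2 * s ^+ 2 * normal_peak s)); apply: cvgM; first exact: cvg_cst.
  exact: cvg_harmonic.
Qed.

(** The reflection x |-> -x preserves the Lebesgue measure and the density. Equality
    of the positive and negative parts is how a vanishing mean is obtained below. *)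
Lemma first_moment_normal (s : R) : s != 0 ->
  (\int[normal_prob 0 s]_x (Num.max x 0)%:E = \int[normal_prob 0 s]_x (Num.max (- x) 0)%:E)%E.
Proof.
move=> s0.
have mp : measurable_fun setT (fun x : R => (Num.max x 0)%:E).
  by apply/measurable_EFinP; apply: measurable_maxr => //; exact: measurable_cst.
have mn : measurable_fun setT (fun x : R => (Num.max (- x) 0)%:E).
  by apply/measurable_EFinP; apply: measurable_maxr => //; exact: measurable_cst.
rewrite !ge0_integral_normal_prob//; last 2 first.
- by move=> x; rewrite lee_fin le_max lexx orbT.
- by move=> x; rewrite lee_fin le_max lexx orbT.
have mpdf : measurable_fun setT (EFin \o (@normal_pdf R 0 s)).
  by apply/measurable_EFinP; exact: measurable_normal_pdf.
pose f (x : measurableTypeR R) := ((Num.max x 0)%:E * (normal_pdf 0 s x)%:E)%E.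
have mf : measurable_fun setT f by exact: emeasurable_funM.
have f0 x : x \in setT -> (0 <= f x)%E.
  by move=> _; apply: mule_ge0; rewrite lee_fin ?normal_pdf_ge0// le_max lexx orbT.
have mN : measurable_fun setT (-%R : measurableTypeR R -> measurableTypeR R).
  exact: measurable_funN.
have H := ge0_integral_pushforward mN mu measurableT mf f0.
transitivity (\int[pushforward mu (-%R : _ -> measurableTypeR R)]_x f x)%E.
  by apply: eq_measure_integral => A mA _; apply/esym; exact: lebesgue_measureN.
rewrite H; apply: eq_integral => x _.
by rewrite /f /= !normal_pdfE// /normal_fun !subr0 sqrrN.
Qed.

End density.

(** * Sub-sigma-algebras, integrability and independence *)

Section sub_measurability.
Context {R : realType} {d : measure_display} {Omega : measurableType d}.
Implicit Types (F : set_system Omega) (Y Z : Omega -> R).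

(** On the space carrying the smaller sigma-algebra the closure properties of
    measurable functions apply. *)
Lemma sub_measurableP F Y : sigma_algebra setT F ->
  sub_measurable F Y <-> @measurable_fun _ _ (g_sigma_algebraType F) R setT Y.
Proof.
move=> sF; have E := measurable_g_measurableTypeE sF; split=> [mY _ B mB|mY].
  by rewrite E; apply: mY; exists B.
by move=> _ [B mB <-]; rewrite -E; exact: mY.
Qed.

Lemma sub_measurable_measurable F Y : F `<=` measurable -> sub_measurable F Y ->
  measurable_fun setT Y.
Proof. by move=> Fm mY _ B mB; apply/Fm/mY; exists B. Qed.

Lemma sub_measurableS F G Y : F `<=` G -> sub_measurable F Y -> sub_measurable G Y.
Proof. by move=> FG mY A /mY /FG. Qed.

Lemma sub_measurable2 F Y Z (h : R * R -> R) : sigma_algebra setT F ->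
  measurable_fun setT h -> sub_measurable F Y -> sub_measurable F Z ->
  sub_measurable F (fun w => h (Y w, Z w)).
Proof.
move=> sF mh /(sub_measurableP _ sF) mY /(sub_measurableP _ sF) mZ.
apply/(sub_measurableP _ sF).
by apply: (measurableT_comp mh); exact: measurable_fun_pair.
Qed.

Lemma sub_measurableM F Y Z : sigma_algebra setT F ->
  sub_measurable F Y -> sub_measurable F Z -> sub_measurable F (fun w => Y w * Z w).
Proof.
move=> sF; apply: (@sub_measurable2 _ _ _ (fun p => p.1 * p.2)) => //.
by apply: measurable_funM; [exact: measurable_fst|exact: measurable_snd].
Qed.

Lemma sub_measurableD F Y Z : sigma_algebra setT F ->
  sub_measurable F Y -> sub_measurable F Z -> sub_measurable F (fun w => Y w + Z w).
Proof.
move=> sF; apply: (@sub_measurable2 _ _ _ (fun p => p.1 + p.2)) => //.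
by apply: measurable_funD; [exact: measurable_fst|exact: measurable_snd].
Qed.

Lemma sub_measurableB F Y Z : sigma_algebra setT F ->
  sub_measurable F Y -> sub_measurable F Z -> sub_measurable F (fun w => Y w - Z w).
Proof.
move=> sF; apply: (@sub_measurable2 _ _ _ (fun p => p.1 - p.2)) => //.
by apply: measurable_funB; [exact: measurable_fst|exact: measurable_snd].
Qed.

Lemma sub_measurable_cst F (c : R) : sigma_algebra setT F ->
  sub_measurable F (fun=> c).
Proof. by move=> sF; apply/(sub_measurableP _ sF); exact: measurable_cst. Qed.

End sub_measurability.

Section square_integrable.
Context {R : realType} {d : measure_display} {Omega : measurableType d}.
Variable P : probability Omega R.
Implicit Types (X Y G : Omega -> R).

Definition L1 X := P.-integrable setT (EFin \o X).
Definition L2 X := measurable_fun setT X /\ L1 (fun w => X w ^+ 2).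
Local Notation "''E' X" := (\int[P]_w X w) (at level 10, X at level 8).

Lemma L1_measurable X : L1 X -> measurable_fun setT X.
Proof. by move=> /(measurable_int P) /measurable_EFinP. Qed.

Lemma L1_le X Y : measurable_fun setT X -> (forall w, `|X w| <= Y w) -> L1 Y -> L1 X.
Proof.
move=> mX XY; apply: le_integrable => //; first exact/measurable_EFinP.
by move=> w _; rewrite lee_fin (le_trans (XY w))// ler_norm.
Qed.

Lemma L1D X Y : L1 X -> L1 Y -> L1 (fun w => X w + Y w).
Proof. by move=> iX iY; have := integrableD measurableT iX iY; apply: eq_integrable. Qed.

Lemma L1B X Y : L1 X -> L1 Y -> L1 (fun w => X w - Y w).
Proof. by move=> iX iY; have := integrableB measurableT iX iY; apply: eq_integrable. Qed.

Lemma L1Z c X : L1 X -> L1 (fun w => c * X w).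
Proof. exact: integrable_scale. Qed.

Lemma L1_cst c : L1 (fun=> c).
Proof. exact: finite_measure_integrable_cst. Qed.

Lemma L1_sum (I : Type) (s : seq I) (X : I -> Omega -> R) :
  (forall i, L1 (X i)) -> L1 (fun w => \sum_(i <- s) X i w).
Proof.
move=> iX; elim: s => [|i s ih].
  by under eq_fun do rewrite big_nil; exact: L1_cst.
by under eq_fun do rewrite big_cons; exact: L1D.
Qed.

Lemma expD X Y : L1 X -> L1 Y -> 'E (fun w => X w + Y w) = 'E X + 'E Y.
Proof. by move=> iX iY; rewrite RintegralD. Qed.

Lemma expB X Y : L1 X -> L1 Y -> 'E (fun w => X w - Y w) = 'E X - 'E Y.
Proof. by move=> iX iY; rewrite RintegralB. Qed.

Lemma expZ c X : L1 X -> 'E (fun w => c * X w) = c * 'E X.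
Proof. by move=> iX; rewrite RintegralZl. Qed.

Lemma exp_sum (I : Type) (s : seq I) (X : I -> Omega -> R) :
  (forall i, L1 (X i)) -> 'E (fun w => \sum_(i <- s) X i w) = \sum_(i <- s) 'E (X i).
Proof.
move=> iX; elim: s => [|i s ih].
  rewrite big_nil; under eq_Rintegral do rewrite big_nil.
  by rewrite Rintegral_cst// mul0r.
rewrite big_cons -ih -expD//; last exact: L1_sum.
by apply: eq_Rintegral => w _; rewrite big_cons.
Qed.

Lemma exp_cst c : 'E (fun=> c) = c.
Proof.
rewrite Rintegral_cst// -[RHS]mulr1; congr (_ * _).
by have /(congr1 fine) := probability_setT P.
Qed.

Lemma exp_le X Y : L1 X -> L1 Y -> (forall w, X w <= Y w) -> 'E X <= 'E Y.
Proof. by move=> iX iY XY; apply: le_Rintegral. Qed.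

Lemma exp_norm_le X : L1 X -> `|'E X| <= 'E (fun w => `|X w|).
Proof. by move=> iX; apply: le_normr_Rintegral. Qed.

Lemma L1_norm X : L1 X -> L1 (fun w => `|X w|).
Proof. by move=> iX; apply: integrable_norm. Qed.

Lemma exp_EFin X : L1 X -> (\int[P]_w (X w)%:E)%E = ('E X)%:E.
Proof. by move=> iX; rewrite fineK//; exact: integrable_fin_num iX. Qed.

Lemma L2_M X Y : L2 X -> L2 Y -> L1 (fun w => X w * Y w).
Proof.
move=> [mX iX] [mY iY]; apply: (@L1_le _ (fun w => X w ^+ 2 + Y w ^+ 2)).
- exact: measurable_funM.
- move=> w; rewrite ler_norml; apply/andP; split.
    have := sqr_ge0 (X w + Y w); have := sqr_ge0 (X w); have := sqr_ge0 (Y w).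
    by rewrite !expr2; nra.
  have := sqr_ge0 (X w - Y w); have := sqr_ge0 (X w); have := sqr_ge0 (Y w).
  by rewrite !expr2; nra.
- exact: L1D.
Qed.

Lemma L2_cst c : L2 (fun=> c).
Proof. by split; [exact: measurable_cst|exact: L1_cst]. Qed.

Lemma L2_L1 X : L2 X -> L1 X.
Proof.
move=> X2; have := L2_M X2 (L2_cst 1); apply: eq_integrable => //.
by move=> w _ /=; rewrite mulr1.
Qed.

Lemma L2D X Y : L2 X -> L2 Y -> L2 (fun w => X w + Y w).
Proof.
move=> X2 Y2; split; first by apply: measurable_funD; [case: X2|case: Y2].
have := L1D (L1D X2.2 (L1Z 2 (L2_M X2 Y2))) Y2.2.
by apply: eq_integrable => // w _ /=; congr EFin; ring.
Qed.

Definition bdd X := measurable_fun setT X /\ exists c : R, forall w, `|X w| <= c.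

Lemma L2_bddM U X : bdd U -> L2 X -> L2 (fun w => U w * X w).
Proof.
move=> [mU [c Uc]] [mX iX]; split; first exact: measurable_funM.
apply: (@L1_le _ (fun w => c ^+ 2 * X w ^+ 2)); last exact: L1Z.
  by apply: measurable_funX; exact: measurable_funM.
move=> w; rewrite ger0_norm ?sqr_ge0// exprMn ler_wpM2r ?sqr_ge0//.
by rewrite -(real_normK (num_real (U w))) lerXn2r ?nnegrE// (le_trans (normr_ge0 (U w))).
Qed.

Lemma bdd_L2 U : bdd U -> L2 U.
Proof.
move=> bU; have := L2_bddM bU (L2_cst 1).
by under eq_fun do rewrite mulr1.
Qed.

Lemma bddM U V : bdd U -> bdd V -> bdd (fun w => U w * V w).
Proof.
move=> [mU [c Uc]] [mV [c' Vc]]; split; first exact: measurable_funM.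
exists (c * c') => w; rewrite normrM ler_pM//.
Qed.

(** The hypothesis says that the law of the pair is the product of the two laws, and
    Fubini's theorem applies to the product measure. *)
Lemma indep_exp X Y : L1 X -> L1 Y ->
  (forall A B : set R, measurable A -> measurable B ->
     P (X @^-1` A `&` Y @^-1` B) = (P (X @^-1` A) * P (Y @^-1` B))%E) ->
  L1 (fun w => X w * Y w) /\ 'E (fun w => X w * Y w) = 'E X * 'E Y.
Proof.
move=> iX iY ind.
have mX := L1_measurable iX; have mY := L1_measurable iY.
pose X' : {RV P >-> R} := HB.pack X (isMeasurableFun.Build _ _ _ _ X mX).
pose Y' : {RV P >-> R} := HB.pack Y (isMeasurableFun.Build _ _ _ _ Y mY).
have mXY : measurable_fun setT (fun w => (X w, Y w)) by exact: measurable_fun_pair.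
pose XY : {mfun Omega >-> (R * R)%type} :=
  HB.pack (fun w => (X w, Y w)) (isMeasurableFun.Build _ _ _ _ _ mXY).
have joint A : measurable A ->
    product_measure1 (distribution P X') (distribution P Y') A = distribution P XY A.
  by apply: product_measure_unique => // B C mB mC; rewrite /distribution /pushforward /= -ind.
pose f (p : R * R) : \bar R := (p.1 * p.2)%:E.
have mf : measurable_fun setT f.
  by apply/measurable_EFinP; apply: measurable_funM; [exact: measurable_fst|exact: measurable_snd].
have fi : (product_measure1 (distribution P X') (distribution P Y')).-integrable setT f.
  apply/integrable12ltyP => //.
  rewrite (_ : (\int[_]_x _)%E = (\int[distribution P X']_x (`|x|%:E * \int[distribution P Y']_y `|y|%:E))%E); last first.
    apply: eq_integral => x _; rewrite -ge0_integralZl//; last exact/measurable_EFinP.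
    by apply: eq_integral => y _; rewrite /f /= normrM EFinM.
  rewrite ge0_integralZr//; [|exact/measurable_EFinP|exact: integral_ge0].
  rewrite !ge0_integral_distribution//; try exact/measurable_EFinP.
  have aX := L1_norm iX; have aY := L1_norm iY.
  have /= -> := exp_EFin aX; have /= -> := exp_EFin aY.
  by rewrite -EFinM ltry.
have i1 : L1 (fun w => X w * Y w).
  apply/integrableP; split; first by apply/measurable_EFinP; exact: measurable_funM.
  have /integrableP[_] := fi.
  rewrite (eq_measure_integral (distribution P XY)); last by move=> A mA _; exact: joint.
  by rewrite ge0_integral_distribution//; exact: measurableT_comp.
split => //; apply/EFin_inj; rewrite -exp_EFin//.
have -> : (\int[P]_w (X w * Y w)%:E = \int[distribution P XY]_p f p)%E.
  by rewrite integral_distribution.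
rewrite -(eq_measure_integral _ (fun A mA _ => joint A mA)) -integral12_prod_meas1//.
rewrite /fubini_F /f /=.
have iY' : (distribution P Y').-integrable setT (fun y => y%:E).
  by apply: integrable_pushforward => //; exact/measurable_EFinP.
have iX' : (distribution P X').-integrable setT (fun y => y%:E).
  by apply: integrable_pushforward => //; exact/measurable_EFinP.
have EY : (\int[distribution P Y']_y y%:E = ('E Y)%:E)%E.
  by rewrite integral_distribution ?exp_EFin//; exact/measurable_EFinP.
have EX : (\int[distribution P X']_y y%:E = ('E X)%:E)%E.
  by rewrite integral_distribution ?exp_EFin//; exact/measurable_EFinP.
rewrite (_ : (\int[_]_x _)%E = (\int[distribution P X']_x (x%:E * ('E Y)%:E))%E); last first.
  apply: eq_integral => x _; rewrite -EY -integralZl//.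
by rewrite integralZr// EX EFinM.
Qed.

End square_integrable.

(** * Brownian increments and the augmented filtration *)

Section brownian.
Context {R : realType} {d : measure_display} {Omega : measurableType d}.
Variables (P : probability Omega R) (hP : measure_is_complete P) (T : R).
Variables (W : R -> Omega -> R) (hW : brownian_motion P T W).
Implicit Types (s t : R).
Local Notation "''E' X" := (\int[P]_w X w) (at level 10, X at level 8).
Local Notation nat_ s := (natural_filtration T W s).
Local Notation aug s := <<s natural_filtration T W s `|` P.-negligible >>.
Local Notation F := (augmented_filtration P T W).

Lemma natural_filtration_measurable s : nat_ s `<=` measurable.
Proof.
apply: smallest_sub; first exact: sigma_algebra_measurable.
move=> _ [r /= rI] [B mB <-]; apply: (brownian_measurable hW) => //.
by move: rI; rewrite !in_itv /= => /andP[-> ]; rewrite le_min => /andP[].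
Qed.

(** Completeness of P makes the negligible sets events. *)
Lemma aug_measurable s : aug s `<=` measurable.
Proof.
apply: smallest_sub; first exact: sigma_algebra_measurable.
by rewrite subUset; split; [exact: natural_filtration_measurable|exact: hP].
Qed.

Lemma augmented_sigma_algebra s : sigma_algebra setT (F s).
Proof. by apply: sigma_algebra_bigcap => r _; exact: smallest_sigma_algebra. Qed.

(** The price of right continuity is an arbitrarily short delay, which is why
    independence is first used for increments starting strictly after s. *)
Lemma augmented_aug s t : s < t -> F s `<=` aug t.
Proof. by move=> st A; apply; rewrite /= in_itv /= st. Qed.

Lemma augmentedS s t : s <= t -> F s `<=` F t.
Proof.
move=> st A FA r /=; rewrite in_itv /= andbT => tr.
by apply: FA; rewrite /= in_itv /= (le_lt_trans st tr).
Qed.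

Lemma augmented_measurable s : F s `<=` measurable.
Proof.
have s1 : s < s + 1 by rewrite ltrDl.
by move=> A /(augmented_aug s1) /aug_measurable.
Qed.

Lemma brownian_adapted : adapted T F W.
Proof.
move=> t tT A mA r /=; rewrite in_itv /= andbT => tr.
apply: sub_sigma_algebra; left; apply: sub_sigma_algebra; exists t => //.
move: tT; rewrite /= !in_itv /= => /andP[-> tT].
by rewrite le_min (ltW tr) tT.
Qed.

(** The sets that have such a modification form a sigma-algebra, which contains the
    natural filtration and the negligible sets. *)
Lemma aug_null_modification s A : aug s A ->
  exists A' N, [/\ nat_ s A', measurable N, P N = 0%E & A `\` N = A' `\` N].
Proof.
apply: (smallest_sub (X := [set A | exists A' N, [/\ nat_ s A', measurable N, P N = 0%E & A `\` N = A' `\` N]])).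
  split.
  - by exists set0, set0; split => //; exact: sigma_algebra0.
  - move=> B [B' [N [nB mN N0 E]]]; exists (~` B'), N; split => //.
      by rewrite -setTD; exact: sigma_algebraCD.
    apply/seteqP; split => w /= [].
      move=> [_ nBw] nN; split => // B'w; apply: nBw.
      by have [] : (B `\` N) w by rewrite E.
    move=> nBw nN; split => //; split => // Bw; apply: nBw.
    by have [] : (B' `\` N) w by rewrite -E.
  - move=> B /choice [B' /choice [N H]].
    exists (\bigcup_k B' k), (\bigcup_k N k); split.
    + by apply: sigma_algebra_bigcup => k; case: (H k).
    + by apply: bigcup_measurable => k _; case: (H k).
    + have mN k : measurable (N k) by case: (H k).
      have mU : measurable (\bigcup_k N k) by exact: bigcup_measurable.
      have NU : P.-negligible (\bigcup_k N k).
        apply: negligible_bigcup => k; exists (N k); split => //.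
        by case: (H k).
      by move: NU => /negligibleP -/(_ mU).
    + apply/seteqP; split => w /= [[k _ Bw] nN]; split => //; exists k => //.
        have [_ _ _ E] := H k.
        have [] // : (B' k `\` N k) w by rewrite -E; split => // Nw; apply: nN; exists k.
      have [_ _ _ E] := H k.
      by have [] // : (B k `\` N k) w by rewrite E; split => // Nw; apply: nN; exists k.
move=> B [nB|[N [mN N0 BN]]].
  by exists B, set0; split.
exists set0, N; split => //; first exact: sigma_algebra0.
by rewrite set0D; apply/seteqP; split => w //= [/BN].
Qed.

Lemma measure_null_modification (A A' N : set Omega) : measurable A -> measurable A' ->
  measurable N -> P N = 0%E -> A `\` N = A' `\` N -> P A = P A'.
Proof.
have le B B' : measurable B -> measurable B' ->
  measurable N -> P N = 0%E -> B `\` N = B' `\` N -> (P B <= P B')%E.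
  move=> mB mB' mN N0 E.
  apply: (@le_trans _ _ (P (B' `|` N))).
    apply: le_measure; rewrite ?inE//; first exact: measurableU.
    move=> w Bw; have [Nw|nN] := pselect (N w); first by right.
    by left; have [] : (B' `\` N) w by rewrite -E.
  apply: (@le_trans _ _ (P B' + P N)%E); first exact: measureU2.
  by rewrite N0 adde0.
by move=> mA mA' mN N0 E; apply/eqP; rewrite eq_le !le.
Qed.

Local Notation D s t := (fun w => W t w - W s w).

(** Replacing A by an event of the natural filtration changes neither side. *)
Lemma aug_indep s t A B : 0 <= s -> s < t -> t <= T -> aug s A -> measurable B ->
  P (A `&` D s t @^-1` B) = (P A * P (D s t @^-1` B))%E.
Proof.
move=> s0 st tT sA mB.
have [A' [N [nA' mN N0 E]]] := aug_null_modification sA.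
have mA := aug_measurable sA; have mA' := natural_filtration_measurable nA'.
have t0 : 0 <= t by rewrite (le_trans s0)// ltW.
have mD : measurable (D s t @^-1` B).
  rewrite -[X in measurable X]setTI; apply: measurable_funB => //.
    by apply: (brownian_measurable hW); rewrite in_itv /= t0.
  by apply: (brownian_measurable hW); rewrite in_itv /= s0 (le_trans (ltW st)).
rewrite (measure_null_modification mA mA' mN N0 E).
rewrite -(brownian_independent hW s0 st tT nA' mB).
apply: (measure_null_modification _ _ mN N0); try exact: measurableI.
by rewrite ![_ `&` (_ @^-1` B)]setIC -!setIDA E.
Qed.

Lemma increment_measurable s t : 0 <= s <= T -> 0 <= t <= T -> measurable_fun setT (D s t).
Proof. by move=> sT tT; apply: measurable_funB; apply: (brownian_measurable hW); rewrite in_itv. Qed.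

Section increment_law.
Variables (s t : R) (s0 : 0 <= s) (st : s < t) (tT : t <= T).

Let sigma0 : Num.sqrt (t - s) != 0.
Proof. by rewrite sqrtr_eq0 -ltNge subr_gt0. Qed.

Let mD : measurable_fun setT (D s t).
Proof.
apply: increment_measurable; first by rewrite s0 (le_trans (ltW st)).
by rewrite tT (le_trans s0 (ltW st)).
Qed.

Let integral_D (f : R -> \bar R) : measurable_fun setT f -> (forall x, 0 <= f x)%E ->
  (\int[P]_w f (W t w - W s w)%R = \int[normal_prob 0 (Num.sqrt (t - s))]_x f x)%E.
Proof.
move=> mf f0.
have mD' : measurable_fun [set: Omega] (D s t : Omega -> measurableTypeR R) by exact: mD.
have mf' : measurable_fun [set: measurableTypeR R] f by exact: mf.
pose X : {RV P >-> measurableTypeR R} :=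
  HB.pack (D s t : Omega -> measurableTypeR R)
    (isMeasurableFun.Build _ _ _ _ (D s t : Omega -> measurableTypeR R) mD').
rewrite -[LHS](ge0_integral_distribution X mf')//.
apply: eq_measure_integral => B mB _.
exact: (brownian_normal hW s0 st tT mB).
Qed.

Lemma increment_second : L2 P (D s t) /\ 'E (fun w => (W t w - W s w) ^+ 2) = t - s.
Proof.
have H : (\int[P]_w ((W t w - W s w) ^+ 2)%:E = (t - s)%:E)%E.
  rewrite (integral_D (f := fun x => (x ^+ 2)%:E)).
  - by rewrite second_moment_normal// sqr_sqrtr// subr_ge0 ltW.
  - by apply/measurable_EFinP; exact: measurable_funX.
  - by move=> x; rewrite lee_fin sqr_ge0.
split; last by rewrite /Rintegral H.
split => //; apply/integrableP; split.
  by apply/measurable_EFinP; exact: measurable_funX.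
under eq_integral do rewrite /= ger0_norm ?sqr_ge0//.
by rewrite H ltry.
Qed.

Lemma increment_first : 'E (D s t) = 0.
Proof.
have [/L2_L1 iD _] := increment_second.
rewrite /Rintegral integralE.
have -> : (\int[P]_w (fun w => (W t w - W s w)%:E)^\+ w =
    \int[normal_prob 0 (Num.sqrt (t - s))]_x (Num.max x 0)%:E)%E.
  rewrite -(integral_D (f := fun x => (Num.max x 0)%:E)).
  - by apply: eq_integral => w _; rewrite funeposE EFin_max.
  - by apply/measurable_EFinP; apply: measurable_maxr => //; exact: measurable_cst.
  - by move=> x; rewrite lee_fin le_max lexx orbT.
have E : (\int[P]_w (fun w => (W t w - W s w)%:E)^\- w =
    \int[normal_prob 0 (Num.sqrt (t - s))]_x (Num.max (- x) 0)%:E)%E.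
  rewrite -(integral_D (f := fun x => (Num.max (- x) 0)%:E)).
  - by apply: eq_integral => w _; rewrite funenegE EFin_max.
  - by apply/measurable_EFinP; apply: measurable_maxr => //; exact: measurable_cst.
  - by move=> x; rewrite lee_fin le_max lexx orbT.
rewrite first_moment_normal// E subee// -E.
exact: (integrable_neg_fin_num measurableT iD).
Qed.

End increment_law.

Lemma increment_L2 s t : 0 <= s -> s <= t -> t <= T -> L2 P (D s t).
Proof.
move=> s0; rewrite le_eqVlt => /predU1P[<- sT|st tT].
  by rewrite (_ : (fun w => _) = cst 0); [exact: L2_cst|apply/funext => w; rewrite subrr].
by have [] := increment_second s0 st tT.
Qed.

Lemma increment_second_le s t : 0 <= s -> s <= t -> t <= T ->
  'E (fun w => (W t w - W s w) ^+ 2) = t - s.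
Proof.
move=> s0; rewrite le_eqVlt => /predU1P[<- sT|st tT].
  by under eq_Rintegral do rewrite subrr expr0n; rewrite exp_cst subrr.
by have [] := increment_second s0 st tT.
Qed.

Lemma increment_orth_strict s s' t (G : Omega -> R) : 0 <= s -> s < s' -> s' < t -> t <= T ->
  sub_measurable (F s) G -> L2 P G -> 'E (fun w => G w * (W t w - W s' w)) = 0.
Proof.
move=> s0 ss s't tT mG G2.
have s'0 : 0 <= s' by rewrite (le_trans s0)// ltW.
have D2 := increment_L2 s'0 (ltW s't) tT.
have [||A B mA mB|_ ->] := @indep_exp _ _ _ P G (D s' t).
- exact: L2_L1.
- exact: L2_L1.
- apply: aug_indep => //; apply: (augmented_aug ss).
  by rewrite -[X in F s X]setTI; apply: mG; exists A.
- by rewrite increment_first// mulr0.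
Qed.

Lemma increment_second_strict s s' t (G : Omega -> R) : 0 <= s -> s < s' -> s' < t -> t <= T ->
  sub_measurable (F s) G -> L1 P G ->
  'E (fun w => G w * (W t w - W s' w) ^+ 2) = 'E G * (t - s').
Proof.
move=> s0 ss s't tT mG G2.
have s'0 : 0 <= s' by rewrite (le_trans s0)// ltW.
have D2 := increment_L2 s'0 (ltW s't) tT.
have [||A B mA mB|_ ->] := @indep_exp _ _ _ P G (fun w => (W t w - W s' w) ^+ 2).
- exact: G2.
- by case: D2.
- have -> : (fun w => (W t w - W s' w) ^+ 2) @^-1` B = D s' t @^-1` ((fun x : R => x ^+ 2) @^-1` B) by [].
  apply: aug_indep => //; last first.
    rewrite -[X in measurable X]setTI.
    have m2 : measurable_fun setT (fun x : R => x ^+ 2) by exact: measurable_funX.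
    exact: m2.
  apply: (augmented_aug ss).
  by rewrite -[X in F s X]setTI; apply: mG; exists A.
- by rewrite increment_second_le// ltW.
Qed.

(** Lets the delay between s and the start of an increment tend to zero. *)
Lemma small_eq0 (x K : R) (h : R) : 0 < h -> 0 <= K ->
  (forall e, 0 < e -> e < h -> `|x| <= K * e) -> x = 0.
Proof.
move=> h0 K0 H; apply/eqP; rewrite -normr_eq0; apply/negPn/negP => x0.
have x0' : 0 < `|x| by rewrite lt_neqAle eq_sym x0 normr_ge0.
pose e := Num.min (h / 2) (`|x| / (2 * (K + 1))).
have K1 : 0 < K + 1 by rewrite ltr_wpDl.
have e0 : 0 < e by rewrite lt_min divr_gt0//= divr_gt0// mulr_gt0.
have eh : e < h by rewrite gt_min ltr_pdivrMr// mulr_natr mulr2n ltrDl h0.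
have := H e e0 eh; apply/negP; rewrite -ltNge.
apply: (@le_lt_trans _ _ ((K + 1) * (`|x| / (2 * (K + 1))))).
  apply: ler_pM => //; [exact: ltW|by rewrite lerDl|by rewrite ge_min lexx orbT].
have -> : (K + 1) * (`|x| / (2 * (K + 1))) = `|x| / 2 by field; rewrite gt_eqF.
by rewrite ltr_pdivrMr// mulr_natr mulr2n ltrDl.
Qed.

(** The increment after a short delay is independent of F s and contributes 0; the
    increment during the delay is small in L2. *)
Lemma increment_orth s t (G : Omega -> R) : 0 <= s -> s <= t -> t <= T ->
  sub_measurable (F s) G -> L2 P G -> 'E (fun w => G w * (W t w - W s w)) = 0.
Proof.
move=> s0; rewrite le_eqVlt => /predU1P[<- sT _ _|st tT mG G2].
  by under eq_Rintegral do rewrite subrr mulr0; rewrite exp_cst.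
have EG0 : 0 <= 'E (fun w => G w ^+ 2) by apply: Rintegral_ge0 => w _; exact: sqr_ge0.
apply: (@small_eq0 _ (('E (fun w => G w ^+ 2) + 1)) (Num.min 1 (t - s))).
- by rewrite lt_min ltr01 subr_gt0.
- by rewrite addr_ge0.
move=> e e0; rewrite lt_min => /andP[e1 ets].
(* With this delay the L2 norm of the early increment is e. *)
pose s' := s + e ^+ 2.
have e20 : 0 < e ^+ 2 by rewrite exprn_gt0.
have e2e : e ^+ 2 <= e by rewrite expr2 ger_pMr// ltW.
have ss' : s < s' by rewrite ltrDl.
have s't : s' < t by rewrite /s'; move: ets; lra.
have s'0 : 0 <= s' by rewrite ltW// (le_lt_trans s0).
have D1 := increment_L2 s0 (ltW ss') (le_trans (ltW s't) tT).
have D2 := increment_L2 s'0 (ltW s't) tT.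
have -> : 'E (fun w => G w * (W t w - W s w)) = 'E (fun w => G w * (W s' w - W s w)).
  rewrite -[RHS]addr0 -(increment_orth_strict s0 ss' s't tT mG G2) -expD; try exact: L2_M.
  by apply: eq_Rintegral => w _; ring.
apply: (le_trans (exp_norm_le (L2_M G2 D1))).
have i3 : L1 P (fun w => e * G w ^+ 2 + e^-1 * (W s' w - W s w) ^+ 2).
  by apply: L1D; apply: L1Z; [case: G2|case: D1].
apply: (@le_trans _ _ ('E (fun w => e * G w ^+ 2 + e^-1 * (W s' w - W s w) ^+ 2))).
  apply: exp_le => //; first exact: L1_norm (L2_M G2 D1).
  move=> w; set g := G w; set D := _ - _.
  have -> : e * g ^+ 2 + e^-1 * D ^+ 2 = e^-1 * (e ^+ 2 * g ^+ 2 + D ^+ 2).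
    by field; rewrite gt_eqF.
  rewrite ler_pdivlMl// -[X in X * _](gtr0_norm e0) -normrM ler_norml.
  by have := sqr_ge0 (e * g - D); have := sqr_ge0 (e * g + D); have := sqr_ge0 (e * g); have := sqr_ge0 D; rewrite !expr2; nra.
rewrite expD; [|by apply: L1Z; case: G2|by apply: L1Z; case: D1].
rewrite !expZ; [|by case: D1|by case: G2].
rewrite increment_second_le ?(ltW ss') ?(le_trans (ltW s't))//.
rewrite /s' addrAC subrr add0r le_eqVlt; apply/orP; left; apply/eqP; field.
by rewrite gt_eqF.
Qed.

Lemma increment_sub_measurable s t : 0 <= s -> s <= t -> t <= T -> sub_measurable (F t) (D s t).
Proof.
move=> s0 st tT; apply: sub_measurableB; first exact: augmented_sigma_algebra.
  by apply: brownian_adapted; rewrite in_itv /= tT (le_trans s0).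
apply: (sub_measurableS (augmentedS st)).
by apply: brownian_adapted; rewrite in_itv /= s0 (le_trans st).
Qed.

(** The same splitting as in increment_orth: the cross term is orthogonal to the
    past, and the two terms of the early increment are of the order of the delay. *)
Lemma increment_quad s t (U : Omega -> R) : 0 <= s -> s <= t -> t <= T ->
  sub_measurable (F s) U -> bdd U ->
  'E (fun w => U w * (W t w - W s w) ^+ 2) = 'E U * (t - s).
Proof.
move=> s0; rewrite le_eqVlt => /predU1P[<- sT _ _|st tT mU bU].
  by under eq_Rintegral do rewrite subrr expr0n mulr0; rewrite exp_cst subrr mulr0.
have U2 := bdd_L2 P bU; have U1 := L2_L1 U2.
have [_ [c Uc]] := bU.
have c0 : 0 <= c by exact: le_trans (normr_ge0 _) (Uc point).
apply/eqP; rewrite -subr_eq0; apply/eqP.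
apply: (@small_eq0 _ (2 * c) (t - s)); [by rewrite subr_gt0|by rewrite mulr_ge0|].
move=> e e0 ets.
pose s' := s + e.
have ss' : s < s' by rewrite ltrDl.
have s't : s' < t by rewrite /s' -ltrBrDl.
have s'0 : 0 <= s' by rewrite ltW// (le_lt_trans s0).
have s'T : s' <= T := le_trans (ltW s't) tT.
have D1 := increment_L2 s0 (ltW ss') s'T.
have D2 := increment_L2 s'0 (ltW s't) tT.
have UD1 := L2_bddM bU D1; have UD2 := L2_bddM bU D2.
have a : 'E (fun w => U w * (W s' w - W s w) * (W t w - W s' w)) = 0.
  apply: increment_orth => //; first exact: ltW.
  apply: sub_measurableM; first exact: augmented_sigma_algebra.
    exact: (sub_measurableS (augmentedS (ltW ss'))).
  by apply: increment_sub_measurable => //; exact: ltW.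
have b := increment_second_strict s0 ss' s't tT mU U1.
have i1 : L1 P (fun w => U w * (W s' w - W s w) ^+ 2).
  have := L2_M UD1 D1; apply: eq_integrable => // w _ /=; congr EFin; ring.
have i2 : L1 P (fun w => U w * (W t w - W s' w) ^+ 2).
  have := L2_M UD2 D2; apply: eq_integrable => // w _ /=; congr EFin; ring.
have i3 := L2_M UD1 D2.
have -> : 'E (fun w => U w * (W t w - W s w) ^+ 2) =
  'E (fun w => U w * (W s' w - W s w) ^+ 2) + 'E U * (t - s').
  rewrite -b -[X in _ + X]addr0 -[X in _ + (_ + X)](mulr0 2) -a -expZ// -expD//; last exact: L1Z.
  rewrite -expD//; last by apply: L1D => //; exact: L1Z.
  by apply: eq_Rintegral => w _; ring.
have -> : 'E (fun w => U w * (W s' w - W s w) ^+ 2) + 'E U * (t - s') - 'E U * (t - s) =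
  'E (fun w => U w * (W s' w - W s w) ^+ 2) - 'E U * e by rewrite /s'; ring.
rewrite (le_trans (ler_normB _ _))// [2 * c]mulrDl mul1r mulrDl lerD//.
  apply: (le_trans (exp_norm_le i1)).
  apply: (@le_trans _ _ ('E (fun w => c * (W s' w - W s w) ^+ 2))).
    apply: exp_le; [exact: L1_norm i1|by apply: L1Z; case: D1|].
    by move=> w; rewrite normrM [X in _ * X]ger0_norm ?sqr_ge0// ler_wpM2r ?sqr_ge0.
  rewrite expZ; last by case: D1.
  by rewrite increment_second_le ?(ltW ss')// /s' addrAC subrr add0r.
rewrite normrM (gtr0_norm e0) ler_wpM2r ?(ltW e0)//.
rewrite (le_trans (exp_norm_le U1))// -[leRHS](@exp_cst _ _ _ P).
by apply: exp_le => //; [exact: L1_norm|exact: L1_cst].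
Qed.

End brownian.

(** * The Ito isometry *)

Lemma jmeas_path {R : realType} {d : measure_display} {Omega : measurableType d}
    (T : R) (Z : R -> Omega -> R) (w : Omega) : jmeas T Z -> measurable_fun `[0, T] (Z ^~ w).
Proof.
move=> mZ.
have -> : Z ^~ w = (fun p : measurableTypeR R * Omega => Z p.1 p.2) \o (fun t => (t, w)) by [].
apply: (measurable_comp _ _ mZ); first exact: measurableX.
  by move=> _ /= [t tT <-].
by apply/measurable_funTS/measurable_fun_pair => //; exact: measurable_cst.
Qed.

Section ito.
Context {R : realType} {d : measure_display} {Omega : measurableType d}.
Variables (P : probability Omega R) (hP : measure_is_complete P) (T : R).
Variables (W : R -> Omega -> R) (hW : brownian_motion P T W).
Implicit Types (s t : R).
Local Notation mu := (@lebesgue_measure R).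
Local Notation "''E' X" := (\int[P]_w X w) (at level 10, X at level 8).
Local Notation F := (augmented_filtration P T W).
Local Notation D s t := (fun w => W t w - W s w).

Lemma bdm_indic_itvoc t (a b : R) : bdm t (fun s => \1_`]a, b] s : R).
Proof.
split; first by apply: measurable_indic.
by exists 1 => s _; rewrite indicE; case: (_ \in _); rewrite ?normr1 ?normr0.
Qed.

Lemma overlap_int t (a b a' b' : R) : 0 <= a' -> a <= a' -> 0 <= t ->
  \int[mu]_(s in `[0, t]) (\1_`]a, b] s * \1_`]a', b'] s) =
  Num.max 0 (Num.min (Num.min b b') t - a').
Proof.
move=> a'0 aa' t0.
rewrite (@itv_eq_int _ _ _ (\1_`]a', Num.min (Num.min b b') t])); last first.
  move=> s; rewrite in_itv /= => /andP[s0 st].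
  rewrite !indicE !mem_setE /= !in_itv /= !le_min st andbT.
  have [a's|_] := ltP a' s; last by rewrite /= mulr0.
  by rewrite (le_lt_trans aa' a's)/=; case: (s <= b); case: (s <= b'); rewrite /= ?mulr1 ?mulr0.
rewrite /Rintegral integral_indic// (_ : _ `&` _ = `]a', Num.min (Num.min b b') t]%classic); last first.
  apply/setIidl => s /=; rewrite !in_itv /= !le_min => /andP[a's /andP[_ st]].
  by rewrite st andbT ltW// (le_lt_trans a'0).
rewrite [X in fine X](lebesgue_measure_itv `]a', Num.min (Num.min b b') t])/= lte_fin.
case: ifPn => [H|]; first by rewrite /= max_r// subr_ge0 ltW.
by rewrite -leNgt /= => H; rewrite max_l// subr_le0.
Qed.

(** Both increments are split at l' and at the right endpoints. All products over
    disjoint intervals vanish by increment_orth, and increment_quad evaluates the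
    square over the overlap. *)
Lemma ito_pair t (l r l' r' : R) (Y Y' : Omega -> R) : 0 <= t <= T ->
  0 <= l -> l <= r <= T -> l <= l' -> l' <= r' <= T ->
  sub_measurable (F l) Y -> bdd Y -> sub_measurable (F l') Y' -> bdd Y' ->
  'E (fun w => (Y w * (W (Num.min r t) w - W (Num.min l t) w)) *
     (Y' w * (W (Num.min r' t) w - W (Num.min l' t) w))) =
  'E (fun w => Y w * Y' w) *
     \int[mu]_(s in `[0, t]) (\1_`]l, r] s * \1_`]l', r'] s).
Proof.
move=> /andP[t0 tT] l0 /andP[lr rT] ll' /andP[lr' rT'] mY bY mY' bY'.
have l'0 : 0 <= l' by rewrite (le_trans l0).
rewrite overlap_int//.
have [tl'|l't] := leP t l'.
  rewrite (_ : Num.max 0 _ = 0); last first.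
    by rewrite max_l// subr_le0 (le_trans _ tl')// ge_min lexx orbT.
  rewrite mulr0; under eq_Rintegral do rewrite (min_r (le_trans tl' lr')) subrr !mulr0.
  by rewrite exp_cst.
set b := Num.min r t; set b' := Num.min r' t.
have bT : b <= T by rewrite ge_min rT.
have bT' : b' <= T by rewrite ge_min rT'.
rewrite (min_l (le_trans ll' (ltW l't))).
have lb : l <= b by rewrite le_min lr (le_trans ll')// ltW.
have lb' : l' <= b' by rewrite le_min lr' ltW.
have sF := augmented_sigma_algebra P T W.
have -> : Num.min (Num.min r r') t = Num.min b b'.
  by rewrite /b /b' -!minA; congr (Num.min _ _); rewrite minCA minxx.
have mYl' : sub_measurable (F l') Y by exact: (sub_measurableS (augmentedS ll')).
have mU : sub_measurable (F l') (fun w => Y w * Y' w) by exact: sub_measurableM.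
have bU := bddM bY bY'.
have D2 := increment_L2 hW l'0 lb' bT'.
have [bl'|l'b] := leP b l'.
  rewrite (_ : Num.max 0 _ = 0); last first.
    by rewrite max_l// subr_le0 (le_trans _ bl')// ge_min lexx.
  rewrite mulr0.
  have D1 := increment_L2 hW l0 lb bT.
  rewrite -(increment_orth hP hW l'0 lb' bT' (G := fun w => Y w * Y' w * (W b w - W l w))).
  - by apply: eq_Rintegral => w _; rewrite /= ?(min_l (ltW l't)); ring.
  - apply: sub_measurableM => //; apply: (sub_measurableS (augmentedS bl')).
    exact: increment_sub_measurable.
  - exact: L2_bddM.
rewrite ?(min_l (ltW l't)).
pose m := Num.min b b'; pose M := Num.max b b'.
have l'm : l' <= m by rewrite le_min lb' ltW.
have mT : m <= T by rewrite ge_min bT.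
have MT : M <= T by rewrite ge_max bT.
have mM : m <= M by rewrite ge_min le_max lexx.
have m0 := le_trans l'0 l'm.
rewrite -/m max_r ?subr_ge0//.
have L1' : L2 P (D l l') by apply: (increment_L2 hW) => //; rewrite (le_trans (ltW l'b)).
have Lm := increment_L2 hW l'0 l'm mT.
have LM := increment_L2 hW m0 mM MT.
have UL1' := L2_bddM bU L1'; have ULm := L2_bddM bU Lm.
have e1 : 'E (fun w => Y w * Y' w * (W l' w - W l w) * (W b' w - W l' w)) = 0.
  apply: (increment_orth hP hW) => //.
  by apply: sub_measurableM => //; apply: increment_sub_measurable => //; rewrite (le_trans (ltW l'b)).
have e2 : 'E (fun w => Y w * Y' w * (W m w - W l' w) * (W M w - W m w)) = 0.
  apply: (increment_orth hP hW) => //.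
  apply: sub_measurableM => //; first exact: (sub_measurableS (augmentedS l'm)).
  exact: increment_sub_measurable.
rewrite -(increment_quad hP hW l'0 l'm mT mU bU) -[RHS]addr0 -e2 -[RHS]addr0 -e1.
have i1 : L1 P (fun w => Y w * Y' w * (W m w - W l' w) ^+ 2).
  have := L2_M ULm Lm; apply: eq_integrable => // w _ /=; congr EFin; ring.
have i2 := L2_M ULm LM; have i3 := L2_M UL1' D2.
rewrite -expD// -expD//; last exact: L1D.
apply: eq_Rintegral => w _; rewrite /m /M.
by have [bb|bb] := leP b b'; ring.
Qed.

Lemma sqr_sum (n : nat) (x : 'I_n -> R) :
  (\sum_(i < n) x i) ^+ 2 = \sum_(i < n) \sum_(j < n) x i * x j.
Proof. by rewrite expr2 mulr_suml; apply: eq_bigr => i _; rewrite mulr_sumr. Qed.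

(** Both squares are expanded into double sums, whose terms agree by ito_pair once
    each pair is ordered by left endpoints. *)
Lemma ito_isometry (H : simple_process T F) t : 0 <= t <= T ->
  [/\ L2 P (simple_integral W H t),
   L1 P (fun w => \int[mu]_(s in `[0, t]) (simple_fun H s w ^+ 2)) &
   'E (fun w => simple_integral W H t w ^+ 2) =
   'E (fun w => \int[mu]_(s in `[0, t]) (simple_fun H s w ^+ 2))].
Proof.
move=> tT; have /andP[t0 tT'] := tT.
case: H => n l r Y /= Hlr mY bY'; rewrite /simple_integral /simple_fun /=.
have bY k : bdd (Y k).
  split; last exact: bY'.
  by apply: (sub_measurable_measurable (@augmented_measurable _ _ _ P hP T W hW (l k))); exact: mY.
have lr0 k : 0 <= l k by case: (Hlr k).
have lr1 k : l k <= r k <= T by case: (Hlr k).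
have lr2 k : l k <= r k by case/andP: (lr1 k).
have lr3 k : r k <= T by case/andP: (lr1 k).
have D2 k : L2 P (fun w => W (Num.min (r k) t) w - W (Num.min (l k) t) w).
  apply: (increment_L2 hW).
  - by rewrite le_min lr0.
  - by rewrite le_min !ge_min lr2 lexx orbT.
  - by rewrite ge_min lr3.
have YD k := L2_bddM (bY k) (D2 k).
have YY k j : L1 P (fun w => Y k w * Y j w) by apply: L2_M; exact: bdd_L2.
have prod k j := L2_M (YD k) (YD j).
have path w : \int[mu]_(s in `[0, t]) ((\sum_(k < n) Y k w * \1_`]l k, r k] s) ^+ 2) =
  \sum_(k < n) \sum_(j < n) Y k w * Y j w *
     \int[mu]_(s in `[0, t]) (\1_`]l k, r k] s * \1_`]l j, r j] s).
  rewrite (@itv_eq_int _ _ _ (fun s => \sum_(k < n) \sum_(j < n) Y k w * Y j w *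
     (\1_`]l k, r k] s * \1_`]l j, r j] s))); last first.
    move=> s _; rewrite sqr_sum; apply: eq_bigr => k _; apply: eq_bigr => j _; ring.
  have bI k j : bdm t (fun s => \1_`]l k, r k] s * \1_`]l j, r j] s : R).
    by apply: bdmM; exact: bdm_indic_itvoc.
  have bsum (I : Type) (sq : seq I) (f : I -> R -> R) : (forall i, bdm t (f i)) ->
      \int[mu]_(s in `[0, t]) (\sum_(i <- sq) f i s) = \sum_(i <- sq) \int[mu]_(s in `[0, t]) f i s.
    move=> bf; elim: sq => [|i sq ih].
      by rewrite big_nil; under eq_Rintegral do rewrite big_nil; rewrite Rintegral_cst//= mul0r.
    rewrite big_cons -ih -bdm_intD//; last exact: bdm_sum.
    by apply: itv_eq_int => s _; rewrite big_cons.
  rewrite bsum; last first.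
    by move=> k; apply: bdm_sum => j; apply: bdmM => //; exact: bdm_cst.
  apply: eq_bigr => k _; rewrite bsum; last by move=> j; apply: bdmM => //; exact: bdm_cst.
  by apply: eq_bigr => j _; rewrite bdm_intZ.
have L2sum (I : Type) (sq : seq I) (f : I -> Omega -> R) : (forall i, L2 P (f i)) ->
    L2 P (fun w => \sum_(i <- sq) f i w).
  move=> bf; elim: sq => [|i sq ih].
    by under eq_fun do rewrite big_nil; exact: L2_cst.
  by under eq_fun do rewrite big_cons; exact: L2D.
have YYc k j := L1Z (\int[mu]_(s in `[0, t]) (\1_`]l k, r k] s * \1_`]l j, r j] s)) (YY k j).
have YYc' k j : L1 P (fun w => Y k w * Y j w *
     \int[mu]_(s in `[0, t]) (\1_`]l k, r k] s * \1_`]l j, r j] s)).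
  by have := YYc k j; apply: eq_integrable => // w _ /=; rewrite mulrC.
split.
- exact: L2sum.
- by under eq_fun do rewrite path; apply: L1_sum => k; apply: L1_sum => j.
- under [RHS]eq_Rintegral do rewrite path.
  under [LHS]eq_Rintegral do rewrite sqr_sum.
  rewrite !exp_sum; [|by move=> k; exact: L1_sum|by move=> k; exact: L1_sum].
  apply: eq_bigr => k _; rewrite !exp_sum//.
  apply: eq_bigr => j _.
  have -> : 'E (fun w => Y k w * Y j w *
     \int[mu]_(s in `[0, t]) (\1_`]l k, r k] s * \1_`]l j, r j] s)) =
    'E (fun w => Y k w * Y j w) *
     \int[mu]_(s in `[0, t]) (\1_`]l k, r k] s * \1_`]l j, r j] s).
    by rewrite mulrC -expZ//; apply: eq_Rintegral => w _; rewrite mulrC.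
  have [lk|lj] := leP (l k) (l j); first exact: ito_pair.
  transitivity ('E (fun w => (Y j w * (W (Num.min (r j) t) w - W (Num.min (l j) t) w)) *
     (Y k w * (W (Num.min (r k) t) w - W (Num.min (l k) t) w)))).
    by apply: eq_Rintegral => w _; rewrite mulrC.
  rewrite ito_pair//; last exact: ltW.
  congr (_ * _); first by apply: eq_Rintegral => w _; rewrite mulrC.
  by apply: itv_eq_int => s _; rewrite mulrC.
Qed.

Lemma jmeas_simple_fun (H : simple_process T F) t : jmeas t (simple_fun H).
Proof.
apply: jmeas_sum => k; apply: jmeasM.
  have mc : measurable_fun setT (simple_coef k).
    apply: (@sub_measurable_measurable _ _ _ (F (simple_left k))).
      exact: (augmented_measurable hP hW).
    exact: simple_adapted.
  by apply: measurable_funTS; exact: (measurableT_comp mc measurable_snd).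
by apply: (jmeas_fst (f := fun s => \1_`]simple_left k, simple_right k] s)); exact: bdm_indic_itvoc.
Qed.

Lemma bdm_simple_fun (H : simple_process T F) t w : bdm t (simple_fun H ^~ w).
Proof.
by apply: bdm_sum => k; apply: bdmM; [exact: bdm_cst|exact: bdm_indic_itvoc].
Qed.

Lemma cvge0_lt1 (u : nat -> \bar R) : u n @[n --> \oo] --> 0%E ->
  \forall n \near \oo, (u n < 1)%E.
Proof.
move=> /fine_cvgP[uf u0]; have u1 : \forall n \near \oo, fine (u n) < 1.
  by apply: (cvgr_lt _ u0).
near=> n; rewrite -[u n]fineK; last by near: n.
by rewrite lte_fin; near: n.
Unshelve. all: by end_near. Qed.

(** One simple process at distance less than 1 from the integrand and from the
    integral suffices: the isometry bounds its second moment. The bound is uniform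
    in t. *)
Lemma ito_second_moment (H : R -> Omega -> R) (K t : R) (I : Omega -> R) :
  0 <= t <= T -> jmeas T H -> (forall s w, s \in `[0, T] -> `|H s w| <= K) ->
  ito_integral P T F W t H I ->
  (\int[P]_w ((I w) ^+ 2)%:E <= (6 + 4 * (K ^+ 2 * T))%:E)%E.
Proof.
move=> tT jH HK [mI [Hn [cvH cvI]]]; have /andP[t0 tT'] := tT.
have jHt := jmeasW tT' jH.
have HKt s w : s \in `[0, t] -> `|H s w| <= K.
  by move=> st; apply: HK; move: st; rewrite !in_itv /= => /andP[-> /le_trans]; exact.
have [n [Hn1 In1]] : exists n,
  ((\int[P]_w \int[mu]_(s in `[0%R, t]) ((simple_fun (Hn n) s w - H s w) ^+ 2)%:E < 1)%E /\
   (\int[P]_w ((simple_integral W (Hn n) t w - I w) ^+ 2)%:E < 1)%E).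
  have [n H1] := filter_ex (filterI (cvge0_lt1 cvH) (cvge0_lt1 cvI)).
  by exists n; case: H1.
have [I2 iHn iso] := ito_isometry (Hn n) tT.
have mIn : measurable_fun setT (simple_integral W (Hn n) t) by case: I2.
have jn : jmeas t (simple_fun (Hn n)) by exact: jmeas_simple_fun.
pose A w := (\int[mu]_(s in `[0%R, t]) ((simple_fun (Hn n) s w - H s w) ^+ 2)%:E)%E.
have jd : jmeas t (fun s w => (simple_fun (Hn n) s w - H s w) ^+ 2) by apply: jmeasX; exact: jmeasB.
have mA : measurable_fun setT A by apply: jmeas_eint => // s w _; exact: sqr_ge0.
have A0 w : (0 <= A w)%E by apply: integral_ge0 => s _; rewrite lee_fin sqr_ge0.
have KT0 : 0 <= K ^+ 2 * T by rewrite mulr_ge0 ?sqr_ge0// (le_trans t0).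
have bHn : (\int[P]_w ((simple_integral W (Hn n) t w) ^+ 2)%:E <= (2 + 2 * (K ^+ 2 * T))%:E)%E.
  have /= -> := exp_EFin I2.2; rewrite iso -exp_EFin//.
  apply: (@le_trans _ _ (\int[P]_w (2%:E * A w + (2 * (K ^+ 2 * T))%:E))%E).
    apply: ge0_le_integral => //.
    - by move=> w _; rewrite lee_fin; apply: Rintegral_ge0 => s _; exact: sqr_ge0.
    - by case/integrableP : iHn.
    - by apply: emeasurable_funD => //; exact: emeasurable_funM.
    move=> w _; rewrite -bdm_EFin_int; last exact/bdmX/bdm_simple_fun.
    apply: (@le_trans _ _ (\int[mu]_(s in `[0%R, t])
       (2%:E * ((simple_fun (Hn n) s w - H s w) ^+ 2)%:E + (2 * K ^+ 2)%:E))%E).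
      have mw : measurable_fun `[0, t] (fun s => (simple_fun (Hn n) s w - H s w) ^+ 2).
        exact: (@jmeas_path _ _ _ _ _ w jd).
      apply: ge0_le_integral => //.
      - by move=> s _; rewrite lee_fin sqr_ge0.
      - by apply/measurable_EFinP; case: (bdmX 2 (bdm_simple_fun (Hn n) t w)).
      - apply: emeasurable_funD => //; apply: emeasurable_funM => //.
        exact/measurable_EFinP.
      move=> s /= st; rewrite -EFinM -EFinD lee_fin.
      have := HKt s w st; set h := H s w; set x := simple_fun _ _ _ => hK.
      have h2 : h ^+ 2 <= K ^+ 2.
        by rewrite -(real_normK (num_real h)) lerXn2r ?nnegrE// (le_trans (normr_ge0 h)).
      have := sqr_ge0 (x - 2 * h); rewrite !expr2 in h2 *; nra.
    rewrite ge0_integralD//; last 3 first.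
    - by move=> s _; rewrite mule_ge0// lee_fin sqr_ge0.
    - apply: emeasurable_funM => //; apply/measurable_EFinP; exact: (@jmeas_path _ _ _ _ _ w jd).
    - by move=> s _; rewrite lee_fin mulr_ge0// sqr_ge0.
    rewrite ge0_integralZl//; last 2 first.
    - by apply/measurable_EFinP; exact: (@jmeas_path _ _ _ _ _ w jd).
    - by move=> s _; rewrite lee_fin sqr_ge0.
    rewrite leeD2l// integral_cst// [X in (_ * X)%E](lebesgue_measure_itv `[0, t])/= lte_fin.
    case: ifPn => _; last by rewrite mule0 lee_fin mulr_ge0.
    rewrite -EFinM lee_fin subr0 -mulrA ler_pM2l// ler_wpM2l ?sqr_ge0//.
  rewrite ge0_integralD//; last 3 first.
  - by move=> w _; rewrite mule_ge0.
  - exact: emeasurable_funM.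
  - by move=> w _; rewrite lee_fin mulr_ge0.
  rewrite ge0_integralZl// (exp_EFin (L1_cst P _)) exp_cst [leRHS]EFinD leeD2r//.
  by rewrite -[leRHS]mule1 lee_pmul2l// ltW.
apply: (@le_trans _ _ (\int[P]_w (2%:E * ((simple_integral W (Hn n) t w) ^+ 2)%:E +
    2%:E * ((simple_integral W (Hn n) t w - I w) ^+ 2)%:E))%E).
  apply: ge0_le_integral => //.
  - by move=> w _; rewrite lee_fin sqr_ge0.
  - by apply/measurable_EFinP; exact: measurable_funX.
  - apply: emeasurable_funD; apply: emeasurable_funM => //; apply/measurable_EFinP.
      exact: measurable_funX.
    by apply: measurable_funX; exact: measurable_funB.
  move=> w _; rewrite -!EFinM -EFinD lee_fin.
  set x := simple_integral _ _ _ _; set y := I w.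
  by have := sqr_ge0 (2 * x - y); rewrite !expr2; nra.
have mx : measurable_fun setT (fun w => ((simple_integral W (Hn n) t w) ^+ 2)%:E).
  by apply/measurable_EFinP; exact: measurable_funX.
have my : measurable_fun setT (fun w => ((simple_integral W (Hn n) t w - I w) ^+ 2)%:E).
  by apply/measurable_EFinP; apply: measurable_funX; exact: measurable_funB.
rewrite ge0_integralD//; last 4 first.
- by move=> w _; rewrite mule_ge0// lee_fin sqr_ge0.
- exact: emeasurable_funM.
- by move=> w _; rewrite mule_ge0// lee_fin sqr_ge0.
- exact: emeasurable_funM.
rewrite !ge0_integralZl//; last 2 first.
- by move=> w _; rewrite lee_fin sqr_ge0.
- by move=> w _; rewrite lee_fin sqr_ge0.
have -> : (6 + 4 * (K ^+ 2 * T))%:E = (2%:E * (2 + 2 * (K ^+ 2 * T))%:E + 2%:E * 1)%E.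
  by rewrite mule1 -EFinM -EFinD; congr EFin; ring.
by apply: leeD; rewrite lee_pmul2l// ltW.
Qed.

End ito.

(** * Square integrability of the demand process *)

Section path_tools.
Context {R : realType}.
Local Notation mu := (@lebesgue_measure R).

Lemma within_right_continuous (T t : R) (f : R -> R) :
  {within `[0, T], continuous f} -> t \in `[0, T[ -> f s @[s --> t^'+] --> f t.
Proof.
move=> cf; rewrite in_itv /= => /andP[t0 tT].
have sub : `[t, T] `<=` `[0, T].
  by move=> s /=; rewrite !in_itv /= => /andP[/(le_trans t0)-> ->].
by move: cf => /(continuous_subspaceW sub)/(continuous_within_itvP _ tT)[].
Qed.

Lemma lipschitz_pairP (T : R) (h : R -> R -> R) :
  [lipschitz (h p.1 p.2) | p in `[0, T]%classic `*` [set: R]] ->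
  exists L : R, 1 <= L /\ forall s t x y, s \in `[0, T] -> t \in `[0, T] ->
    `|h s x - h t y| <= L * (`|s - t| + `|x - y|).
Proof.
rewrite /lipschitz_on => H.
have H1 : \forall M \near (pinfty_nbhs R), 1 <= M by exact/nbhs_pinfty_ge/num_real.
have [L [HL L1]] := filter_ex (filterI H H1).
exists L; split => // s t x y sT tT.
have := HL ((s, x), (t, y)) ltac:(by []); rewrite /= => /le_trans; apply.
rewrite ler_wpM2l ?(le_trans ler01)// prod_normE /= ge_max.
by rewrite lerDl lerDr !normr_ge0.
Qed.

Lemma lipschitz_right_continuous (T L t : R) (h : R -> R -> R) (f : R -> R) : 1 <= L ->
  (forall s t x y, s \in `[0, T] -> t \in `[0, T] ->
    `|h s x - h t y| <= L * (`|s - t| + `|x - y|)) ->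
  t \in `[0, T[ -> f s @[s --> t^'+] --> f t ->
  h s (f s) @[s --> t^'+] --> h t (f t).
Proof.
move=> L1 HL; rewrite in_itv /= => /andP[t0 tT] /cvgrPdist_le cf.
have L0 : 0 < L by rewrite (lt_le_trans ltr01).
apply/cvgrPdist_le => e e0.
have e2 : 0 < e / (2 * L) by rewrite divr_gt0// mulr_gt0.
have := cf _ e2 => {}cf.
near=> s.
have st : t < s by near: s; exact: nbhs_right_gt.
have sT : s < T by near: s; exact: nbhs_right_lt.
have se : s <= t + e / (2 * L) by near: s; apply: nbhs_right_le; rewrite ltrDl.
have fs : `|f t - f s| <= e / (2 * L) by near: s.
apply: (le_trans (HL _ _ _ _ _ _)).
- by rewrite in_itv /= t0 ltW.
- by rewrite in_itv /= (le_trans t0 (ltW st)) ltW.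
have -> : e = L * (e / (2 * L) + e / (2 * L)) by field; rewrite gt_eqF.
rewrite ler_pM2l// lerD// distrC gtr0_norm ?subr_gt0//.
by rewrite lerBlDl.
Unshelve. all: by end_near. Qed.

Lemma bdm_int_cst (T c : R) : 0 <= T -> \int[mu]_(t in `[0, T]) (cst c t) = c * T.
Proof.
move=> T0; rewrite Rintegral_cst//.
rewrite [X in fine X](lebesgue_measure_itv `[0, T])/= lte_fin.
by move: T0; rewrite le_eqVlt => /predU1P[<-|->]/=; rewrite ?ltxx ?subr0.
Qed.

(** Jensen's inequality: (f - c)^2 has a nonnegative integral, c being the mean. *)
Lemma sqr_int_le (T : R) f : 0 < T -> bdm T f ->
  (\int[mu]_(t in `[0, T]) f t) ^+ 2 <= T * \int[mu]_(t in `[0, T]) (f t ^+ 2).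
Proof.
move=> T0 bf; pose c := (\int[mu]_(t in `[0, T]) f t) / T.
have : 0 <= \int[mu]_(t in `[0, T]) ((f t - c) ^+ 2).
  by apply: Rintegral_ge0 => t _; exact: sqr_ge0.
have -> : \int[mu]_(t in `[0, T]) ((f t - c) ^+ 2) =
    \int[mu]_(t in `[0, T]) (f t ^+ 2 + (c ^+ 2 - 2 * c * f t)).
  by apply: itv_eq_int => t _; ring.
have b2 := bdmX 2 bf.
have bc := bdmM (bdm_cst T (2 * c)) bf.
have bc2 := bdm_cst T (c ^+ 2).
rewrite (bdm_intD b2 (bdmB bc2 bc)) (bdm_intB bc2 bc) (@bdm_intZ _ T (2 * c) f bf) (bdm_int_cst _ (ltW T0)).
have -> : \int[mu]_(t in `[0, T]) f t = c * T by rewrite /c divfK// gt_eqF.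
move=> H; rewrite -subr_ge0.
rewrite (_ : _ - _ = T * (\int[mu]_(t in `[0, T]) (f t ^+ 2) + (c ^+ 2 * T - 2 * c * (c * T)))); last by ring.
by rewrite mulr_ge0// ltW.
Qed.

(** Gronwall's inequality bounds u by m plus a multiple of the integral of m; the
    square of that integral is bounded by Jensen's inequality. *)
Lemma gronwall_sqr (T L : R) (u m : R -> R) : 0 < T -> 0 < L -> bdm T u -> bdm T m ->
    (forall s, s \in `[0, T] -> 0 <= u s) ->
    (forall s, s \in `[0, T] -> 0 <= m s) ->
    (forall s, s \in `[0, T] -> u s <= m s + L * \int[mu]_(r in `[0, s]) u r) ->
  \int[mu]_(s in `[0, T]) (u s ^+ 2) <=
    (2 + 2 * (L * expR (L * T) * T) ^+ 2) * \int[mu]_(s in `[0, T]) (m s ^+ 2).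
Proof.
move=> T0 L0 bu bm u0 m0 um.
pose K := L * expR (L * T) * \int[mu]_(s in `[0, T]) m s.
have LE0 : 0 <= L * expR (L * T) by rewrite mulr_ge0 ?expR_ge0// ltW.
have K0 : 0 <= K by rewrite mulr_ge0//; apply: Rintegral_ge0 => s sT; apply: m0.
have uK s : s \in `[0, T] -> u s <= m s + K.
  move=> sT; apply: (le_trans (um s sT)); rewrite lerD2l /K -mulrA ler_pM2l//.
  move: (sT); rewrite in_itv /= => /andP[s0 sT'].
  apply: (@le_trans _ _ (expR (L * s) * \int[mu]_(r in `[0, s]) m r)).
    by apply: (@gronwall_int _ T L u m s) => //; rewrite s0.
  apply: ler_pM; rewrite ?expR_ge0//.
  - by apply: Rintegral_ge0 => r /= rs; apply: m0; move: rs; rewrite !in_itv /= => /andP[-> /le_trans]; exact.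
  - by rewrite ler_expR ler_pM2l.
  rewrite /Rintegral fine_le//.
  - exact: (integrable_fin_num _ (bdm_integrable (bdmW sT' bm))).
  - exact: (integrable_fin_num _ (bdm_integrable bm)).
  apply: ge0_subset_integral => //.
  - by apply/measurable_EFinP; case: bm.
  - by move=> r /=; rewrite !in_itv /= => /andP[-> /le_trans]; exact.
have b2 := bdmX 2 bm.
apply: (@le_trans _ _ (\int[mu]_(s in `[0, T]) (2 * m s ^+ 2 + 2 * K ^+ 2))).
  apply: bdm_le_int; first exact: bdmX.
    by apply: bdmD; [apply: bdmM => //; exact: bdm_cst|exact: bdm_cst].
  move=> s sT; have h1 := uK s sT; have h2 := u0 s sT; have h3 := m0 s sT.
  apply: (@le_trans _ _ ((m s + K) ^+ 2)); first by rewrite lerXn2r ?nnegrE// addr_ge0.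
  by have := sqr_ge0 (m s - K); rewrite !expr2; nra.
rewrite (bdm_intD (bdmM (bdm_cst T 2) b2) (bdm_cst T (2 * K ^+ 2))).
rewrite (@bdm_intZ _ T 2 _ b2) (bdm_int_cst _ (ltW T0)) [leRHS]mulrDl lerD2l.
have := sqr_int_le T0 bm => H.
have -> : 2 * (L * expR (L * T) * T) ^+ 2 * \int[mu]_(s in `[0, T]) (m s ^+ 2) =
  2 * (L * expR (L * T)) ^+ 2 * (T * \int[mu]_(s in `[0, T]) (m s ^+ 2)) * T by ring.
have -> : 2 * K ^+ 2 * T =
  2 * (L * expR (L * T)) ^+ 2 * (\int[mu]_(s in `[0, T]) m s) ^+ 2 * T by rewrite /K; ring.
by rewrite ler_pM2r// ler_wpM2l// mulr_ge0// sqr_ge0.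
Qed.

End path_tools.

Section sde.
Context {R : realType} {d : measure_display} {Omega : measurableType d}.
Variables (P : probability Omega R) (hP : measure_is_complete P) (T : R) (T0 : 0 < T).
Variables (W : R -> Omega -> R) (hW : brownian_motion P T W).
Local Notation mu := (@lebesgue_measure R).
Local Notation F := (augmented_filtration P T W).

Lemma sde_measurable (b sg : R -> R -> R) (x00 : R) (X : R -> Omega -> R) t :
  sde_solution P T F W b sg x00 X -> t \in `[0, T] -> measurable_fun setT (X t).
Proof.
move=> hX tT; apply: (sub_measurable_measurable (F := F t)).
  exact: (augmented_measurable hP hW).
exact: (sde_adapted hX).
Qed.

Lemma sde_jmeas (b sg : R -> R -> R) (x00 : R) (X : R -> Omega -> R) :
  sde_solution P T F W b sg x00 X -> jmeas T X.
Proof.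
move=> hX; apply: jmeas_right_continuous => [t tT|w t tT].
  exact: sde_measurable hX tT.
by apply: within_right_continuous tT; exact: (sde_continuous hX).
Qed.

(** The stochastic integral has bounded second moments as sigma is bounded, and the
    drift grows at most linearly. Gronwall's inequality is applied path by path,
    where continuity makes everything finite, and expectations are taken only
    afterwards. *)
Lemma sde_square_integrable (b sg : R -> R -> R) (x00 K : R) (X : R -> Omega -> R) :
  [lipschitz (b p.1 p.2) | p in `[0, T]%classic `*` [set: R]] ->
  [lipschitz (sg p.1 p.2) | p in `[0, T]%classic `*` [set: R]] ->
  (forall t x, t \in `[0, T] -> `|sg t x| <= K) ->
  sde_solution P T F W b sg x00 X ->
  (\int[P]_w \int[mu]_(t in `[0%R, T]) ((X t w) ^+ 2)%:E < +oo)%E.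
Proof.
move=> /lipschitz_pairP[L [L1 Lb]] /lipschitz_pairP[L' [L1' Lsg]] sgK hX.
have L0 : 0 < L by rewrite (lt_le_trans ltr01).
have jX := sde_jmeas hX.
have bX w : bdm T (X ^~ w) by apply: bdm_continuous; exact: (sde_continuous hX).
have rX w t : t \in `[0, T[ -> X s w @[s --> t^'+] --> X t w.
  by move=> tT; apply: within_right_continuous tT; exact: (sde_continuous hX).
have lipj (h : R -> R -> R) L2 : 1 <= L2 -> (forall s t x y, s \in `[0, T] -> t \in `[0, T] ->
    `|h s x - h t y| <= L2 * (`|s - t| + `|x - y|)) -> jmeas T (fun s w => h s (X s w)).
  move=> L21 Lh; apply: jmeas_right_continuous => [t tT|w t tT]; last first.
    exact: (lipschitz_right_continuous L21 Lh tT (rX w t tT)).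
  apply: (measurableT_comp (f := h t)); last exact: sde_measurable hX tT.
  have : continuous (h t).
    move=> x; apply/cvgrPdist_le => e e0.
    have L20 : 0 < L2 by rewrite (lt_le_trans ltr01).
    near=> y; apply: (le_trans (Lh _ _ _ _ tT tT)); rewrite subrr normr0 add0r.
    rewrite -ler_pdivlMl// mulrC; near: y.
    by apply: cvgr_dist_le; [exact: cvg_id|rewrite divr_gt0].
  exact: continuous_measurable_fun.
have jb := lipj b L L1 Lb; have jsg := lipj sg L' L1' Lsg.
have T0T : (0 : R) \in `[0, T] by rewrite in_itv /= lexx ltW.
pose c0 := `|b 0 0| + L * T.
have c00 : 0 <= c0 by rewrite addr_ge0// mulr_ge0 ?ltW.
have b_le s x : s \in `[0, T] -> `|b s x| <= c0 + L * `|x|.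
  move=> sT; have := Lb s 0 x 0 sT T0T; rewrite !subr0 => H.
  have /andP[s0 sT'] : 0 <= s <= T by move: sT; rewrite in_itv.
  rewrite -(subrK (b 0 0) (b s x)) (le_trans (ler_normD _ _))// addrC /c0 -addrA lerD2l.
  by rewrite (le_trans H)// mulrDr lerD2r ler_pM2l// ger0_norm.
have bb w : bdm T (fun s => b s (X s w)).
  split; first exact: (@jmeas_path _ _ _ _ _ w jb).
  have [_ [M HM]] := bX w; exists (c0 + L * M) => t tT.
  by rewrite (le_trans (b_le _ _ tT))// lerD2l ler_pM2l// HM.
(* Almost surely the stochastic integral, but jointly measurable by construction. *)
pose Z t w := X t w - x00 - \int[mu]_(s in `[0, t]) b s (X s w).
have mZ t : t \in `[0, T] -> measurable_fun setT (Z t).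
  move=> tT; have tT' : t <= T by move: tT; rewrite in_itv /= => /andP[].
  apply: measurable_funB; last by apply: jmeas_int; exact: jmeasW jb.
  by apply: measurable_funB; [exact: sde_measurable hX tT|exact: measurable_cst].
have jZ : jmeas T Z.
  apply: jmeas_right_continuous => // w t tT.
  apply: cvgB; first by apply: cvgB; [exact: rX|exact: cvg_cst].
  apply: within_right_continuous tT; apply: bdm_int_continuous => //; exact: ltW.
have bZ w : bdm T (Z ^~ w).
  by apply: bdmB; [apply: bdmB => //; exact: bdm_cst|apply: bdm_int => //; exact: ltW].
pose C := 6 + 4 * (K ^+ 2 * T).
have EZ t : t \in `[0, T] -> (\int[P]_w ((Z t w) ^+ 2)%:E <= C%:E)%E.
  move=> tT; have [M [itoM eqM]] := sde_equation hX.
  have tT' : 0 <= t <= T by move: tT; rewrite in_itv.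
  have := @ito_second_moment _ _ _ _ hP _ _ hW (fun s w => sg s (X s w)) K t (M t) tT' jsg.
  move=> /(_ (fun s w sT => sgK s _ sT) (itoM t tT)); apply: le_trans.
  have [mM _] := itoM t tT.
  have mZt := mZ t tT.
  rewrite le_eqVlt; apply/orP; left; apply/eqP.
  apply: ge0_ae_eq_integral => //.
  - by apply/measurable_EFinP; exact: measurable_funX.
  - by apply/measurable_EFinP; exact: measurable_funX.
  - by move=> w _; rewrite lee_fin sqr_ge0.
  - by move=> w _; rewrite lee_fin sqr_ge0.
  move: eqM; apply: filterS => w /(_ t tT) E _; congr (_ ^+ 2)%:E.
  by rewrite /Z E; ring.
pose m t w := `|x00| + c0 * T + `|Z t w|.
have bm w : bdm T (m ^~ w) by apply: bdmD; [exact: bdm_cst|apply: bdm_norm; exact: bZ].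
pose Q := 2 + 2 * (L * expR (L * T) * T) ^+ 2.
have Q0 : 0 <= Q by rewrite addr_ge0// mulr_ge0// sqr_ge0.
have path w : \int[mu]_(s in `[0, T]) (X s w ^+ 2) <=
    Q * \int[mu]_(s in `[0, T]) (m s w ^+ 2).
  have -> : \int[mu]_(s in `[0, T]) (X s w ^+ 2) = \int[mu]_(s in `[0, T]) (`|X s w| ^+ 2).
    by apply: itv_eq_int => s _; rewrite real_normK// num_real.
  apply: (@gronwall_sqr _ T L (fun s => `|X s w|) (m ^~ w)) => //.
  - exact: bdm_norm.
  - by move=> s _; rewrite /m !addr_ge0// mulr_ge0// ltW.
  move=> s sT; have /andP[s0 sT'] : 0 <= s <= T by move: sT; rewrite in_itv.
  have bXs := bdm_norm (bdmW sT' (bX w)).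
  have -> : X s w = x00 + Z s w + \int[mu]_(r in `[0, s]) b r (X r w) by rewrite /Z; ring.
  rewrite (le_trans (ler_normD _ _))//.
  apply: (@le_trans _ _ (`|x00| + `|Z s w| + (c0 * T + L * \int[mu]_(r in `[0, s]) `|X r w|))); last first.
    by rewrite le_eqVlt /m; apply/orP; left; apply/eqP; ring.
  apply: lerD; first exact: ler_normD.
  apply: (le_trans (le_normr_Rintegral _ (bdm_integrable (bdmW sT' (bb w))))) => //.
  apply: (@le_trans _ _ (\int[mu]_(r in `[0, s]) (c0 + L * `|X r w|))).
    apply: bdm_le_int.
    - exact/bdm_norm/(bdmW sT' (bb w)).
    - by apply: bdmD; [exact: bdm_cst|apply: bdmM => //; exact: bdm_cst].
    by move=> r rs; apply: b_le; move: rs; rewrite !in_itv /= => /andP[-> /le_trans]; exact.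
  rewrite (bdm_intD (bdm_cst s c0) (bdmM (bdm_cst s L) bXs)).
  by rewrite (@bdm_intZ _ s L _ bXs) lerD2r bdm_int_cst// ler_wpM2l.
have jm : jmeas T m by apply: jmeasD; [exact: jmeas_cst|exact: jmeas_norm].
have jm2 := jmeasX 2 jm.
pose B := 2 * (`|x00| + c0 * T) ^+ 2.
apply: (@le_lt_trans _ _ (\int[P]_w (Q%:E * \int[mu]_(s in `[0%R, T]) ((m s w) ^+ 2)%:E))%E).
  apply: ge0_le_integral => //.
  - by move=> w _; apply: integral_ge0 => s _; rewrite lee_fin sqr_ge0.
  - by apply: jmeas_eint; [exact: jmeasX|move=> s w _; exact: sqr_ge0].
  - apply: emeasurable_funM => //.
    by apply: jmeas_eint => // s w _; exact: sqr_ge0.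
  move=> w _; rewrite !bdm_EFin_int ?lee_fin//; last exact: bdmX.
  exact: bdmX.
rewrite ge0_integralZl//; last 2 first.
- by apply: jmeas_eint => // s w _; exact: sqr_ge0.
- by move=> w _; apply: integral_ge0 => s _; rewrite lee_fin sqr_ge0.
apply: lte_mul_pinfty => //.
rewrite jmeas_tonelli//; last by move=> s w _; exact: sqr_ge0.
apply: (@le_lt_trans _ _ (\int[mu]_(t in `[0%R, T]) (B + 2 * C)%:E)%E); last first.
  rewrite integral_cst// [X in (_ * X)%E](lebesgue_measure_itv `[0, T])/= lte_fin T0.
  by rewrite -EFinB -EFinM ltry.
apply: ge0_le_integral => //.
- by move=> t _; apply: integral_ge0 => w _; rewrite lee_fin sqr_ge0.
- by apply: jmeas_eexp => // t w _; exact: sqr_ge0.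
move=> t tT; have mZt := mZ t tT.
have mZ2 : measurable_fun setT (fun w => ((Z t w) ^+ 2)%:E).
  by apply/measurable_EFinP; exact: measurable_funX.
have B0 : 0 <= B by rewrite mulr_ge0// sqr_ge0.
apply: (@le_trans _ _ (\int[P]_w (B%:E + 2%:E * ((Z t w) ^+ 2)%:E))%E).
  apply: ge0_le_integral => //.
  - by move=> w _; rewrite lee_fin sqr_ge0.
  - apply/measurable_EFinP/measurable_funX; apply: measurable_funD => //.
    exact: measurableT_comp.
  - by apply: emeasurable_funD => //; exact: emeasurable_funM.
  move=> w _; rewrite -EFinM -EFinD lee_fin /B /m.
  have := sqr_ge0 (`|x00| + c0 * T - `|Z t w|).
  have := real_normK (num_real (Z t w)); rewrite !expr2; nra.
rewrite ge0_integralD//; last 2 first.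
- by move=> w _; rewrite mule_ge0// lee_fin sqr_ge0.
- exact: emeasurable_funM.
rewrite ge0_integralZl//; last by move=> w _; rewrite lee_fin sqr_ge0.
rewrite (exp_EFin (L1_cst P _)) exp_cst [leRHS]EFinD leeD2l// [leRHS]EFinM lee_pmul2l//.
exact: EZ.
Unshelve. all: by end_near. Qed.

End sde.

(** * The potential of the game *)

Section potential_algebra.
Context {R : realType} {N : nat}.
Variables (gamma : R) (g0 : 0 < gamma).
Implicit Types (z : R) (y : 'I_N -> R).

(** At demand z and outputs y, the derivative in y i is minus that of the payoff of
    firm i. The summand z^2 / gamma does not depend on y and makes the potential
    nonnegative. *)
Definition stage z y := z ^+ 2 / gamma - z * (\sum_j y j) +
  gamma / 2 * ((\sum_j y j) ^+ 2 + \sum_j y j ^+ 2).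

Definition payoff i z y := y i * (z - gamma * \sum_j y j).

Definition rivals_part i z y := z ^+ 2 / gamma - z * (\sum_(j < N | j != i) y j) +
  gamma / 2 * ((\sum_(j < N | j != i) y j) ^+ 2 + \sum_(j < N | j != i) y j ^+ 2).

(** The identity behind the exact potential: y i is absent on the right, so firm i
    maximizes its payoff by minimizing the potential. *)
Lemma payoff_add_potential i z y : payoff i z y + stage z y = rivals_part i z y.
Proof.
rewrite /payoff /stage /rivals_part [\sum_j y j](bigD1 i)//= [\sum_j y j ^+ 2](bigD1 i)//=.
set A := \sum_(j < N | j != i) y j; set B := \sum_(j < N | j != i) y j ^+ 2.
by field; rewrite gt_eqF.
Qed.

(** Complete the square in z. *)
Lemma stage_ge z y : gamma / 4 * (\sum_j y j) ^+ 2 + gamma / 2 * \sum_j y j ^+ 2 <= stage z y.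
Proof.
rewrite /stage; set S := \sum_j y j; set B := \sum_j y j ^+ 2.
rewrite -subr_ge0.
rewrite (_ : _ - _ = (z - gamma * S / 2) ^+ 2 / gamma); last by field; rewrite gt_eqF.
by rewrite divr_ge0 ?sqr_ge0// ltW.
Qed.

Lemma stage_ge0 z y : 0 <= stage z y.
Proof.
apply: le_trans (stage_ge z y); apply: addr_ge0; apply: mulr_ge0.
- by rewrite divr_ge0// ltW.
- exact: sqr_ge0.
- by rewrite divr_ge0// ltW.
- by apply: sumr_ge0 => j _; exact: sqr_ge0.
Qed.

Lemma sumsq_le_stage z y : gamma / 2 * \sum_j y j ^+ 2 <= stage z y.
Proof.
apply: le_trans (stage_ge z y); rewrite lerDr mulr_ge0 ?sqr_ge0//.
by rewrite divr_ge0// ltW.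
Qed.

Lemma sum_le_stage z y : gamma / 4 * (\sum_j y j) ^+ 2 <= stage z y.
Proof.
apply: le_trans (stage_ge z y); rewrite lerDl; apply: mulr_ge0; first by rewrite divr_ge0// ltW.
by apply: sumr_ge0 => j _; exact: sqr_ge0.
Qed.

(** Strong convexity as an equality: the defect controls the distance of y and y'. *)
Lemma stage_midpoint z y y' :
  stage z (fun j => (y j + y' j) / 2) = (stage z y + stage z y') / 2 -
    gamma / 8 * ((\sum_j (y j - y' j)) ^+ 2 + \sum_j (y j - y' j) ^+ 2).
Proof.
rewrite /stage -mulr_suml big_split/= sumrB.
have -> : \sum_j ((y j + y' j) / 2) ^+ 2 =
    (\sum_j y j ^+ 2 + \sum_j y' j ^+ 2) / 2 - (\sum_j (y j - y' j) ^+ 2) / 4.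
  rewrite -big_split/= !mulr_suml -sumrB; apply: eq_bigr => j _; by field.
by field; rewrite ?gt_eqF.
Qed.

(** Makes profits integrable whenever the expected potential is finite. *)
Lemma payoff_le i z y : `|payoff i z y| <= (1 / gamma + 4 * gamma) * stage z y + z ^+ 2.
Proof.
have h1 := sumsq_le_stage z y; have h2 := sum_le_stage z y.
rewrite /payoff; move: h1 h2; set S := \sum_j y j; set q := stage z y => h1 h2.
have h3 : y i ^+ 2 <= \sum_j y j ^+ 2.
  by rewrite (bigD1 i)//= lerDl; apply: sumr_ge0 => j _; exact: sqr_ge0.
have h4 : y i ^+ 2 / 2 <= 1 / gamma * q.
  rewrite div1r ler_pdivlMl//; apply: le_trans h1.
  have -> : gamma * (y i ^+ 2 / 2) = gamma / 2 * y i ^+ 2 by ring.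
  by rewrite ler_pM2l// divr_gt0.
have h5 : gamma ^+ 2 * S ^+ 2 <= 4 * gamma * q.
  rewrite (_ : gamma ^+ 2 * S ^+ 2 = 4 * gamma * (gamma / 4 * S ^+ 2)); last by field.
  by rewrite ler_pM2l// mulr_gt0.
rewrite mulrDl.
apply: (@le_trans _ _ (y i ^+ 2 / 2 + (gamma ^+ 2 * S ^+ 2 + z ^+ 2))); last first.
  by rewrite addrA lerD2r lerD.
rewrite -exprMn; set x := gamma * S; rewrite ler_norml; apply/andP; split.
  have := sqr_ge0 (y i + (z - x)); have := sqr_ge0 (z + x); rewrite !expr2; nra.
have := sqr_ge0 (y i - (z - x)); have := sqr_ge0 (z + x); rewrite !expr2; nra.
Qed.

Lemma stage_le z y : stage z y <= (1 / gamma + 1 / 2) * z ^+ 2 +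
  ((1 / 2 + gamma / 2) * (\sum_j y j) ^+ 2 + gamma / 2 * \sum_j y j ^+ 2).
Proof.
rewrite /stage; set S := \sum_j y j; set B := \sum_j _.
rewrite -subr_ge0 (_ : _ - _ = (z + S) ^+ 2 / 2); last by field; rewrite gt_eqF.
by rewrite divr_ge0 ?sqr_ge0.
Qed.

End potential_algebra.

Section path_potential.
Context {R : realType} {N : nat}.
Local Notation mu := (@lebesgue_measure R).
Variables (T : R) (T0 : 0 < T) (alpha c delta x0 : 'I_N -> R) (gamma rho : R).
Hypotheses (hc : forall i, 0 < c i) (g0 : 0 < gamma) (hrho : 0 < rho).
Implicit Types (z : R -> R) (p : 'I_N -> R -> R) (i : 'I_N).

Definition output p i t := alpha i * capital_of (delta i) (x0 i) (p i) t.

(** The discounted investment cost in the form given by stieltjes_exp_parts. *)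
Definition cost (f : R -> R) :=
  expR (- rho * T) * f T + rho * \int[mu]_(t in `[0, T]) (expR (- rho * t) * f t).

Definition potential z p :=
  \int[mu]_(t in `[0, T]) (expR (- rho * t) * stage gamma (z t) (output p ^~ t)) +
  \sum_i c i * cost (p i).

Definition profit i z p :=
  \int[mu]_(t in `[0, T]) (expR (- rho * t) * payoff gamma i (z t) (output p ^~ t)) -
  c i * cost (p i).

Definition bdmp p := forall i, bdm T (p i).

Lemma bdm_output p i : bdmp p -> bdm T (output p i).
Proof.
move=> bp; apply: bdmM; first exact: bdm_cst.
by apply: bdm_capital_of => //; exact: ltW.
Qed.

Lemma bdm_stage z (y : 'I_N -> R -> R) : bdm T z -> (forall i, bdm T (y i)) ->
  bdm T (fun t => expR (- rho * t) * stage gamma (z t) (y ^~ t)).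
Proof.
move=> bz bo.
have bS : bdm T (fun t => \sum_j y j t) by exact: bdm_sum.
have bQ : bdm T (fun t => \sum_j y j t ^+ 2) by apply: bdm_sum => j; exact: bdmX.
apply: bdmM; first exact: bdm_expRM.
apply: bdmD.
  apply: bdmB; last exact: bdmM.
  by apply: (bdmM (bdmX 2 bz)); exact: (bdm_cst T (gamma^-1)).
apply: (bdmM (bdm_cst T (gamma / 2))).
by apply: bdmD => //; exact: bdmX.
Qed.

Lemma bdm_payoff z (y : 'I_N -> R -> R) i : bdm T z -> (forall i, bdm T (y i)) ->
  bdm T (fun t => expR (- rho * t) * payoff gamma i (z t) (y ^~ t)).
Proof.
move=> bz bo.
have bS : bdm T (fun t => \sum_j y j t) by exact: bdm_sum.
apply: bdmM; first exact: bdm_expRM.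
apply: bdmM => //; apply: bdmB => //.
exact: (bdmM (bdm_cst T gamma)).
Qed.

Lemma bdm_ecost f : bdm T f -> bdm T (fun t => expR (- rho * t) * f t).
Proof. by move=> bf; apply: bdmM => //; exact: bdm_expRM. Qed.

Lemma cost_ge f : bdm T f -> (forall t, t \in `[0, T] -> 0 <= f t) ->
  expR (- rho * T) * f T <= cost f.
Proof.
move=> bf f0; rewrite /cost lerDl; apply: mulr_ge0; first exact: ltW.
by apply: Rintegral_ge0 => t tT; rewrite mulr_ge0 ?expR_ge0// f0.
Qed.

Lemma TT : T \in `[0, T]. Proof. by rewrite in_itv /= lexx ltW. Qed.

Lemma cost_ge0 f : bdm T f -> (forall t, t \in `[0, T] -> 0 <= f t) -> 0 <= cost f.
Proof.
by move=> bf f0; apply: le_trans (cost_ge bf f0); rewrite mulr_ge0 ?expR_ge0// f0 ?TT.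
Qed.

Lemma cost_midpoint f f' : bdm T f -> bdm T f' ->
  cost (fun t => (f t + f' t) / 2) = (cost f + cost f') / 2.
Proof.
move=> bf bf'; rewrite /cost.
have -> : \int[mu]_(t in `[0, T]) (expR (- rho * t) * ((f t + f' t) / 2)) =
   \int[mu]_(t in `[0, T]) (2^-1 * (expR (- rho * t) * f t + expR (- rho * t) * f' t)).
  by apply: itv_eq_int => t _; ring.
have be := bdm_ecost bf; have be' := bdm_ecost bf'.
rewrite (bdm_intZ _ (bdmD be be')) (bdm_intD be be').
by field.
Qed.

Lemma capital_of_midpoint de x f f' t : bdm T f -> bdm T f' -> t \in `[0, T] ->
  capital_of de x (fun t => (f t + f' t) / 2) t = (capital_of de x f t + capital_of de x f' t) / 2.
Proof.
move=> bf bf'; rewrite in_itv /= => /andP[t0 tT]; rewrite /capital_of.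
have bh h : bdm T h -> bdm t (fun s => expR (de * s) * (x + h s)).
  move=> bh; apply: bdmM; first exact: bdm_expRM.
  by apply: bdmD; [exact: bdm_cst|exact: bdmW bh].
have -> : \int[mu]_(s in `[0, t]) (expR (de * s) * (x + (f s + f' s) / 2)) =
   \int[mu]_(s in `[0, t]) (2^-1 * (expR (de * s) * (x + f s) + expR (de * s) * (x + f' s))).
  by apply: itv_eq_int => s _; field.
rewrite (bdm_intZ _ (bdmD (bh _ bf) (bh _ bf'))) (bdm_intD (bh _ bf) (bh _ bf')).
by field.
Qed.

(** payoff_add_potential under the integral, while the cost of firm i cancels. *)
Lemma potential_profit i z p p' : bdm T z -> bdmp p -> bdmp p' -> (forall j, j != i -> p' j = p j) ->
  profit i z p' + potential z p' = profit i z p + potential z p.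
Proof.
move=> bz bp bp' pp'.
have main q : bdmp q -> profit i z q + potential z q =
    \int[mu]_(t in `[0, T]) (expR (- rho * t) * rivals_part gamma i (z t) (output q ^~ t)) +
    \sum_(j < N | j != i) c j * cost (q j).
  move=> bq; rewrite /profit /potential (bigD1 i)//=.
  have -> : \int[mu]_(t in `[0, T]) (expR (- rho * t) * rivals_part gamma i (z t) (output q ^~ t)) =
      \int[mu]_(t in `[0, T]) (expR (- rho * t) * payoff gamma i (z t) (output q ^~ t) +
        expR (- rho * t) * stage gamma (z t) (output q ^~ t)).
    by apply: itv_eq_int => t _; rewrite -mulrDr payoff_add_potential.
  have bo j := bdm_output j bq.
  by rewrite (bdm_intD (bdm_payoff i bz bo) (bdm_stage bz bo)); ring.
rewrite (main p' bp').
rewrite (main p bp).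
have -> : \sum_(j < N | j != i) c j * cost (p' j) = \sum_(j < N | j != i) c j * cost (p j).
  by apply: eq_bigr => j ji; rewrite pp'.
suff E t : rivals_part gamma i (z t) (output p' ^~ t) = rivals_part gamma i (z t) (output p ^~ t).
  by under eq_Rintegral do rewrite E.
rewrite /rivals_part.
have E (f : R -> R) : \sum_(j < N | j != i) f (output p' j t) = \sum_(j < N | j != i) f (output p j t).
  by apply: eq_bigr => j ji; rewrite /output pp'.
by rewrite (E id) (E (fun x => x ^+ 2)).
Qed.

(** Outputs and costs are affine in the paths, so stage_midpoint can be integrated. *)
Lemma potential_midpoint z p p' : bdm T z -> bdmp p -> bdmp p' ->
  potential z (fun i t => (p i t + p' i t) / 2) +
  \int[mu]_(t in `[0, T]) (expR (- rho * t) * (gamma / 8 * ((\sum_j (output p j t - output p' j t)) ^+ 2 +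
     \sum_j (output p j t - output p' j t) ^+ 2))) = (potential z p + potential z p') / 2.
Proof.
move=> bz bp bp'; rewrite /potential.
have bo j := bdm_output j bp; have bo' j := bdm_output j bp'.
have bd j := bdmB (bo j) (bo' j).
have bD : bdm T (fun t => expR (- rho * t) * (gamma / 8 * ((\sum_j (output p j t - output p' j t)) ^+ 2 +
     \sum_j (output p j t - output p' j t) ^+ 2))).
  apply: bdmM; first exact: bdm_expRM.
  apply: (bdmM (bdm_cst T (gamma / 8))); apply: bdmD.
    by apply: bdmX; exact: bdm_sum.
  by apply: bdm_sum => j; exact: bdmX.
have -> : \int[mu]_(t in `[0, T]) (expR (- rho * t) *
     stage gamma (z t) (output (fun i t => (p i t + p' i t) / 2) ^~ t)) =
   \int[mu]_(t in `[0, T]) (2^-1 * (expR (- rho * t) * stage gamma (z t) (output p ^~ t) +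
      expR (- rho * t) * stage gamma (z t) (output p' ^~ t)) -
     expR (- rho * t) * (gamma / 8 * ((\sum_j (output p j t - output p' j t)) ^+ 2 +
     \sum_j (output p j t - output p' j t) ^+ 2))).
  apply: itv_eq_int => t tT.
  have -> : (output (fun i t => (p i t + p' i t) / 2))^~ t = (fun j => (output p j t + output p' j t) / 2).
    by apply/funext => j; rewrite /output capital_of_midpoint//; field.
  by rewrite stage_midpoint//; field.
have bq := bdm_stage bz bo; have bq' := bdm_stage bz bo'.
rewrite (bdm_intB (bdmM (bdm_cst T 2^-1) (bdmD bq bq')) bD).
rewrite (bdm_intZ 2^-1 (bdmD bq bq')) (bdm_intD bq bq').
have -> : \sum_i c i * cost (fun t => (p i t + p' i t) / 2) =
    (\sum_i c i * cost (p i) + \sum_i c i * cost (p' i)) / 2.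
  rewrite -big_split/= mulr_suml; apply: eq_bigr => j _.
  by rewrite cost_midpoint// -mulrDr mulrA.
set A := \int[mu]_(t in _) (_ * stage _ _ (output p ^~ t)).
set A' := \int[mu]_(t in _) (_ * stage _ _ (output p' ^~ t)).
set B := \int[mu]_(t in _) _; set S := \sum_i _; set S' := \sum_i _.
by move: A A' B S S' => A A' B S S'; field.
Qed.

Lemma potential_ge0 z p : bdmp p -> (forall i t, t \in `[0, T] -> 0 <= p i t) -> 0 <= potential z p.
Proof.
move=> bp p0; apply: addr_ge0.
  by apply: Rintegral_ge0 => t _; rewrite mulr_ge0 ?expR_ge0// stage_ge0.
by apply: sumr_ge0 => i _; apply: (mulr_ge0 (ltW (hc i))); apply: cost_ge0 => //; exact: p0.
Qed.

(** Bounds on the potential thus control the total investment, in particular of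
    limits of strategies. *)
Lemma potential_terminal z p i : bdm T z -> bdmp p -> (forall i t, t \in `[0, T] -> 0 <= p i t) ->
  c i * (expR (- rho * T) * p i T) <= potential z p.
Proof.
move=> bz bp p0; rewrite /potential (bigD1 i)//= addrCA.
apply: (@le_trans _ _ (c i * cost (p i))).
  by rewrite ler_pM2l// cost_ge//; exact: p0.
rewrite lerDl; apply: addr_ge0.
  by apply: Rintegral_ge0 => t _; rewrite mulr_ge0 ?expR_ge0// stage_ge0.
by apply: sumr_ge0 => j _; apply: (mulr_ge0 (ltW (hc j))); apply: cost_ge0 => //; exact: p0.
Qed.

Lemma profit_le i z p : bdm T z -> bdmp p -> (forall i t, t \in `[0, T] -> 0 <= p i t) ->
  `|profit i z p| <= (1 / gamma + 4 * gamma + 1) * potential z p + \int[mu]_(t in `[0, T]) (z t ^+ 2).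
Proof.
move=> bz bp p0; rewrite /profit.
have bo j := bdm_output j bp.
have bq := bdm_stage bz bo; have bpay := bdm_payoff i bz bo.
have K0 : 0 <= 1 / gamma + 4 * gamma by apply: addr_ge0; [rewrite divr_ge0// ltW|rewrite mulr_ge0// ltW].
set K := 1 / gamma + 4 * gamma in K0 *.
have H : `|\int[mu]_(t in `[0, T]) (expR (- rho * t) * payoff gamma i (z t) (output p ^~ t))| <=
    K * \int[mu]_(t in `[0, T]) (expR (- rho * t) * stage gamma (z t) (output p ^~ t)) +
    \int[mu]_(t in `[0, T]) (z t ^+ 2).
  rewrite -(bdm_intZ K bq) -(bdm_intD (bdmM (bdm_cst T K) bq) (bdmX 2 bz)).
  apply: (le_trans (le_normr_Rintegral _ (bdm_integrable bpay))) => //.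
  apply: bdm_le_int; first exact: bdm_norm.
    by apply: bdmD; [exact: (bdmM (bdm_cst T K) bq)|exact: bdmX].
  move=> t; rewrite in_itv /= => /andP[t0 _]; rewrite normrM gtr0_norm ?expR_gt0//.
  have e1 : expR (- rho * t) <= 1 by rewrite -expR0 ler_expR mulNr oppr_le0 mulr_ge0// ltW.
  apply: (@le_trans _ _ (expR (- rho * t) * (K * stage gamma (z t) (output p ^~ t) + z t ^+ 2))).
    by rewrite ler_pM2l ?expR_gt0// payoff_le.
  rewrite mulrDr mulrCA lerD2l -[leRHS]mul1r ler_wpM2r ?sqr_ge0//.
have Hq : 0 <= \int[mu]_(t in `[0, T]) (expR (- rho * t) * stage gamma (z t) (output p ^~ t)).
  by apply: Rintegral_ge0 => t _; rewrite mulr_ge0 ?expR_ge0// stage_ge0.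
have c0 j : 0 <= c j * cost (p j) by apply: (mulr_ge0 (ltW (hc j))); apply: cost_ge0 => //; exact: p0.
have Hc : c i * cost (p i) <= \sum_j c j * cost (p j).
  by rewrite (bigD1 i)//= lerDl sumr_ge0.
have Hs : 0 <= \sum_j c j * cost (p j) by exact: sumr_ge0.
rewrite (le_trans (ler_normB _ _))// (ger0_norm (c0 i)).
rewrite /potential; set A := \int[mu]_(t in _) (_ * stage _ _ _) in H Hq *; set B := \sum_j _ in Hc Hs *.
set Zi := \int[mu]_(t in _) (z t ^+ 2) in H *.
apply: (le_trans (lerD H Hc)); rewrite -subr_ge0.
rewrite (_ : _ - _ = K * B + A); last by move: A B Zi {H Hq Hc Hs} => A B Zi; ring.
by rewrite addr_ge0// mulr_ge0.
Qed.

End path_potential.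

(** * Lower limits and right regularization *)

Section liminf.
Context {R : realType}.
Local Open Scope ereal_scope.
Implicit Types (u v : nat -> \bar R).

Lemma le_limn_einf u v : (forall n, u n <= v n) -> limn_einf u <= limn_einf v.
Proof.
move=> uv; rewrite !limn_einf_lim; apply: lee_lim; [exact: is_cvg_einfs|exact: is_cvg_einfs|].
apply: nearW => n; apply: le_ereal_inf_tmp => _ [k nk <-].
by apply: ge_ereal_inf; exists (u k) => //; exists k.
Qed.

Lemma limn_einf_ge0 u : (forall n, 0 <= u n) -> 0 <= limn_einf u.
Proof.
move=> u0; have <- : limn_einf (cst 0 : nat -> \bar R) = 0.
  by have [] := @cvg_limn_einf_sup R (cst 0) 0 (cvg_cst _).
exact: le_limn_einf.
Qed.

Lemma limn_einf_superadd u v : (forall n, 0 <= u n) -> (forall n, 0 <= v n) ->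
  limn_einf u + limn_einf v <= limn_einf (fun n => u n + v n).
Proof.
move=> u0 v0.
have e0 w n : (forall n, 0 <= w n) -> 0 <= einfs w n.
  by move=> w0; apply: le_ereal_inf_tmp => _ [k _ <-].
have l0 w : (forall n, 0 <= w n) -> 0 <= limn (einfs w).
  by move=> w0; apply: lime_ge; [exact: is_cvg_einfs|apply: nearW => n; exact: e0].
have d : limn (einfs u) +? limn (einfs v).
  by apply: ge0_adde_def; rewrite inE; exact: l0.
rewrite !limn_einf_lim -limeD//; try exact: is_cvg_einfs.
apply: lee_lim; [|exact: is_cvg_einfs|].
  apply: is_cvgeD => //; exact: is_cvg_einfs.
apply: nearW => n; apply: le_ereal_inf_tmp => _ [k nk <-].
by apply: leeD; apply: ge_ereal_inf; [exists (u k)|exists (v k)] => //; exists k.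
Qed.

Lemma limn_einf_sum (I : Type) (s : seq I) (u : I -> nat -> \bar R) :
  (forall i n, 0 <= u i n) ->
  \sum_(i <- s) limn_einf (u i) <= limn_einf (fun n => \sum_(i <- s) u i n).
Proof.
move=> u0; elim: s => [|i s ih].
  by rewrite big_nil; apply: limn_einf_ge0 => n; rewrite big_nil.
rewrite big_cons; under [X in _ <= limn_einf X]eq_fun do rewrite big_cons.
apply: le_trans (limn_einf_superadd (u0 i) _); first exact: leeD2l.
by move=> n; exact: sume_ge0.
Qed.

End liminf.

Section right_regularization.
Context {R : realType}.
Local Notation mu := (@lebesgue_measure R).
Variables (T : R) (T0 : 0 < T).

Definition node (t : R) (k : nat) : R := Num.min (t + k.+1%:R^-1) T.

Lemma node_itv t k : 0 <= t <= T -> 0 <= node t k <= T.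
Proof. by move=> /andP[t0 tT]; rewrite le_min (ltW T0) addr_ge0//= ge_min lexx orbT. Qed.

Lemma node_ge t k : t <= T -> t <= node t k.
Proof. by move=> tT; rewrite le_min tT lerDl invr_ge0 ler0n. Qed.

Lemma node_gt t k : t < T -> t < node t k.
Proof. by move=> tT; rewrite lt_min tT ltrDl invr_gt0 ltr0n. Qed.

Lemma nodeT k : node T k = T.
Proof. by rewrite /node min_r// lerDl. Qed.

Lemma node_ni t m n : (m <= n)%N -> node t n <= node t m.
Proof.
move=> mn; rewrite le_min !ge_min lexx orbT andbT lerD2l lef_pV2 ?posrE ?ltr0n//.
by rewrite ler_nat ltnS mn.
Qed.

Lemma node_lt t s : t < s -> exists k0, forall k, (k0 <= k)%N -> node t k < s.
Proof.
move=> ts; exists (Num.truncn (s - t)^-1) => k k0.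
rewrite gt_min; apply/orP; left; rewrite -ltrBrDl.
have st : 0 < s - t by rewrite subr_gt0.
rewrite invf_plt ?posrE// (lt_le_trans (truncnS_gt _))//.
by rewrite ler_nat ltnS.
Qed.

Variable l : R -> R.
Hypothesis nd : forall s t, 0 <= s -> s <= t -> t <= T -> l s <= l t.

(** A lower limit of nondecreasing paths is nondecreasing but in general not right
    continuous, so it is replaced by its right limits, taken along the times
    node t k. These stop at T, where the value is kept. Extended real values are
    admitted because a lower limit may be infinite in some states. *)
Definition right_reg (L : R -> \bar R) t := fine (limn (fun k => L (node t k))).
Local Notation g := (right_reg (EFin \o l)).

Lemma right_regE t : 0 <= t <= T ->
  (g t)%:E = ereal_inf (range (fun k => (l (node t k))%:E)).
Proof.
move=> tT; have /andP[t0 tT'] := tT.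
have cv : (l (node t k))%:E @[k --> \oo] --> ereal_inf (range (fun k => (l (node t k))%:E)).
  apply: ereal_nonincreasing_cvgn => m n mn; rewrite lee_fin nd ?node_ni//.
    by case/andP: (node_itv n tT).
  by case/andP: (node_itv m tT).
rewrite /right_reg /comp (cvg_lim _ cv)// fineK// fin_numElt; apply/andP; split.
  apply: (@lt_le_trans _ _ (l t)%:E); first exact: ltNyr.
  apply: le_ereal_inf_tmp => _ [k _ <-]; rewrite lee_fin nd ?node_ge//.
  by case/andP: (node_itv k tT).
apply: (@le_lt_trans _ _ (l (node t 0))%:E); last exact: ltry.
by apply: ge_ereal_inf; exists (l (node t 0))%:E => //; exists 0%N.
Qed.

Lemma right_reg_glb t x : 0 <= t <= T -> (forall k, x <= l (node t k)) -> x <= g t.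
Proof.
move=> tT xl; rewrite -lee_fin right_regE//.
by apply: le_ereal_inf_tmp => _ [k _ <-]; rewrite lee_fin.
Qed.

Lemma right_reg_lb t k : 0 <= t <= T -> g t <= l (node t k).
Proof.
move=> tT; rewrite -lee_fin right_regE//.
by apply: ge_ereal_inf; exists (l (node t k))%:E => //; exists k.
Qed.

Lemma right_reg_ge t : 0 <= t <= T -> l t <= g t.
Proof.
move=> tT; apply: right_reg_glb => // k; have /andP[t0 tT'] := tT.
by apply: nd => //; [exact: node_ge|case/andP: (node_itv k tT)].
Qed.

Lemma right_reg_le t s : 0 <= t -> t < s -> s <= T -> g t <= l s.
Proof.
move=> t0 ts sT; have tT : 0 <= t <= T by rewrite t0 (le_trans (ltW ts)).
have [k /(_ k (leqnn _)) ks] := node_lt ts.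
apply: (le_trans (right_reg_lb k tT)); apply: nd => //; last exact: ltW.
by case/andP: (node_itv k tT).
Qed.

Lemma right_regT : g T = l T.
Proof.
have TT : 0 <= T <= T by rewrite lexx ltW.
apply/eqP; rewrite eq_le right_reg_ge// andbT.
by have := right_reg_lb 0 TT; rewrite nodeT.
Qed.

Lemma right_reg_nd s t : 0 <= s -> s <= t -> t <= T -> g s <= g t.
Proof.
move=> s0; rewrite le_eqVlt => /predU1P[->//|st tT].
by apply: (le_trans (right_reg_le s0 st tT)); apply: right_reg_ge; rewrite tT (le_trans s0)// ltW.
Qed.

Lemma nd_left_cvg (h : R -> R) t : (forall s t, 0 <= s -> s <= t -> t <= T -> h s <= h t) ->
  t \in `]0, T] -> cvg (h s @[s --> t^'-]).
Proof.
move=> hnd; rewrite in_itv /= => /andP[t0 tT].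
apply: nondecreasing_at_left_is_cvgr.
  near=> x; have x0 : 0 <= x by near: x; exact: nbhs_left_ge.
  move=> a b; rewrite !in_itv /= => /andP[xa _] /andP[_ bt] ab.
  by apply: hnd => //; [rewrite (le_trans x0)// ltW|rewrite (le_trans (ltW bt))].
near=> x; have x0 : 0 <= x by near: x; exact: nbhs_left_ge.
exists (h T) => z [y]; rewrite /= in_itv /= => /andP[xy yt] <-.
by apply: hnd => //; [rewrite (le_trans x0)// ltW|rewrite (le_trans (ltW yt))].
Unshelve. all: by end_near. Qed.

Lemma nd_right_cvg (h : R -> R) t : (forall s t, 0 <= s -> s <= t -> t <= T -> h s <= h t) ->
  t \in `[0, T[ -> cvg (h s @[s --> t^'+]).
Proof.
move=> hnd; rewrite in_itv /= => /andP[t0 tT].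
apply: nondecreasing_at_right_is_cvgr.
  near=> x; have xT : x <= T by near: x; exact: nbhs_right_le.
  move=> a b; rewrite !in_itv /= => /andP[ta _] /andP[_ bx] ab.
  by apply: hnd => //; [rewrite (le_trans t0)// ltW|rewrite (le_trans (ltW bx))].
near=> x; have xT : x <= T by near: x; exact: nbhs_right_le.
exists (h t) => z [y]; rewrite /= in_itv /= => /andP[ty yx] <-.
by apply: hnd => //; [exact: ltW|rewrite (le_trans (ltW yx))].
Unshelve. all: by end_near. Qed.

Lemma right_reg_cadlag : cadlag T g.
Proof.
split=> t tT; last exact: nd_left_cvg right_reg_nd tT.
move: tT; rewrite in_itv /= => /andP[t0 tT].
have tT' : 0 <= t <= T by rewrite t0 ltW.
apply/cvgrPdist_le => e e0.
have [k kl] : exists k, l (node t k) <= g t + e.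
  apply/not_existsP => H; have : g t + e <= g t.
    by apply: right_reg_glb => // k; apply/ltW; rewrite ltNge; apply/negP; exact: H.
  by rewrite gerDl leNgt e0.
near=> s.
have ts : t < s by near: s; exact: nbhs_right_gt.
have sk : s < node t k by near: s; apply: nbhs_right_lt; exact: node_gt.
have /andP[_ kT] := node_itv k tT'.
have g1 : g t <= g s by apply: right_reg_nd => //; rewrite ltW// (lt_le_trans sk).
have g2 : g s <= l (node t k) by apply: right_reg_le => //; rewrite (le_trans t0)// ltW.
rewrite distrC ger0_norm ?subr_ge0// lerBlDl; exact: le_trans kl.
Unshelve. all: by end_near. Qed.

(** A monotone function has countably many discontinuities. *)
Lemma right_reg_ae : {ae mu, forall t, t \in `[0, T] -> g t = l t}.
Proof.
have ndl : {in `[0, T] &, {homo l : n m / n <= m}}.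
  by move=> a b; rewrite !in_itv /= => /andP[a0 _] /andP[_ bT] ab; exact: nd.
have cD := discontinuity_countable ndl.
set Dd := [set x | _] in cD.
have cnull (A : set R) : countable A -> mu.-negligible A.
  move=> cA; exists A; split => //; last exact: countable_lebesgue_measure0.
  exact: (@countable_measurable _ (measurableTypeR R) A (@measurable_set1 R)).
have : mu.-negligible ([set 0] `|` Dd).
  by apply: negligibleU; apply: cnull => //; exact: countable1.
apply: negligibleS => t /= /not_implyP[tT gl]; move: (tT); rewrite in_itv /= => /andP[t0 tT'].
move: t0; rewrite le_eqVlt => /predU1P[<-|t0]; [by left|right].
move: tT'; rewrite le_eqVlt => /predU1P[tE|tT']; first by exfalso; apply: gl; rewrite tE right_regT.
split; first by rewrite in_itv /= t0.
have cl : cvg (l s @[s --> t^'-]) by apply: nd_left_cvg nd _; rewrite in_itv /= t0 ltW.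
have cr : cvg (l s @[s --> t^'+]) by apply: nd_right_cvg nd _; rewrite in_itv /= tT' ltW.
split => //; apply/eqP => E; apply: gl; apply/eqP.
rewrite eq_le right_reg_ge ?andbT ?(ltW t0) ?(ltW tT')//.
apply: (@le_trans _ _ (lim (l s @[s --> t^'+]))).
  apply: limr_ge => //; near=> s; apply: right_reg_le => //; first exact: ltW.
  by near: s; exact: nbhs_right_le.
rewrite -E; apply: limr_le => //; near=> s; apply: nd => //; last exact: ltW.
by near: s; exact: nbhs_left_ge.
Unshelve. all: by end_near. Qed.

End right_regularization.

(** * Limits of nondecreasing paths *)

Section liminf_more.
Context {R : realType}.
Local Open Scope ereal_scope.

Lemma measurable_limn_einf d (X : measurableType d) (D : set X) (f : nat -> X -> \bar R) :
  measurable D ->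
  (forall n, measurable_fun D (f n)) -> measurable_fun D (fun x => limn_einf (f ^~ x)).
Proof.
move=> mD mf; apply: (emeasurable_fun_cvg (fun n x => einfs (f ^~ x) n)).
  by move=> n; exact: measurable_fun_einfs.
by move=> x _; rewrite limn_einf_lim; exact: is_cvg_einfs.
Qed.

Lemma limn_einf_scale (k : R) (u : nat -> \bar R) : (0 <= k)%R -> (forall n, 0 <= u n) ->
  k%:E * limn_einf u <= limn_einf (fun n => k%:E * u n).
Proof.
move=> k0 u0; rewrite !limn_einf_lim -limeMl//; last exact: is_cvg_einfs.
apply: lee_lim; [|exact: is_cvg_einfs|].
  by apply: is_cvgeMl => //; exact: is_cvg_einfs.
apply: nearW => n; apply: le_ereal_inf_tmp => _ [m nm <-].
apply: lee_wpmul2l; first by rewrite lee_fin.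
by apply: ge_ereal_inf; exists (u m) => //; exists m.
Qed.

End liminf_more.

Section path_limit.
Context {R : realType}.
Local Notation mu := (@lebesgue_measure R).
Variables (T : R) (T0 : 0 < T) (f : nat -> R -> R).
Hypothesis f0 : forall n t, t \in `[0, T] -> 0 <= f n t.
Hypothesis fnd : forall n s t, 0 <= s -> s <= t -> t <= T -> f n s <= f n t.

Definition liminf_path t : \bar R := limn_einf (fun n => (f n t)%:E).
Hypothesis fin : (liminf_path T < +oo)%E.
Hypothesis summ : (\sum_(n <oo) \int[mu]_(t in `[0%R, T]) (`|f n.+1 t - f n t|)%:E < +oo)%E.

Let l t := fine (liminf_path t).
Let g := right_reg T liminf_path.

Let bf n : bdm T (f n).
Proof. by apply: bdm_nd => s t; exact: fnd. Qed.

Let TT : T \in `[0, T]. Proof. by rewrite in_itv /= lexx ltW. Qed.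

(** Monotonicity in time makes finiteness at T enough. *)
Lemma liminf_pathE t : t \in `[0, T] -> liminf_path t = (l t)%:E.
Proof.
rewrite in_itv /= => /andP[t0 tT]; rewrite fineK// ge0_fin_numE.
  apply: le_lt_trans fin; apply: le_limn_einf => n; rewrite lee_fin.
  exact: fnd.
by apply: limn_einf_ge0 => n; rewrite lee_fin f0// in_itv /= t0.
Qed.

Lemma l_nd s t : 0 <= s -> s <= t -> t <= T -> l s <= l t.
Proof.
move=> s0 st tT; rewrite -lee_fin -!liminf_pathE; last 2 first.
- by rewrite in_itv /= (le_trans s0).
- by rewrite in_itv /= s0 (le_trans st).
by apply: le_limn_einf => n; rewrite lee_fin; exact: fnd.
Qed.

Lemma l_ge0 t : t \in `[0, T] -> 0 <= l t.
Proof.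
move=> tT; rewrite -lee_fin -liminf_pathE//.
by apply: limn_einf_ge0 => n; rewrite lee_fin f0.
Qed.

Lemma gE t : t \in `[0, T] -> g t = right_reg T (EFin \o l) t.
Proof.
rewrite in_itv /= => tT; rewrite /g /right_reg.
suff -> : (fun k => liminf_path (node T t k)) = (fun k => (EFin \o l) (node T t k)) by [].
by apply/funext => k /=; rewrite liminf_pathE// in_itv /=; exact: node_itv.
Qed.

Lemma glim_nd s t : 0 <= s -> s <= t -> t <= T -> g s <= g t.
Proof.
move=> s0 st tT; rewrite !gE ?in_itv /= ?s0 ?tT ?(le_trans s0)// ?(le_trans st)//.
by exact: (right_reg_nd T0 l_nd s0 st tT).
Qed.

Lemma glim_ge0 t : t \in `[0, T] -> 0 <= g t.
Proof.
move=> tT; rewrite gE//; apply: (le_trans (l_ge0 tT)); apply: right_reg_ge => //.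
exact: l_nd.
Qed.

Lemma glimT : g T = l T.
Proof. by rewrite gE//; apply: right_regT => //; exact: l_nd. Qed.

Lemma glim_cadlag : cadlag T g.
Proof.
have [rc lc] := right_reg_cadlag T0 l_nd; split => t tT.
  have tT' : t \in `[0, T] by move: tT; rewrite !in_itv /= => /andP[-> /ltW].
  rewrite gE//; apply: cvg_trans (rc t tT); apply: near_eq_cvg.
  move: tT; rewrite in_itv /= => /andP[t0 tT].
  near=> s; rewrite gE// in_itv /=; apply/andP; split.
    by rewrite (le_trans t0)//; near: s; exact: nbhs_right_ge.
  by near: s; exact: nbhs_right_le.
exact: (nd_left_cvg glim_nd tT).
Unshelve. all: by end_near. Qed.

Let bg : bdm T g.
Proof. by apply: bdm_nd; exact: glim_nd. Qed.

(** Summable L1 distances force convergence at almost every time, necessarily to the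
    lower limit, and the regularization alters it at countably many times only. *)
Lemma path_ae_cvg : {ae mu, forall t, t \in `[0, T] -> f n t @[n --> \oo] --> g t}.
Proof.
have mS n : measurable_fun (`[0, T]%classic : set (measurableTypeR R))
    (fun t => (`|f n.+1 t - f n t|)%:E).
  by apply/measurable_EFinP; case: (bdm_norm (bdmB (bf n.+1) (bf n))).
have S0 n t : `[0, T]%classic t -> (0 <= (`|f n.+1 t - f n t|)%:E)%E by rewrite lee_fin.
have iS : mu.-integrable `[0, T] (fun t => \sum_(n <oo) (`|f n.+1 t - f n t|)%:E)%E.
  apply/integrableP; split.
    by apply: ge0_emeasurable_sum => // n t tT _; exact: S0.
  under eq_integral => t tT.
    rewrite gee0_abs; last by apply: nneseries_ge0 => n _ _; rewrite lee_fin.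
    over.
  by rewrite integral_nneseries.
have := integrable_ae _ iS => /(_ ltac:(exact: measurable_itv)) fin_ae.
have gl := right_reg_ae T0 l_nd.
apply: filterS2 fin_ae gl => t Sfin gl tT.
have {}Sfin := Sfin tT.
have cs : cvgn (series (fun n => `|f n.+1 t - f n t|)).
  by apply: nnseries_is_cvg => //; move: Sfin; rewrite ge0_fin_numE// nneseries_ge0.
have ct : cvgn (series (telescope (f ^~ t))) by apply: normed_cvg; exact: cs.
have cf : cvgn (f ^~ t).
  rewrite (_ : f ^~ t = (fun n => f 0 t + series (telescope (f ^~ t)) n)).
    by apply: is_cvgD => //; exact: is_cvg_cst.
  by apply/funext => n; rewrite -eq_sum_telescope.
have /cvg_ex[a fa] := cf.
have la : liminf_path t = a%:E.
  have [-> //] : (liminf_path t = a%:E) * (limn_esup (fun n => (f n t)%:E) = a%:E).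
  by apply: cvg_limn_einf_sup; apply: cvg_EFin => //; exact: nearW.
by rewrite gE// gl// /l la.
Qed.

(** Dominated convergence: the paths converge at some time t' > t, where they are
    therefore bounded, and they are nondecreasing. At t = T there is no such t'. *)
Lemma path_int_cvg (a : R -> R) t : bdm T a -> 0 <= t < T ->
  \int[mu]_(s in `[0, t]) (a s * f n s) @[n --> \oo] --> \int[mu]_(s in `[0, t]) (a s * g s).
Proof.
move=> ba /andP[t0 tT].
have [t' [tt' t'T cv]] : exists t', [/\ t < t', t' < T & f n t' @[n --> \oo] --> g t'].
  have [A [mA A0 sA]] := path_ae_cvg.
  apply/not_existsP => H.
  have : `]t, T[%classic `<=` A.
    move=> s /=; rewrite in_itv /= => /andP[ts sT]; apply: sA => /= Hs.
    apply: (H s); split => //; apply: Hs.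
    by rewrite in_itv /= (le_trans t0 (ltW ts)) ltW.
  move=> /(le_measure mu); rewrite !inE => /(_ (measurable_itv _) mA).
  rewrite [X in (_ <= X)%E]A0 [X in (X <= _)%E](lebesgue_measure_itv `]t, T[)/= lte_fin tT.
  by rewrite -EFinB lee_fin leNgt subr_gt0 tT.
have [C HC] : exists C, forall n, f n t' <= C.
  have [C [_ HC]] := cvg_seq_bounded (cvgP _ cv).
  exists (`|C| + 1) => n; rewrite (le_trans (ler_norm _))//.
  by apply: HC => //; rewrite (le_lt_trans (ler_norm _))// ltrDl.
have [ma [M HM]] := ba.
have sub s : s \in `[0, t] -> s \in `[0, T].
  by rewrite !in_itv /= => /andP[-> /le_trans]; apply; exact: ltW.
have tT' := ltW tT.
have cae : {ae mu, forall s, s \in `[0, t] ->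
    (a s * f n s)%:E @[n --> \oo] --> (a s * g s)%:E}.
  apply: (@filterS _ _ (ae_filter_ringOfSetsType mu)) path_ae_cvg => s H st; apply: cvg_EFin; first exact: nearW.
  by apply: cvgM; [exact: cvg_cst|apply: H; exact: sub].
have [|||||_ _ H] := @dominated_convergence _ (measurableTypeR R) R mu `[0, t]%classic (measurable_itv _)
  (fun n s => (a s * f n s)%:E) (fun s => (a s * g s)%:E) (fun s => (`|M| * C)%:E).
- move=> n; apply/measurable_EFinP.
  by case: (bdmW tT' (bdmM ba (bf n))).
- by apply/measurable_EFinP; case: (bdmW tT' (bdmM ba bg)).
- exact: cae.
- exact: (bdm_integrable (bdm_cst t (`|M| * C))).
- apply: aeW => s n st; rewrite lee_fin normrM ler_pM//.
    by rewrite (le_trans (HM _ (sub _ st)))// ler_norm.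
  rewrite ger0_norm; last by apply: f0; exact: sub.
  rewrite (le_trans _ (HC n))//; move: st; rewrite /= in_itv /= => /andP[s0 st].
  by apply: fnd => //; [exact: le_trans (ltW tt')|exact: ltW].
apply: fine_cvg.
by rewrite -bdm_EFin_int; last exact: (bdmW tT' (bdmM ba bg)).
Qed.

Lemma capital_of_cvg (de x : R) :
  {ae mu, forall t, t \in `[0, T] -> capital_of de x (f n) t @[n --> \oo] --> capital_of de x g t}.
Proof.
have nT : {ae mu, forall t, t != T}.
  exists [set T]; split; [exact: measurable_set1|exact: lebesgue_measure_set1|].
  by move=> t /= /negP; rewrite negbK => /eqP.
apply: (@filterS2 _ _ (ae_filter_ringOfSetsType mu)) path_ae_cvg nT => t ft tnT tT.
move: (tT); rewrite in_itv /= => /andP[t0]; rewrite le_eqVlt (negbTE tnT) /= => tT'.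
apply: cvgB; first by apply: cvgD; [exact: cvg_cst|exact: ft].
apply: cvgM; first exact: cvg_cst.
have E h : bdm T h -> \int[mu]_(s in `[0, t]) (expR (de * s) * (x + h s)) =
    \int[mu]_(s in `[0, t]) (expR (de * s) * x) + \int[mu]_(s in `[0, t]) (expR (de * s) * h s).
  move=> bh; rewrite -bdm_intD.
  - by apply: itv_eq_int => s _; rewrite mulrDr.
  - by apply: bdmM; [exact: bdm_expRM|exact: bdm_cst].
  - by apply: bdmM; [exact: bdm_expRM|exact: (bdmW (ltW tT') bh)].
under eq_fun do rewrite E//.
rewrite E//; apply: cvgD; first exact: cvg_cst.
apply: path_int_cvg; last by rewrite t0.
exact: bdm_expRM.
Qed.

End path_limit.

(** * Lower semicontinuity of the potential *)

Section potential_fatou.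
Context {R : realType} {N : nat}.
Local Notation mu := (@lebesgue_measure R).
Variables (T : R) (T0 : 0 < T) (alpha c delta x0 : 'I_N -> R) (gamma rho : R).
Hypotheses (hc : forall i, 0 < c i) (g0 : 0 < gamma) (hrho : 0 < rho).
Local Notation output := (output alpha delta x0).
Local Notation potential := (potential T alpha c delta x0 gamma rho).

(** The terminal part of the costs is kept outside of the integral: terminal values
    need not converge, and only their lower limits are known. *)
Definition pot_integrand (z : R -> R) (p : 'I_N -> R -> R) t :=
  expR (- rho * t) * stage gamma (z t) (output p ^~ t) +
  \sum_i c i * (rho * (expR (- rho * t) * p i t)).

Lemma bdm_pot_integrand z p : bdm T z -> bdmp T p -> bdm T (pot_integrand z p).
Proof.
move=> bz bp; apply: bdmD.
  by apply: bdm_stage => // i; exact: bdm_output.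
apply: bdm_sum => i; apply: (bdmM (bdm_cst T (c i))); apply: (bdmM (bdm_cst T rho)).
exact: bdm_ecost.
Qed.

Lemma pot_integrand_ge0 z p t : (forall i, 0 <= p i t) -> 0 <= pot_integrand z p t.
Proof.
move=> p0; apply: addr_ge0; first by rewrite mulr_ge0 ?expR_ge0// stage_ge0.
apply: sumr_ge0 => i _; apply: (mulr_ge0 (ltW (hc i))).
by apply: (mulr_ge0 (ltW hrho)); rewrite mulr_ge0 ?expR_ge0.
Qed.

Lemma potential_split z p : bdm T z -> bdmp T p ->
  potential z p = \int[mu]_(t in `[0, T]) pot_integrand z p t + \sum_i c i * expR (- rho * T) * p i T.
Proof.
move=> bz bp; rewrite /pot_integrand.
have bo i : bdm T (output p i) by exact: bdm_output.
have bc i : bdm T (fun t => c i * (rho * (expR (- rho * t) * p i t))).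
  apply: (bdmM (bdm_cst T (c i))); apply: (bdmM (bdm_cst T rho)).
  exact: bdm_ecost.
rewrite (bdm_intD (bdm_stage gamma rho bz bo) (bdm_sum _ bc)) -addrA; congr (_ + _).
have -> : \int[mu]_(t in `[0, T]) (\sum_i c i * (rho * (expR (- rho * t) * p i t))) =
    \sum_i \int[mu]_(t in `[0, T]) (c i * (rho * (expR (- rho * t) * p i t))).
  elim: (index_enum _) => [|i s ih].
    under eq_Rintegral do rewrite big_nil.
    by rewrite big_nil Rintegral_cst//= mul0r.
  under eq_Rintegral do rewrite big_cons.
  by rewrite big_cons (bdm_intD (bc i) (bdm_sum _ bc)) ih.
rewrite -big_split/=; apply: eq_bigr => i _.
have be := bdm_ecost rho (bp i).
rewrite (bdm_intZ (c i) (bdmM (bdm_cst T rho) be)) (bdm_intZ rho be) /cost.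
by ring.
Qed.

Lemma cvg_sumR (I : Type) (s : seq I) (u : I -> nat -> R) (l : I -> R) :
  (forall i, u i n @[n --> \oo] --> l i) ->
  \sum_(i <- s) u i n @[n --> \oo] --> \sum_(i <- s) l i.
Proof.
move=> ul; elim: s => [|i s ih].
  by under eq_fun do rewrite big_nil; rewrite big_nil; exact: cvg_cst.
by under eq_fun do rewrite big_cons; rewrite big_cons; exact: cvgD.
Qed.

Variable f : nat -> 'I_N -> R -> R.
Local Notation fi i := (fun n => f n i).
Hypothesis f0 : forall i n t, t \in `[0, T] -> 0 <= f n i t.
Hypothesis fnd : forall i n s t, 0 <= s -> s <= t -> t <= T -> f n i s <= f n i t.
Hypothesis fin : forall i, (liminf_path (fi i) T < +oo)%E.
Hypothesis summ : forall i,
  (\sum_(n <oo) \int[mu]_(t in `[0%R, T]) (`|f n.+1 i t - f n i t|)%:E < +oo)%E.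
Let G i := right_reg T (liminf_path (fi i)).

Lemma pot_integrand_cvg z : {ae mu, forall t, t \in `[0, T] ->
  pot_integrand z (f n) t @[n --> \oo] --> pot_integrand z G t}.
Proof.
have aeF := ae_filter_ringOfSetsType mu.
have H1 : {ae mu, forall t, forall i, t \in `[0, T] -> f n i t @[n --> \oo] --> G i t}.
  by apply: filter_forall => i; exact: (path_ae_cvg T0 (f0 i) (fnd i)).
have H2 : {ae mu, forall t, forall i, t \in `[0, T] ->
    capital_of (delta i) (x0 i) (f n i) t @[n --> \oo] --> capital_of (delta i) (x0 i) (G i) t}.
  by apply: filter_forall => i; exact: (capital_of_cvg T0 (f0 i) (fnd i)).
apply: (@filterS2 _ _ aeF) H1 H2 => t H1 H2 tT.
have Ho i : output (f n) i t @[n --> \oo] --> output G i t.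
  by apply: cvgM; [exact: cvg_cst|exact: H2].
have HS : \sum_i output (f n) i t @[n --> \oo] --> \sum_i output G i t by exact: cvg_sumR.
have HQ : \sum_i output (f n) i t ^+ 2 @[n --> \oo] --> \sum_i output G i t ^+ 2.
  by apply: cvg_sumR => i; rewrite /= expr2; under eq_fun do rewrite expr2; exact: cvgM.
apply: cvgD.
  apply: cvgM; first exact: cvg_cst.
  apply: cvgD.
    apply: cvgB; first exact: cvg_cst.
    by apply: cvgM; first exact: cvg_cst.
  apply: cvgM; first exact: cvg_cst.
  apply: cvgD => //; rewrite expr2; under eq_fun do rewrite expr2; exact: cvgM.
apply: cvg_sumR => i; apply: cvgM; first exact: cvg_cst.
apply: cvgM; first exact: cvg_cst.
apply: cvgM; first exact: cvg_cst.
exact: H1.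
Qed.

(** Fatou's lemma for the time integral, whose integrand converges almost everywhere,
    and superadditivity of lower limits for the terminal costs. *)
Lemma potential_fatou z : bdm T z ->
  ((potential z G)%:E <= limn_einf (fun n => (potential z (f n))%:E))%E.
Proof.
move=> bz.
have bf n : bdmp T (f n) by move=> i; apply: bdm_nd => s t; exact: fnd.
have bG : bdmp T G by move=> i; apply: bdm_nd; exact: (glim_nd T0 (f0 i) (fnd i)).
have G0 i t : t \in `[0, T] -> 0 <= G i t by exact: (glim_ge0 T0 (f0 i) (fnd i)).
have TT : T \in `[0, T] by rewrite in_itv /= lexx ltW.
have I0 n t : t \in `[0, T] -> 0 <= pot_integrand z (f n) t.
  by move=> tT; apply: pot_integrand_ge0 => i; exact: f0.
pose k i := c i * expR (- rho * T).
have k0 i : 0 <= k i by rewrite mulr_ge0 ?expR_ge0// ltW.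
rewrite potential_split// EFinD -bdm_EFin_int; last exact: bdm_pot_integrand.
have -> : (fun n => (potential z (f n))%:E) = (fun n =>
    \int[mu]_(t in `[0%R, T]) (pot_integrand z (f n) t)%:E + \sum_i (k i)%:E * (f n i T)%:E)%E.
  apply/funext => n; rewrite potential_split// EFinD -bdm_EFin_int; last exact: bdm_pot_integrand.
  by rewrite sumEFin.
apply: le_trans (limn_einf_superadd _ _); last 2 first.
- by move=> n; apply: integral_ge0 => t tT; rewrite lee_fin I0.
- by move=> n; apply: sume_ge0 => i _; apply: mule_ge0; rewrite lee_fin ?k0 ?f0.
apply: leeD; last first.
  rewrite -sumEFin; apply: le_trans (limn_einf_sum _ _); last first.
    by move=> i n; apply: mule_ge0; rewrite lee_fin ?k0 ?f0.
  apply: lee_sum => i _; apply: le_trans (limn_einf_scale (k0 i) _); last first.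
    by move=> n; rewrite lee_fin f0.
  have := liminf_pathE (f0 i) (fnd i) (fin i) TT; rewrite /liminf_path => ->.
  by rewrite -EFinM /G (glimT T0 (f0 i) (fnd i) (fin i)).
have mI n : measurable_fun (`[0, T]%classic : set (measurableTypeR R)) (fun t => (pot_integrand z (f n) t)%:E).
  by apply/measurable_EFinP; case: (bdm_pot_integrand bz (bf n)).
apply: le_trans (fatou _ _ _ _); [|exact: measurable_itv|exact: mI|]; last first.
  by move=> n t tT; rewrite lee_fin I0.
rewrite le_eqVlt; apply/orP; left; apply/eqP.
apply: ae_eq_integral; [exact: measurable_itv| | |].
- by apply/measurable_EFinP; case: (bdm_pot_integrand bz bG).
- by apply: measurable_limn_einf => //; exact: measurable_itv.
apply: (@filterS _ _ (ae_filter_ringOfSetsType mu)) (pot_integrand_cvg z) => t H tT.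
apply/esym; apply: (cvg_limn_einf_sup _).1.
by apply: cvg_EFin; [exact: nearW|exact: H].
Qed.

End potential_fatou.

(** * The distance between two profiles *)

Section path_distance.
Context {R : realType} {N : nat}.
Local Notation mu := (@lebesgue_measure R).
Variables (T : R) (T0 : 0 < T) (alpha delta x0 : 'I_N -> R) (gamma rho : R).
Hypotheses (halpha : forall i, 0 < alpha i)
  (hdelta : forall i, 0 < delta i) (hx0 : forall i, 0 <= x0 i)
  (g0 : 0 < gamma) (hrho : 0 < rho).
Local Notation output := (output alpha delta x0).
Local Notation caps p i t := (capital_of (delta i) (x0 i) (p i) t).

(** The defect in potential_midpoint. *)
Definition gap (p p' : 'I_N -> R -> R) :=
  \int[mu]_(t in `[0, T]) (expR (- rho * t) * (gamma / 8 *
    ((\sum_j (output p j t - output p' j t)) ^+ 2 + \sum_j (output p j t - output p' j t) ^+ 2))).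

Definition gap_cst i := expR (- rho * T) * (gamma / 8 * alpha i ^+ 2).

Lemma gap_cst_gt0 i : 0 < gap_cst i.
Proof.
apply: mulr_gt0; first exact: expR_gt0.
by apply: mulr_gt0; [rewrite divr_gt0|rewrite exprn_gt0].
Qed.

Lemma bdm_capital_of_diff p p' i : bdmp T p -> bdmp T p' ->
  bdm T (fun t => caps p i t - caps p' i t).
Proof. by move=> bp bp'; apply: bdmB; apply: bdm_capital_of => //; exact: ltW. Qed.

Lemma gap_ge p p' i : bdmp T p -> bdmp T p' ->
  gap_cst i * \int[mu]_(t in `[0, T]) ((caps p i t - caps p' i t) ^+ 2) <= gap p p'.
Proof.
move=> bp bp'; have bd := bdm_capital_of_diff i bp bp'.
have bo j : bdm T (fun t => output p j t - output p' j t) by apply: bdmB; exact: bdm_output.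
rewrite -(bdm_intZ (gap_cst i) (bdmX 2 bd)); apply: bdm_le_int.
- exact: (bdmM (bdm_cst T (gap_cst i)) (bdmX 2 bd)).
- apply: bdmM; first exact: bdm_expRM.
  apply: (bdmM (bdm_cst T (gamma / 8))); apply: bdmD.
    by apply: bdmX; exact: bdm_sum.
  by apply: bdm_sum => j; exact: bdmX.
move=> t; rewrite in_itv /= => /andP[t_ge0 tT].
have h : alpha i ^+ 2 * (caps p i t - caps p' i t) ^+ 2 <=
    (\sum_j (output p j t - output p' j t)) ^+ 2 + \sum_j (output p j t - output p' j t) ^+ 2.
  rewrite -exprMn mulrBr [X in _ <= _ + X](bigD1 i)//= addrCA lerDl.
  by apply: addr_ge0; [exact: sqr_ge0|apply: sumr_ge0 => j _; exact: sqr_ge0].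
have q0 : 0 < gamma / 8 by rewrite divr_gt0.
rewrite /gap_cst -mulrA -[X in _ * X <= _]mulrA; apply: ler_pM => //.
- by apply: (mulr_ge0 (ltW q0)); apply: mulr_ge0; exact: sqr_ge0.
- by rewrite ler_expR !mulNr lerN2 ler_pM2l.
- by rewrite ler_pM2l.
Qed.

Lemma gap_ge0 p p' : 0 <= gap p p'.
Proof.
apply: Rintegral_ge0 => t _; apply: mulr_ge0; first exact: expR_ge0.
apply: mulr_ge0; first by rewrite divr_ge0// ltW.
by apply: addr_ge0; [exact: sqr_ge0|apply: sumr_ge0 => j _; exact: sqr_ge0].
Qed.

(** The capital equation, solved for the investment path. *)
Lemma investment_of_capital p i t : bdmp T p -> (forall i t, t \in `[0, T] -> 0 <= p i t) ->
  t \in `[0, T] -> p i t =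
  caps p i t - x0 i + delta i * \int[mu]_(s in `[0, t]) caps p i s.
Proof.
move=> bp p0; rewrite in_itv /= => tT.
rewrite (int_capital_of (hdelta i) (hx0 i) tT (bp i) (p0 i)) /capital_of; by ring.
Qed.

Definition dist_cst i := (1 + delta i * T) / 2 * ((gap_cst i)^-1 + T).

(** By investment_of_capital it suffices to compare capitals, and for these
    |y| <= (a y^2 + 1/a) / 2 brings in the gap. The parameter a is free in order to
    be adapted to the size of the gap. *)
Lemma path_dist p p' i a : bdmp T p -> bdmp T p' ->
  (forall i t, t \in `[0, T] -> 0 <= p i t) -> (forall i t, t \in `[0, T] -> 0 <= p' i t) ->
  0 < a -> \int[mu]_(t in `[0, T]) `|p i t - p' i t| <= dist_cst i * (a * gap p p' + a^-1).
Proof.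
move=> bp bp' p0 p0' a0.
have bd := bdm_capital_of_diff i bp bp'; have bn := bdm_norm bd.
set D := (fun t => caps p i t - caps p' i t) in bd bn.
set I := \int[mu]_(t in `[0, T]) `|D t|.
have bc q : bdmp T q -> bdm T (fun t => caps q i t).
  by move=> bq; apply: bdm_capital_of => //; exact: ltW.
have point t : t \in `[0, T] -> `|p i t - p' i t| <= `|D t| + delta i * I.
  move=> tT; rewrite (investment_of_capital i bp p0 tT) (investment_of_capital i bp' p0' tT).
  move: tT; rewrite in_itv /= => /andP[t_ge0 tT].
  rewrite (_ : _ - _ = D t + delta i * \int[mu]_(s in `[0, t]) D s); last first.
    by rewrite (bdm_intB (bdmW tT (bc _ bp)) (bdmW tT (bc _ bp'))) /D; ring.
  apply: (le_trans (ler_normD _ _)); rewrite lerD2l normrM gtr0_norm// ler_pM2l//.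
  apply: (le_trans (le_normr_Rintegral _ (bdm_integrable (bdmW tT bd)))) => //.
  rewrite -lee_fin -(bdm_EFin_int (bdmW tT bn)) -(bdm_EFin_int bn).
  apply: ge0_subset_integral => //=.
  - by apply/measurable_EFinP; case: bn.
  - by move=> s; rewrite /= !in_itv /= => /andP[-> /le_trans ->].
have h1 : \int[mu]_(t in `[0, T]) `|p i t - p' i t| <= (1 + delta i * T) * I.
  apply: (@le_trans _ _ (\int[mu]_(t in `[0, T]) (`|D t| + delta i * I))).
    apply: bdm_le_int => //; first by apply: bdm_norm; exact: bdmB.
    by apply: (bdmD bn); exact: bdm_cst.
  rewrite (bdm_intD bn (bdm_cst T (delta i * I))) (bdm_int_cst _ (ltW T0)).
  by rewrite -/I le_eqVlt; apply/orP; left; apply/eqP; ring.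
have h2 : I <= (a * \int[mu]_(t in `[0, T]) (D t ^+ 2) + a^-1 * T) / 2.
  have bD2 := bdmX 2 bd.
  have -> : (a * \int[mu]_(t in `[0, T]) (D t ^+ 2) + a^-1 * T) / 2 =
      \int[mu]_(t in `[0, T]) (2^-1 * (a * D t ^+ 2 + a^-1)).
    rewrite (bdm_intZ 2^-1 (bdmD (bdmM (bdm_cst T a) bD2) (bdm_cst T a^-1))).
    rewrite (bdm_intD (bdmM (bdm_cst T a) bD2) (bdm_cst T a^-1)) (bdm_intZ a bD2).
    by rewrite (bdm_int_cst _ (ltW T0)) mulrC.
  apply: bdm_le_int => //.
    apply: (bdmM (bdm_cst T 2^-1)); apply: bdmD; last exact: bdm_cst.
    exact: (bdmM (bdm_cst T a) bD2).
  move=> t _; rewrite -(real_normK (num_real (D t))); set y := `|D t|.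
  rewrite -subr_ge0 (_ : _ - _ = (a * y - 1) ^+ 2 / (2 * a)); last first.
    by field; rewrite gt_eqF.
  by rewrite divr_ge0 ?sqr_ge0// mulr_ge0// ltW.
have h3 : \int[mu]_(t in `[0, T]) (D t ^+ 2) <= (gap_cst i)^-1 * gap p p'.
  by rewrite ler_pdivlMl ?gap_cst_gt0//; exact: gap_ge.
have dT : 0 < 1 + delta i * T by rewrite addr_gt0// mulr_gt0.
apply: (le_trans h1); rewrite /dist_cst -!mulrA ler_pM2l//.
apply: (le_trans h2).
have k0 : 0 < (gap_cst i)^-1 by rewrite invr_gt0 gap_cst_gt0.
have G0 := gap_ge0 p p'; have a0' : 0 < a^-1 by rewrite invr_gt0.
move: h3; set k := (gap_cst i)^-1 in k0 *; set G := gap p p' in G0 *; set S := \int[mu]_(t in _) _.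
move=> h3; have h4 : a * S <= a * (k * G) by rewrite ler_pM2l.
rewrite [leLHS]mulrC ler_pM2l// (le_trans (lerD h4 (lexx _)))//.
rewrite -subr_ge0 (_ : _ - _ = k * a^-1 + T * (a * G)); last by ring.
by apply: addr_ge0; [exact: (ltW (mulr_gt0 _ _))|apply: (mulr_ge0 (ltW T0)); exact: (mulr_ge0 (ltW a0))].
Qed.

End path_distance.

(** * Minimizers of the expected potential are equilibria *)

Section game.
Context {R : realType} {d : measure_display} {Omega : measurableType d}.
Local Notation mu := (@lebesgue_measure R).
Variables (P : probability Omega R) (hP : measure_is_complete P).
Variables (T : R) (T0 : 0 < T) (W : R -> Omega -> R) (hW : brownian_motion P T W).
Local Notation F := (augmented_filtration P T W).
Local Notation strategy := (investment_strategy P T F).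
Variables (N : nat) (alpha c delta x0 : 'I_N -> R) (gamma rho : R).
Hypotheses (halpha : forall i, 0 < alpha i) (hc : forall i, 0 < c i)
  (hdelta : forall i, 0 < delta i) (hx0 : forall i, 0 <= x0 i)
  (g0 : 0 < gamma) (hrho : 0 < rho).
Variable X0 : R -> Omega -> R.
Hypotheses (mX0 : jmeas T X0) (bX0 : forall w, bdm T (X0 ^~ w))
  (sX0 : L1 P (fun w => \int[mu]_(t in `[0, T]) (X0 t w ^+ 2))).
Implicit Types (xi : 'I_N -> strategy) (i : 'I_N) (w : Omega).
Local Notation output := (output alpha delta x0).
Local Notation potential := (potential T alpha c delta x0 gamma rho).
Local Notation profit := (profit T alpha c delta x0 gamma rho).

Definition paths xi w i t : R := xi i t w.
Definition potential_at xi w := potential (X0 ^~ w) (paths xi w).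
Definition profit_at i xi w := profit i (X0 ^~ w) (paths xi w).

Lemma strategy_measurable (s : strategy) t : t \in `[0, T] -> measurable_fun setT (s t).
Proof.
move=> tT; apply: (sub_measurable_measurable (F := F t)); last exact: strategy_adapted.
exact: augmented_measurable.
Qed.

Lemma strategy_jmeas (s : strategy) : jmeas T s.
Proof.
apply: jmeas_right_continuous; first by move=> t; exact: strategy_measurable.
by move=> w t tT; have [rc _] := strategy_cadlag s w; exact: rc.
Qed.

Lemma paths_bdm xi w : bdmp T (paths xi w).
Proof. by move=> i; apply: bdm_cadlag; exact: strategy_cadlag. Qed.

Lemma paths_ge0 xi w i t : t \in `[0, T] -> 0 <= paths xi w i t.
Proof. exact: strategy_ge0. Qed.

Lemma jmeas_output xi i : jmeas T (fun t w => output (paths xi w) i t).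
Proof.
apply: jmeasM; first exact: jmeas_cst.
apply: jmeas_capital_of; first by move=> t; exact: strategy_measurable.
by move=> w; exact: strategy_cadlag.
Qed.

Lemma jmeas_exp : jmeas T (fun t (_ : Omega) => expR (- rho * t)).
Proof. by apply: jmeas_fst; exact: bdm_expRM. Qed.

Lemma measurable_cost xi i : measurable_fun setT (fun w => cost T rho (paths xi w i)).
Proof.
have TT : T \in `[0, T] by rewrite in_itv /= lexx ltW.
apply: measurable_funD; first by apply: measurable_funM => //; exact: strategy_measurable.
apply: measurable_funM => //; apply: jmeas_int.
by apply: jmeasM; [exact: jmeas_exp|exact: strategy_jmeas].
Qed.

Lemma jmeas_stage xi : jmeas T (fun t w =>
  expR (- rho * t) * stage gamma (X0 t w) (output (paths xi w) ^~ t)).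
Proof.
have mo := jmeas_output xi.
apply: jmeasM; first exact: jmeas_exp.
apply: jmeasD.
  apply: jmeasB; first by apply: jmeasM; [exact: jmeasX|exact: jmeas_cst].
  by apply: jmeasM => //; exact: jmeas_sum.
apply: jmeasM; first exact: jmeas_cst.
apply: jmeasD; first by apply: jmeasX; exact: jmeas_sum.
by apply: jmeas_sum => i; exact: jmeasX.
Qed.

Lemma measurable_potential_at xi : measurable_fun setT (potential_at xi).
Proof.
apply: measurable_funD; first by apply: jmeas_int; exact: jmeas_stage.
by apply: measurable_sum => i; apply: measurable_funM => //; exact: measurable_cost.
Qed.

Lemma measurable_profit_at i xi : measurable_fun setT (profit_at i xi).
Proof.
have mo := jmeas_output xi.
apply: measurable_funB; last by apply: measurable_funM => //; exact: measurable_cost.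
apply: jmeas_int; apply: jmeasM; first exact: jmeas_exp.
apply: jmeasM => //; apply: jmeasB => //.
by apply: jmeasM; [exact: jmeas_cst|exact: jmeas_sum].
Qed.

Lemma potential_at_ge0 xi w : 0 <= potential_at xi w.
Proof. by apply: potential_ge0 => //; [exact: paths_bdm|exact: paths_ge0]. Qed.

Lemma strategy_integralE (s : strategy) w :
  strategy_integral (fun t => expR (- rho * t)) s w = cost T rho (s ^~ w).
Proof.
rewrite /strategy_integral mulr0 expR0 mul1r stieltjes_exp_parts ?(ltW T0)//.
have E t : t \in `[0, T] -> strategy_path s w t = s t w.
  rewrite in_itv /= => /andP[t0 tT].
  by rewrite /strategy_path /clamp (min_l tT) (max_r t0).
rewrite /= !E ?in_itv /= ?lexx ?(ltW T0)// /cost.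
rewrite (_ : \int[mu]_(t in `[0, T]) (expR (- rho * t) * strategy_path s w t) =
  \int[mu]_(t in `[0, T]) (expR (- rho * t) * s t w)); last first.
  by apply: itv_eq_int => t tT; rewrite E.
by ring.
Qed.

(** Path by path, capital and cost have explicit forms. *)
Lemma net_profitE i xi w : net_profit X0 alpha c delta x0 gamma rho i xi w = profit_at i xi w.
Proof.
rewrite /net_profit strategy_integralE; congr (_ - _).
apply: itv_eq_int => t tT.
have E j : capital delta x0 xi j t w = capital_of (delta j) (x0 j) (paths xi w j) t.
  apply: capital_pathE => //; first exact: strategy_cadlag.
  by move=> s; exact: strategy_ge0.
rewrite /payoff /output E -!mulrA; congr (_ * (_ * (_ * (_ - _ * _)))).
by apply: eq_bigr => j _; rewrite E.
Qed.

Lemma potential_profit_at i xi xi' w : (forall j, j != i -> xi' j = xi j) ->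
  profit_at i xi' w + potential_at xi' w = profit_at i xi w + potential_at xi w.
Proof.
move=> E; apply: potential_profit => //; try exact: paths_bdm.
by move=> j ji; apply/funext => t; rewrite /paths E.
Qed.

Lemma profit_at_L1 i xi : L1 P (potential_at xi) -> L1 P (profit_at i xi).
Proof.
move=> ip.
have H w : `|profit_at i xi w| <= (1 / gamma + 4 * gamma + 1) * potential_at xi w +
    \int[mu]_(t in `[0, T]) (X0 t w ^+ 2).
  by apply: profit_le => //; [exact: paths_bdm|exact: paths_ge0].
apply: (L1_le _ H); first exact: measurable_profit_at.
exact: (L1D (L1Z _ ip) sX0).
Qed.

Definition expected_potential xi : \bar R := (\int[P]_w (potential_at xi w)%:E)%E.

Lemma expected_potential_L1 xi : (expected_potential xi < +oo)%E -> L1 P (potential_at xi).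
Proof.
move=> H; apply/integrableP; split.
  by apply/measurable_EFinP; exact: measurable_potential_at.
apply: le_lt_trans H; apply: ge0_le_integral => //.
- by apply: measurableT_comp => //; apply/measurable_EFinP; exact: measurable_potential_at.
- by apply/measurable_EFinP; exact: measurable_potential_at.
- by move=> w _ /=; rewrite lee_fin ger0_norm ?potential_at_ge0.
Qed.

(** The expected profit of a deviation with infinite expected potential. *)
Lemma integral_sub_ninfty (h q : Omega -> R) : L1 P h -> measurable_fun setT q ->
  (forall w, 0 <= q w) -> ~ L1 P q -> (\int[P]_w (h w - q w)%:E = -oo)%E.
Proof.
move=> ih mq q0 nq; have mh := L1_measurable ih.
have mk : measurable_fun setT (fun w => h w - q w) by exact: measurable_funB.
rewrite integralE.
have pf : (\int[P]_w (fun w => (h w - q w)%:E)^\+ w < +oo)%E.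
  apply: (@le_lt_trans _ _ (\int[P]_w (`|h w|)%:E)%E); last first.
    by have /integrableP[_] := L1_norm ih; under eq_integral do rewrite /= normr_id.
  apply: ge0_le_integral => //.
  - by apply: measurable_funepos; exact/measurable_EFinP.
  - by apply/measurable_EFinP; exact: measurableT_comp.
  move=> w _; rewrite funeposE /maxe; case: ifPn => _; rewrite lee_fin//.
  by rewrite (le_trans _ (ler_norm _))// lerBlDr lerDl.
have [nf|nf] := ltP (\int[P]_w (fun w => (h w - q w)%:E)^\- w)%E +oo%E; last first.
  move: nf; rewrite leye_eq => /eqP ->.
  by rewrite addeNy.
exfalso; apply: nq.
have ik : L1 P (fun w => h w - q w).
  have part g : measurable_fun setT g -> (forall w, 0 <= g w)%E ->
      (\int[P]_w g w < +oo)%E -> P.-integrable setT g.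
    move=> mg g_ge0 gf; apply/integrableP; split => //.
    by under eq_integral do rewrite gee0_abs//.
  have mkE : measurable_fun setT (fun w => (h w - q w)%:E) by exact/measurable_EFinP.
  have ipos := part _ (measurable_funepos mkE) (funepos_ge0 _) pf.
  have ineg := part _ (measurable_funeneg mkE) (funeneg_ge0 _) nf.
  have := integrableB measurableT ipos ineg; apply: eq_integrable => // w _.
  by rewrite /= [RHS](congr1 (fun u => u w) (funeposneg (fun w => (h w - q w)%:E))).
have := L1B ih ik; apply: eq_integrable => // w _ /=.
by congr (_%:E); ring.
Qed.

(** When one firm deviates, its profit changes by minus the change of the potential.
    A deviation of infinite expected potential has expected profit -oo. *)
Lemma minimizer_nash xi : (expected_potential xi < +oo)%E ->
  (forall xi', (expected_potential xi <= expected_potential xi')%E) ->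
  nash_equilibrium X0 alpha c delta x0 gamma rho xi.
Proof.
move=> fin min i s; set xi' := [eta xi with i |-> s].
have EP zeta : expected_profit X0 alpha c delta x0 gamma rho i zeta =
    (\int[P]_w (profit_at i zeta w)%:E)%E.
  by apply: eq_integral => w _; rewrite net_profitE.
rewrite (EP xi) (EP xi').
have ip := expected_potential_L1 fin.
have inp := profit_at_L1 i ip.
have E w : profit_at i xi' w = (profit_at i xi w + potential_at xi w) - potential_at xi' w.
  by rewrite -(@potential_profit_at i xi xi') ?addrK// => j ji; rewrite /xi' /= (negbTE ji).
under eq_integral do rewrite E.
have ih := L1D inp ip.
have [ip'|nip'] := pselect (L1 P (potential_at xi')); last first.
  rewrite (integral_sub_ninfty ih) ?leNye//; [exact: measurable_potential_at|exact: potential_at_ge0].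
rewrite (exp_EFin (L1B ih ip')) (exp_EFin inp) lee_fin expB// expD//.
rewrite lerBlDr lerD2l.
by move: (min xi'); rewrite /expected_potential (exp_EFin ip) (exp_EFin ip') lee_fin.
Qed.

Let F_sigma t : sigma_algebra setT (F t).
Proof. exact: augmented_sigma_algebra. Qed.

Lemma strategy_L1 (s : strategy) : L1 P (s T).
Proof.
have TT : T \in `[0, T] by rewrite in_itv /= lexx ltW.
apply/integrableP; split; first by apply/measurable_EFinP; exact: strategy_measurable.
apply: le_lt_trans (strategy_integrable s); rewrite le_eqVlt; apply/orP; left; apply/eqP.
by apply: eq_integral => w _; rewrite /= ger0_norm// strategy_ge0.
Qed.

Lemma zero_strategy : exists s : strategy, forall t w, s t w = 0.
Proof.
unshelve eexists (@InvestmentStrategy _ _ _ P T F (fun _ _ => 0) _ _ _ _ _) => //.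
- by move=> t _; exact: sub_measurable_cst.
- by move=> w; split=> t _; [exact: cvg_cst|exact: is_cvg_cst].
- by rewrite integral0.
Qed.

Lemma midpoint_strategy (s s' : strategy) :
  exists m : strategy, forall t w, m t w = (s t w + s' t w) / 2.
Proof.
unshelve eexists (@InvestmentStrategy _ _ _ P T F (fun t w => (s t w + s' t w) / 2) _ _ _ _ _) => //.
- move=> t tT; apply: sub_measurableM => //; last exact: sub_measurable_cst.
  by apply: sub_measurableD => //; exact: strategy_adapted.
- by move=> w t tT; rewrite divr_ge0// addr_ge0// strategy_ge0.
- move=> w a b a0 ab bT; rewrite ler_pM2r// lerD//; exact: strategy_nondecreasing.
- move=> w; have [r l] := strategy_cadlag s w; have [r' l'] := strategy_cadlag s' w.
  split=> t tT; first by apply: cvgM; [apply: cvgD; [exact: r|exact: r']|exact: cvg_cst].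
  by apply: is_cvgM; [apply: is_cvgD; [exact: l|exact: l']|exact: is_cvg_cst].
- have := L1Z 2^-1 (L1D (strategy_L1 s) (strategy_L1 s')) => H.
  by under eq_integral do rewrite mulrC; rewrite (exp_EFin H) ltry.
Qed.

(** * Existence of a minimizer *)

(** Without investment the outputs are deterministic and bounded, and the demand is
    square integrable. *)
Lemma finite_potential : exists xi, (expected_potential xi < +oo)%E.
Proof.
have [s s0] := zero_strategy; exists (fun=> s).
pose y i t := output (fun _ _ => 0) i t.
have by_ i : bdm T (y i) by apply: bdm_output => // j; exact: bdm_cst.
pose B t := (1 / 2 + gamma / 2) * (\sum_j y j t) ^+ 2 + gamma / 2 * \sum_j y j t ^+ 2.
have bB : bdm T B.
  apply: bdmD.
    by apply: (bdmM (bdm_cst T (1 / 2 + gamma / 2))); apply: bdmX; exact: bdm_sum.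
  by apply: (bdmM (bdm_cst T (gamma / 2))); apply: bdm_sum => j; exact: bdmX.
pose K := 1 / gamma + 1 / 2.
have bound w : potential_at (fun=> s) w <=
    K * \int[mu]_(t in `[0, T]) (X0 t w ^+ 2) + \int[mu]_(t in `[0, T]) B t.
  have p0 : paths (fun=> s) w = (fun _ _ => 0).
    by apply/funext => i; apply/funext => t; rewrite /paths s0.
  rewrite /potential_at p0 /potential big1 ?addr0; last first.
    move=> i _; rewrite /cost mulr0 (itv_eq_int (g := cst 0)) ?(bdm_int_cst _ (ltW T0))//.
      by rewrite mul0r !mulr0 addr0 mulr0.
    by move=> t _; rewrite mulr0.
  have bX2 := bdmX 2 (bX0 w).
  rewrite -(bdm_intZ K bX2) -(bdm_intD (bdmM (bdm_cst T K) bX2) bB).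
  apply: bdm_le_int; first exact: bdm_stage.
    by apply: bdmD => //; exact: (bdmM (bdm_cst T K) bX2).
  move=> t; rewrite in_itv /= => /andP[t0 _]; apply: le_trans (stage_le g0 _ _).
  rewrite -[leRHS]mul1r ler_wpM2r ?stage_ge0// -expR0 ler_expR mulNr oppr_le0 mulr_ge0//.
  exact: ltW.
have ib : L1 P (potential_at (fun=> s)).
  apply: (L1_le _ _ (L1D (L1Z K sX0) (L1_cst P _))); first exact: measurable_potential_at.
  by move=> w; rewrite ger0_norm ?potential_at_ge0//; exact: bound.
by rewrite /expected_potential (exp_EFin ib) ltry.
Qed.

(** The L1 distance between consecutive terms of the minimizing sequence will be of
    the order of the square root of this tolerance, hence summable. *)
Definition eps n : R := ((2 ^ n.+1)%:R^-1) ^+ 2.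

Lemma eps_gt0 n : 0 < eps n.
Proof. by rewrite exprn_gt0// invr_gt0 ltr0n expn_gt0. Qed.

Lemma eps_ni n : eps n.+1 <= eps n.
Proof.
rewrite lerXn2r ?nnegrE ?invr_ge0 ?ler0n// lef_pV2 ?posrE ?ltr0n ?expn_gt0//.
by rewrite ler_nat leq_exp2l.
Qed.

Lemma minimizing_sequence : exists f : nat -> 'I_N -> strategy,
  (forall n, expected_potential (f n) < +oo)%E /\
  (forall n xi, expected_potential (f n) <= expected_potential xi + (eps n)%:E)%E.
Proof.
pose S := [set expected_potential xi | xi in [set: 'I_N -> strategy]].
have J0 xi : (0 <= expected_potential xi)%E by apply: integral_ge0 => w _; rewrite lee_fin potential_at_ge0.
have [z zfin] := finite_potential.
have Sfin : ereal_inf S \is a fin_num.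
  rewrite ge0_fin_numE; last by apply: le_ereal_inf_tmp => _ [xi _ <-].
  apply: le_lt_trans zfin; apply: ge_ereal_inf; exists (expected_potential z) => //.
  by exists z.
have /choice[f Hf] n : exists xi, (expected_potential xi < ereal_inf S + (eps n)%:E)%E.
  by have [_ [xi _ <-] H] := lb_ereal_inf_adherent (eps_gt0 n) Sfin; exists xi.
exists f; split=> [n|n xi].
  by apply: (lt_trans (Hf n)); rewrite -(fineK Sfin) -EFinD ltry.
apply: ltW; apply: (lt_le_trans (Hf n)); apply: leeD2r.
by apply: ge_ereal_inf; exists (expected_potential xi) => //; exists xi.
Qed.

Section limit_of_minimizing_sequence.
Variable f : nat -> 'I_N -> strategy.
Hypothesis f_fin : forall n, (expected_potential (f n) < +oo)%E.
Hypothesis f_min : forall n xi, (expected_potential (f n) <= expected_potential xi + (eps n)%:E)%E.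
Local Notation gapw n w := (gap T alpha delta x0 gamma rho (paths (f n.+1) w) (paths (f n) w)).
Local Notation "''E' X" := (\int[P]_w X w) (at level 10, X at level 8).

(** The midpoint of two consecutive terms is itself a competitor, so its expected
    potential cannot fall short of theirs by more than eps n. *)
Lemma expected_gap_le n : L1 P (fun w => gapw n w) /\ 'E (fun w => gapw n w) <= eps n.
Proof.
have /choice[m Hm] i : exists m : strategy, forall t w, m t w = (f n.+1 i t w + f n i t w) / 2.
  exact: midpoint_strategy.
have mid w : potential_at m w + gapw n w = (potential_at (f n.+1) w + potential_at (f n) w) / 2.
  rewrite -(potential_midpoint T0 alpha c delta x0 rho g0 (bX0 w) (paths_bdm _ w) (paths_bdm _ w)).
  congr (_ + _); congr (potential _ _); apply/funext => i; apply/funext => t.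
  exact: Hm.
have i1 := expected_potential_L1 (f_fin n.+1); have i0 := expected_potential_L1 (f_fin n).
have ih := L1Z 2^-1 (L1D i1 i0).
have G0 w : 0 <= gapw n w by exact: gap_ge0.
have im : L1 P (potential_at m).
  apply: (L1_le _ _ ih); first exact: measurable_potential_at.
  by move=> w; rewrite ger0_norm ?potential_at_ge0// mulrC -mid lerDl.
have E : (fun w => gapw n w) = (fun w => 2^-1 * (potential_at (f n.+1) w + potential_at (f n) w) - potential_at m w).
  by apply/funext => w; rewrite mulrC -mid addrC addKr.
have ig : L1 P (fun w => gapw n w) by rewrite E; exact: L1B.
split=> //; rewrite E (expB ih im) (expZ _ (L1D i1 i0)) (expD i1 i0).
have H k : L1 P (potential_at (f k)) -> 'E (potential_at (f k)) <= 'E (potential_at m) + eps k.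
  by move=> ik; have := f_min k m; rewrite /expected_potential (exp_EFin ik) (exp_EFin im) -EFinD lee_fin.
have := H _ i1; have := H _ i0; have := eps_ni n.
set a := 'E _; set b := 'E _; set e := 'E _; move: a b e => a b e; lra.
Qed.


(** In path_dist the choice a = 2^(n+1) gives an expected distance of order
    2^-(n+1). *)
Lemma summable_ae : {ae P, forall w, forall i,
  (\sum_(n <oo) \int[mu]_(t in `[0%R, T]) (`|f n.+1 i t w - f n i t w|)%:E < +oo)%E}.
Proof.
apply: filter_forall => i.
pose g n w := (\int[mu]_(t in `[0%R, T]) (`|f n.+1 i t w - f n i t w|)%:E)%E.
have mg n : measurable_fun setT (g n).
  apply: (@jmeas_eint _ _ _ T (fun t w => `|f n.+1 i t w - f n i t w|)) => //.
  by apply: jmeas_norm; apply: jmeasB; exact: strategy_jmeas.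
have gn0 n w : (0 <= g n w)%E by apply: integral_ge0 => t _; rewrite lee_fin.
pose A := 2 * dist_cst T alpha delta gamma rho i.
have dc0 : 0 <= dist_cst T alpha delta gamma rho i.
  have k0 : 0 < gap_cst T alpha gamma rho i by exact: gap_cst_gt0.
  apply: mulr_ge0; last by rewrite addr_ge0 ?(ltW T0)// invr_ge0 ltW.
  by rewrite divr_ge0// addr_ge0// mulr_ge0// ltW.
have A0 : 0 <= A by rewrite mulr_ge0.
have gE n : (\int[P]_w g n w <= (A / (2 ^ n.+1)%:R)%:E)%E.
  have [ig Hg] := expected_gap_le n.
  (* The gap is of order a^-2, so that both terms of path_dist are of order a^-1. *)
  pose a : R := (2 ^ n.+1)%:R.
  have a0 : 0 < a by rewrite ltr0n expn_gt0.
  have ih := L1Z (dist_cst T alpha delta gamma rho i) (L1D (L1Z a ig) (L1_cst P a^-1)).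
  apply: (@le_trans _ _ (\int[P]_w (dist_cst T alpha delta gamma rho i *
      (a * gapw n w + a^-1))%:E)%E).
    apply: ge0_le_integral => //.
    - exact: (measurable_int P ih).
    - move=> w _; rewrite /g bdm_EFin_int; last first.
        by apply: bdm_norm; apply: bdmB; exact: (paths_bdm _ w i).
      rewrite lee_fin; apply: path_dist => //; try exact: paths_bdm.
        by move=> j t; exact: paths_ge0.
      by move=> j t; exact: paths_ge0.
  rewrite (exp_EFin ih) lee_fin (expZ _ (L1D (L1Z a ig) (L1_cst P a^-1))).
  rewrite (expD (L1Z a ig) (L1_cst P a^-1)) (expZ _ ig) exp_cst -/a /A.
  rewrite [leRHS](_ : _ = dist_cst T alpha delta gamma rho i * (a^-1 + a^-1)); last by ring.
  apply: ler_wpM2l => //; rewrite lerD2r.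
  rewrite [leRHS](_ : _ = a * (a^-1 ^+ 2)); last by field; rewrite gt_eqF.
  by rewrite ler_pM2l.
have iS : P.-integrable setT (fun w => \sum_(n <oo) g n w)%E.
  apply/integrableP; split.
    by apply: ge0_emeasurable_sum => // n w _ _; exact: gn0.
  under eq_integral do rewrite gee0_abs ?nneseries_ge0//.
  rewrite integral_nneseries//.
  apply: (@le_lt_trans _ _ (\sum_(n <oo) (A / (2 ^ n.+1)%:R)%:E)%E).
    by apply: lee_nneseries => [n _ _|n _]; [exact: integral_ge0|exact: gE].
  by apply: le_lt_trans (epsilon_trick0 _ A0) _; rewrite ltry.
have := integrable_ae measurableT iS; apply: filterS => w /(_ I).
by rewrite ge0_fin_numE// nneseries_ge0.
Qed.

Definition liminf_potential w : \bar R := limn_einf (fun n => (potential_at (f n) w)%:E).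

Lemma measurable_liminf_potential : measurable_fun setT liminf_potential.
Proof.
apply: measurable_limn_einf => // n; apply/measurable_EFinP; exact: measurable_potential_at.
Qed.

Lemma liminf_potential_ge0 w : (0 <= liminf_potential w)%E.
Proof. by apply: limn_einf_ge0 => n; rewrite lee_fin potential_at_ge0. Qed.

Lemma eps_cvg0 : eps n @[n --> \oo] --> 0.
Proof.
have h : (fun n => (2 ^ n.+1)%:R^-1 : R) @ \oo --> 0.
  have -> : (fun n => (2 ^ n.+1)%:R^-1 : R) = (fun n => geometric 2^-1 2^-1 n).
    by apply/funext => n; rewrite /geometric /= natrX exprS invfM exprVn.
  by apply: cvg_geometric; rewrite ger0_norm ?invr_ge0// invf_lt1// ltr1n.
rewrite (_ : 0 = 0 * 0 :> R); last by rewrite mulr0.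
by rewrite /eps; under eq_fun do rewrite expr2; exact: cvgM.
Qed.

(** Fatou's lemma, as the sequence is minimizing up to eps n, which tends to 0. *)
Lemma exp_liminf_potential_le xi : (\int[P]_w liminf_potential w <= expected_potential xi)%E.
Proof.
apply: (@le_trans _ _ (limn_einf (fun n => expected_potential (f n)))).
  apply: fatou => // n; first by apply/measurable_EFinP; exact: measurable_potential_at.
  by move=> w _; rewrite lee_fin potential_at_ge0.
have [xifin|] := ltP (expected_potential xi) +oo%E; last by rewrite leye_eq => /eqP ->; exact: leey.
apply: (@le_trans _ _ (limn_einf (fun n => expected_potential xi + (eps n)%:E)%E)).
  by apply: le_limn_einf => n; exact: f_min.
rewrite le_eqVlt; apply/orP; left; apply/eqP.
apply: (cvg_limn_einf_sup _).1.
have ix := expected_potential_L1 xifin; rewrite /expected_potential (exp_EFin ix).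
under eq_fun do rewrite -EFinD.
apply: cvg_EFin; first exact: nearW.
rewrite -[X in _ --> X]addr0; apply: cvgD; [exact: cvg_cst|exact: eps_cvg0].
Qed.

Lemma exp_liminf_potential_fin : (\int[P]_w liminf_potential w < +oo)%E.
Proof. exact: le_lt_trans (exp_liminf_potential_le (f 0%N)) (f_fin 0%N). Qed.

Local Notation seq_path i w := (fun n t => f n i t w).
Definition finite_limit i : set Omega := [set w | (liminf_path (seq_path i w) T < +oo)%E].

Let k i := c i * expR (- rho * T).
Let k0 i : 0 < k i. Proof. by rewrite mulr_gt0// expR_gt0. Qed.
Let TT : T \in `[0, T]. Proof. by rewrite in_itv /= lexx ltW. Qed.
Let fp0 i w n t : t \in `[0, T] -> 0 <= seq_path i w n t. Proof. exact: strategy_ge0. Qed.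
Let fpnd i w n s t : 0 <= s -> s <= t -> t <= T -> seq_path i w n s <= seq_path i w n t.
Proof. exact: strategy_nondecreasing. Qed.

(** potential_terminal in the limit. *)
Lemma liminf_path_le_potential i w : ((k i)%:E * liminf_path (seq_path i w) T <= liminf_potential w)%E.
Proof.
apply: le_trans (limn_einf_scale (ltW (k0 i)) _) _; first by move=> n; rewrite lee_fin fp0.
apply: le_limn_einf => n; rewrite -EFinM lee_fin -mulrA.
by apply: potential_terminal => //; [exact: paths_bdm|move=> j t; exact: paths_ge0].
Qed.

Lemma liminf_potential_finite_limit i w : (liminf_potential w < +oo)%E -> finite_limit i w.
Proof.
move=> /(le_lt_trans (liminf_path_le_potential i w)); rewrite /finite_limit /=.
have : (0 <= liminf_path (seq_path i w) T)%E by apply: limn_einf_ge0 => n; rewrite lee_fin fp0.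
by case: (liminf_path _ _) => [r _ _|_|//]; [exact: ltry|rewrite gt0_muley ?lte_fin].
Qed.

Lemma liminf_potential_fin_ae : {ae P, forall w, (liminf_potential w < +oo)%E}.
Proof.
have iL : P.-integrable setT liminf_potential.
  apply/integrableP; split; first exact: measurable_liminf_potential.
  by under eq_integral do rewrite gee0_abs ?liminf_potential_ge0//; exact: exp_liminf_potential_fin.
have := integrable_ae measurableT iL; apply: filterS => w /(_ I).
by rewrite ge0_fin_numE ?liminf_potential_ge0.
Qed.

Lemma finite_limit_negligible i : P.-negligible (~` finite_limit i).
Proof.
apply: negligibleS liminf_potential_fin_ae => w /= ng L; apply: ng.
exact: liminf_potential_finite_limit.
Qed.

(** Every path of a strategy has to be finite, nondecreasing and cadlag, hence the
    value 0 in the states where the lower limit is infinite, a negligible set. *)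
Definition limit_process i t w := right_reg T (liminf_path (seq_path i w)) t * \1_(finite_limit i) w.

(** The value at t is a limit of values at times node t m, which precede any given
    s > t from some index on; right continuity of the filtration then allows s to
    decrease to t. The states where the limit is infinite form a negligible set,
    hence belong to the augmented filtration. *)
Lemma limit_process_adapted i : adapted T F (limit_process i).
Proof.
move=> t tT A mA s /=; rewrite in_itv /= andbT => ts.
move: A mA; rewrite -/(sub_measurable _ _).
set aug := <<s _ >>.
have sa : sigma_algebra setT aug by exact: smallest_sigma_algebra.
have [n0 Hn0] := @node_lt _ T _ _ ts.
move: (tT); rewrite in_itv /= => tT'.
pose u w m := liminf_path (seq_path i w) (node T t m).
have mu_ m : (n0 <= m)%N -> @measurable_fun _ _ (g_sigma_algebraType aug) _ setT (u ^~ m).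
  move=> nm; apply: measurable_limn_einf => // n; apply/measurable_EFinP.
  apply/(sub_measurableP _ sa); apply: (sub_measurableS (F := F (node T t m))).
    by apply: augmented_aug; exact: Hn0.
  by apply: strategy_adapted; rewrite in_itv /=; exact: node_itv.
(* The values decrease along the nodes, so the limit exists and may be taken from n0 on. *)
have ul w : limn (u w) = limn_einf (fun m => u w (m + n0)%N).
  have cu : cvgn (u w).
    apply: ereal_nonincreasing_is_cvgn => m n mn; apply: le_limn_einf => j; rewrite lee_fin.
    apply: fpnd; [by case/andP: (node_itv T0 n tT')|exact: node_ni|by case/andP: (node_itv T0 m tT')].
  apply/esym; apply: (cvg_limn_einf_sup _).1.
  by rewrite (cvg_shiftn n0 (u w) _).
apply: sub_measurableM => //.
  apply/(sub_measurableP _ sa); rewrite /right_reg.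
  under eq_fun do rewrite ul.
  by apply: measurableT_comp => //; apply: measurable_limn_einf => // m; apply: mu_; exact: leq_addl.
apply/(sub_measurableP _ sa); apply: measurable_indic.
rewrite -(setCK (finite_limit i)); apply: measurableC.
apply: sub_sigma_algebra; apply: sub_sigma_algebra; right; exact: finite_limit_negligible.
Qed.

Lemma limit_process_finite i w : finite_limit i w ->
  limit_process i ^~ w = right_reg T (liminf_path (seq_path i w)).
Proof. by move=> gw; apply/funext => t; rewrite /limit_process indicE mem_set ?mulr1. Qed.

Lemma limit_process_infinite i w : ~ finite_limit i w -> limit_process i ^~ w = cst 0.
Proof. by move=> gw; apply/funext => t; rewrite /limit_process indicE memNset ?mulr0. Qed.

Lemma limit_process_ge0 i w t : t \in `[0, T] -> 0 <= limit_process i t w.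
Proof.
move=> tT; have [gw|bw] := pselect (finite_limit i w).
  by rewrite (congr1 (@^~ t) (limit_process_finite gw)); apply: (glim_ge0 T0 (fp0 i w) (fpnd i w)).
by rewrite (congr1 (@^~ t) (limit_process_infinite bw)).
Qed.

(** Integrability at T follows from liminf_path_le_potential. *)
Lemma limit_strategy : exists xi, forall i, strategy_process (xi i) = limit_process i.
Proof.
suff /choice[xi Hxi] : forall i, exists s : strategy, strategy_process s = limit_process i.
  by exists xi.
move=> i.
have nd w s t : 0 <= s -> s <= t -> t <= T -> limit_process i s w <= limit_process i t w.
  move=> s0 st tT; have [gw|bw] := pselect (finite_limit i w).
    rewrite (congr1 (@^~ s) (limit_process_finite gw)) (congr1 (@^~ t) (limit_process_finite gw)).
    exact: (glim_nd T0 (fp0 i w) (fpnd i w)).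
  by rewrite (congr1 (@^~ s) (limit_process_infinite bw)) (congr1 (@^~ t) (limit_process_infinite bw)).
have cad w : cadlag T (limit_process i ^~ w).
  have [gw|bw] := pselect (finite_limit i w).
    by rewrite (limit_process_finite gw); exact: (glim_cadlag T0 (fp0 i w) (fpnd i w)).
  by rewrite (limit_process_infinite bw); split=> t _; [exact: cvg_cst|exact: is_cvg_cst].
have mT : measurable_fun setT (limit_process i T).
  apply: (sub_measurable_measurable (F := F T)); first exact: augmented_measurable.
  exact: limit_process_adapted.
have int : (\int[P]_w (limit_process i T w)%:E < +oo)%E.
  apply: (@le_lt_trans _ _ (\int[P]_w ((k i)^-1%:E * liminf_potential w))%E).
    apply: ge0_le_integral => //.
    - by move=> w _; rewrite lee_fin limit_process_ge0.
    - exact/measurable_EFinP.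
    - by apply: emeasurable_funM => //; exact: measurable_liminf_potential.
    move=> w _; have [gw|bw] := pselect (finite_limit i w); last first.
      rewrite (congr1 (@^~ T) (limit_process_infinite bw)).
      by rewrite mule_ge0 ?liminf_potential_ge0// lee_fin invr_ge0 ltW.
    rewrite (congr1 (@^~ T) (limit_process_finite gw)) (glimT T0 (fp0 i w) (fpnd i w) gw).
    rewrite -(liminf_pathE (fp0 i w) (fpnd i w) gw TT) lee_pdivlMl//.
    exact: liminf_path_le_potential.
  rewrite ge0_integralZl_EFin//; last 3 first.
  - by move=> w _; exact: liminf_potential_ge0.
  - exact: measurable_liminf_potential.
  - by rewrite invr_ge0 ltW.
  by rewrite lte_mul_pinfty ?exp_liminf_potential_fin// lee_fin invr_ge0 ltW.
by exists (InvestmentStrategy (@limit_process_adapted i) (@limit_process_ge0 i) nd cad int).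
Qed.

Lemma limit_minimizes xi : (forall i, strategy_process (xi i) = limit_process i) ->
  (expected_potential xi <= \int[P]_w liminf_potential w)%E.
Proof.
move=> Exi; apply: ae_ge0_le_integral => //.
- by move=> w _; rewrite lee_fin potential_at_ge0.
- by apply/measurable_EFinP; exact: measurable_potential_at.
- by move=> w _; exact: liminf_potential_ge0.
- exact: measurable_liminf_potential.
apply: filterS2 summable_ae liminf_potential_fin_ae => w S L _.
have gw i : finite_limit i w by exact: liminf_potential_finite_limit.
rewrite /potential_at (_ : paths xi w = fun i => right_reg T (liminf_path (seq_path i w))); last first.
  by apply/funext => i; rewrite -(limit_process_finite (gw i)) /paths Exi.
apply: (@potential_fatou _ _ T T0 alpha c delta x0 gamma rho hc g0 hrho (fun n => paths (f n) w)) => //.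
- by move=> i n t; exact: fp0.
- by move=> i n s t; exact: fpnd.
Qed.

End limit_of_minimizing_sequence.

Lemma minimizer_exists : exists xi, (expected_potential xi < +oo)%E /\
  forall xi', (expected_potential xi <= expected_potential xi')%E.
Proof.
have [f [f_fin f_min]] := minimizing_sequence.
have [xi Exi] := limit_strategy f_fin f_min.
have H xi' : (expected_potential xi <= expected_potential xi')%E.
  by apply: (@le_trans _ _ (\int[P]_w liminf_potential f w)%E); [exact: limit_minimizes|exact: exp_liminf_potential_le].
by exists xi; split=> //; exact: le_lt_trans (H (f 0%N)) (f_fin 0%N).
Qed.

Lemma nash_exists : exists xi : 'I_N -> strategy,
  nash_equilibrium X0 alpha c delta x0 gamma rho xi.
Proof. by have [xi [fin min]] := minimizer_exists; exists xi; exact: minimizer_nash. Qed.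

End game.

(** * Existence of an equilibrium *)

Theorem theorem4p1 (R : realType) (d : measure_display)
    (Omega : measurableType d) (P : probability Omega R)
    (hP : measure_is_complete P)
    (N : nat) (hN : (2 <= N)%N) (T : R) (hT : 0 < T)
    (W0 : R -> Omega -> R) (hW0 : brownian_motion P T W0)
    (mu0 sigma0 : R -> R -> R)
    (hmu0 : [lipschitz (mu0 p.1 p.2) | p in `[0, T]%classic `*` [set: R]])
    (hsigma0 : [lipschitz (sigma0 p.1 p.2) | p in `[0, T]%classic `*` [set: R]])
    (sigma_lo sigma_hi : R) (hsigma_lo : 0 < sigma_lo)
    (hsigma : forall t x : R, t \in `[0, T] -> sigma_lo <= sigma0 t x <= sigma_hi)
    (x00 : R) (X0 : R -> Omega -> R)
    (hX0 : sde_solution P T (augmented_filtration P T W0) W0 mu0 sigma0 x00 X0)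
    (alpha c delta x0 : 'I_N -> R) (gamma rho : R)
    (halpha : forall i, 0 < alpha i) (hc : forall i, 0 < c i)
    (hdelta : forall i, 0 < delta i) (hx0 : forall i, 0 <= x0 i)
    (hgamma : 0 < gamma) (hrho : 0 < rho) :
  exists xi : 'I_N -> investment_strategy P T (augmented_filtration P T W0),
    nash_equilibrium X0 alpha c delta x0 gamma rho xi.

Proof.
have mX0 := sde_jmeas hP hW0 hX0.
have bX0 w : bdm T (X0 ^~ w) by apply: bdm_continuous; exact: (sde_continuous hX0).
have bX2 w := bdmX 2 (bX0 w).
have bound t x : t \in `[0, T] -> `|sigma0 t x| <= sigma_hi.
  move=> /(hsigma t x) /andP[lo hi].
  by rewrite gtr0_norm// (lt_le_trans hsigma_lo).
have sX0 : L1 P (fun w => \int[lebesgue_measure]_(t in `[0, T]) (X0 t w ^+ 2)).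
  have m2 := jmeas_int (jmeasX 2 mX0).
  apply/integrableP; split; first exact/measurable_EFinP.
  apply: le_lt_trans (sde_square_integrable hP hT hW0 hmu0 hsigma0 bound hX0).
  rewrite le_eqVlt; apply/orP; left; apply/eqP; apply: eq_integral => w _.
  rewrite /= ger0_norm; first by rewrite bdm_EFin_int.
  by apply: Rintegral_ge0 => t _; exact: sqr_ge0.
exact: (nash_exists hP hT hW0 halpha hc hdelta hx0 hgamma hrho mX0 bX0 sX0).
Qed.
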